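(* Fix natural numbers $k$ and $m$. The following two problems are decidable. (1) The $k,m$-deterministic separability problem: given two nondeterministic timed automata $\mathcal{A}$ and $\mathcal{B}$ with $\varepsilon$-transitions over the same finite alphabet $\Sigma$, decide whether there exists a deterministic timed automaton $\mathcal{S}$ with at most $k$ clocks and all constants in clock constraints bounded in absolute value by $m$ such that $L(\mathcal{A}) \subseteq L(\mathcal{S})$ and $L(\mathcal{S}) \cap L(\mathcal{B}) = \emptyset$. (2) The $k$-deterministic separability problem: given $\mathcal{A}$ and $\mathcal{B}$ as in (1), decide whether there exist some $m \in \mathbb{N}$ and a deterministic timed automaton $\mathcal{S}$ with at most $k$ clocks and maximal constant at most $m$ such that $L(\mathcal{A}) \subseteq L(\mathcal{S})$ and $L(\mathcal{S}) \cap L(\mathcal{B}) = \emptyset$.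
   Context: Timed automata read finite timed words $(a_1,t_1)\cdots(a_n,t_n)$ with $a_i \in \Sigma$ and $0 \le t_1 \le \dots \le t_n$ real timestamps. A timed automaton has finitely many locations, real-valued clocks, and transitions labelled by a letter (or $\varepsilon$), a clock constraint (Boolean combination of $x \sim z$ and $x - y \sim z$ with $z \in \mathbb{Z}$), and a set of clocks to reset. $L(\mathcal{A})$ is the set of finite timed words over $\Sigma$ accepted by $\mathcal{A}$ (after erasing $\varepsilon$-letters). A timed automaton is deterministic if it has no $\varepsilon$-transitions, exactly one initial location, and any two transitions from the same location on the same letter with jointly satisfiable guards have the same target and reset set. *)

(* Defs.v *)
From Stdlib Require Import Reals List Arith ZArith Cantor.
Import ListNotations.
Open Scope R_scope.

Inductive cmp : Type := CLt | CLe | CEq | CGe | CGt.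

Inductive guard : Type :=
| GTrue : guard
| GAtom : nat -> cmp -> Z -> guard
| GDiff : nat -> nat -> cmp -> Z -> guard
| GNot  : guard -> guard
| GAnd  : guard -> guard -> guard
| GOr   : guard -> guard -> guard.

Record transition : Type := Trans {
  src : nat;
  lab : option nat;     (* letter, or None for an epsilon-transition *)
  grd : guard;
  rst : list nat;
  tgt : nat
}.

Record TA : Type := MkTA {
  alph  : nat;               (* |Sigma|, letters are 0 .. alph-1 *)
  nclk  : nat;               (* number of clocks, clocks 0 .. nclk-1 *)
  init  : list nat;
  final : list nat;
  trans : list transition
}.

Definition valuation := nat -> R.

Definition cmp_sem (c : cmp) (a b : R) : Prop :=
  match c with
  | CLt => a < b | CLe => a <= b | CEq => a = b | CGe => a >= b | CGt => a > b
  end.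

Fixpoint sat (v : valuation) (g : guard) : Prop :=
  match g with
  | GTrue => True
  | GAtom x c z => cmp_sem c (v x) (IZR z)
  | GDiff x y c z => cmp_sem c (v x - v y) (IZR z)
  | GNot g1 => ~ sat v g1
  | GAnd g1 g2 => sat v g1 /\ sat v g2
  | GOr g1 g2 => sat v g1 \/ sat v g2
  end.

Definition shift (v : valuation) (d : R) : valuation := fun x => v x + d.

Definition reset (v : valuation) (r : list nat) : valuation :=
  fun x => if existsb (Nat.eqb x) r then 0 else v x.

(* Finite timed words: sequences of (letter, absolute timestamp). *)
Definition tword := list (nat * R).

(* runs A q v t w qf : from location q with clock valuation v at absolute
   time t, the automaton can read the (remaining) timed word w and end in
   location qf.  Each transition is taken at an absolute time t' >= t
   (time elapses, guard checked on the delayed valuation, then resets);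
   a letter transition taken at time t' reads a letter with timestamp t'.
   Monotonicity of timestamps and t_1 >= 0 are enforced by the run. *)
Inductive runs (A : TA) : nat -> valuation -> R -> tword -> nat -> Prop :=
| run_nil q v t : runs A q v t [] q
| run_eps q v t tr t' w qf :
    In tr (trans A) -> src tr = q -> lab tr = None -> t <= t' ->
    sat (shift v (t' - t)) (grd tr) ->
    runs A (tgt tr) (reset (shift v (t' - t)) (rst tr)) t' w qf ->
    runs A q v t w qf
| run_letter q v t tr a t' w qf :
    In tr (trans A) -> src tr = q -> lab tr = Some a -> t <= t' ->
    sat (shift v (t' - t)) (grd tr) ->
    runs A (tgt tr) (reset (shift v (t' - t)) (rst tr)) t' w qf ->
    runs A q v t ((a, t') :: w) qf.

Definition accepts (A : TA) (w : tword) : Prop :=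
  exists q0 qf, In q0 (init A) /\ In qf (final A) /\
    runs A q0 (fun _ => 0) 0 w qf.

Fixpoint guard_clocks_lt (n : nat) (g : guard) : Prop :=
  match g with
  | GTrue => True
  | GAtom x _ _ => (x < n)%nat
  | GDiff x y _ _ => (x < n)%nat /\ (y < n)%nat
  | GNot g1 => guard_clocks_lt n g1
  | GAnd g1 g2 | GOr g1 g2 => guard_clocks_lt n g1 /\ guard_clocks_lt n g2
  end.

Fixpoint guard_consts_le (m : nat) (g : guard) : Prop :=
  match g with
  | GTrue => True
  | GAtom _ _ z | GDiff _ _ _ z => (Z.abs z <= Z.of_nat m)%Z
  | GNot g1 => guard_consts_le m g1
  | GAnd g1 g2 | GOr g1 g2 => guard_consts_le m g1 /\ guard_consts_le m g2
  end.

Definition wf_TA (A : TA) : Prop :=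
  forall tr, In tr (trans A) ->
    (forall a, lab tr = Some a -> (a < alph A)%nat) /\
    guard_clocks_lt (nclk A) (grd tr) /\
    (forall x, In x (rst tr) -> (x < nclk A)%nat).

Definition clock_valuation (v : valuation) : Prop := forall x, 0 <= v x.

Definition deterministic (A : TA) : Prop :=
  (forall tr, In tr (trans A) -> lab tr <> None) /\
  (exists q0, forall q, In q (init A) <-> q = q0) /\
  (forall tr1 tr2, In tr1 (trans A) -> In tr2 (trans A) ->
     src tr1 = src tr2 -> lab tr1 = lab tr2 ->
     (exists v, clock_valuation v /\ sat v (grd tr1) /\ sat v (grd tr2)) ->
     tgt tr1 = tgt tr2 /\ (forall x, In x (rst tr1) <-> In x (rst tr2))).

Definition max_const_le (A : TA) (m : nat) : Prop :=
  forall tr, In tr (trans A) -> guard_consts_le m (grd tr).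

Definition separates (S A B : TA) : Prop :=
  (forall w, accepts A w -> accepts S w) /\
  (forall w, ~ (accepts S w /\ accepts B w)).

Definition km_det_separable (k m : nat) (A B : TA) : Prop :=
  exists S, wf_TA S /\ alph S = alph A /\ deterministic S /\
    (nclk S <= k)%nat /\ max_const_le S m /\ separates S A B.

Definition k_det_separable (k : nat) (A B : TA) : Prop :=
  exists m : nat, km_det_separable k m A B.

Definition valid_instance (A B : TA) : Prop :=
  wf_TA A /\ wf_TA B /\ alph A = alph B.

Definition pair_nat (x y : nat) : nat := Cantor.to_nat (x, y).

Fixpoint enc_list (l : list nat) : nat :=
  match l with
  | [] => 0%nat
  | x :: l' => S (pair_nat x (enc_list l'))
  end.

Definition enc_Z (z : Z) : nat :=
  match z with
  | Z0 => 0%nat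
  | Zpos p => (2 * Pos.to_nat p)%nat
  | Zneg p => S (2 * Pos.to_nat p)
  end.

Definition enc_cmp (c : cmp) : nat :=
  match c with CLt => 0 | CLe => 1 | CEq => 2 | CGe => 3 | CGt => 4 end%nat.

Fixpoint enc_guard (g : guard) : nat :=
  match g with
  | GTrue => enc_list [0%nat]
  | GAtom x c z => enc_list [1%nat; x; enc_cmp c; enc_Z z]
  | GDiff x y c z => enc_list [2%nat; x; y; enc_cmp c; enc_Z z]
  | GNot g1 => enc_list [3%nat; enc_guard g1]
  | GAnd g1 g2 => enc_list [4%nat; enc_guard g1; enc_guard g2]
  | GOr g1 g2 => enc_list [5%nat; enc_guard g1; enc_guard g2]
  end.

Definition enc_option (o : option nat) : nat :=
  match o with None => 0%nat | Some a => S a end.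

Definition enc_trans (tr : transition) : nat :=
  enc_list [src tr; enc_option (lab tr); enc_guard (grd tr);
            enc_list (rst tr); tgt tr].

Definition enc_TA (A : TA) : nat :=
  enc_list [alph A; nclk A; enc_list (init A); enc_list (final A);
            enc_list (map enc_trans (trans A))].

Definition enc_instance (A B : TA) : nat := pair_nat (enc_TA A) (enc_TA B).

Inductive recf : Type :=
| RZero : recf
| RSucc : recf
| RProj : nat -> recf
| RComp : recf -> list recf -> recf
| RPrec : recf -> recf -> recf
| RMu   : recf -> recf.

Inductive reval : recf -> list nat -> nat -> Prop :=
| ev_zero v : reval RZero v 0
| ev_succ x v : reval RSucc (x :: v) (S x)
| ev_proj i v : reval (RProj i) v (nth i v 0%nat)
| ev_comp f gs v ws y :
    reval_list gs v ws -> reval f ws y -> reval (RComp f gs) v y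
| ev_prec0 f g v y : reval f v y -> reval (RPrec f g) (0%nat :: v) y
| ev_precS f g n v y z :
    reval (RPrec f g) (n :: v) y -> reval g (n :: y :: v) z ->
    reval (RPrec f g) (S n :: v) z
| ev_mu f v n :
    reval f (n :: v) 0 ->
    (forall j, (j < n)%nat -> exists y, reval f (j :: v) (S y)) ->
    reval (RMu f) v n
with reval_list : list recf -> list nat -> list nat -> Prop :=
| evl_nil v : reval_list [] v []
| evl_cons g gs v y ys :
    reval g v y -> reval_list gs v ys -> reval_list (g :: gs) v (y :: ys).

Definition decidable_set (P : nat -> Prop) : Prop :=
  exists f : recf, forall n,
    (P n -> reval f [n] 1%nat) /\ (~ P n -> reval f [n] 0%nat).

Definition km_det_sep_problem (k m : nat) (n : nat) : Prop :=
  exists A B, n = enc_instance A B /\ valid_instance A B /\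
    km_det_separable k m A B.

Definition k_det_sep_problem (k : nat) (n : nat) : Prop :=
  exists A B, n = enc_instance A B /\ valid_instance A B /\
    k_det_separable k A B.

(* Main.v *)
(** A separator with [k] clocks and constants at most [m] plays a game: it observes the letters
    together with the regions of its clocks and answers with resets, and it wins if no two plays
    that look alike to it are induced by words of both languages.  Only the set of configurations
    of the two automata compatible with the observations matters, and region equivalence is a
    bisimulation, so this is a safety game on a finite graph; a finite closed set of positions is
    exactly a separator, which decides the first problem.

    When [m] is not given, let the separator also be notified whenever a clock reaches an integer
    value.  It then tracks fractional parts only, and a strategy with constant [m] is a strategy
    in which every clock is notified at most [m] times between resets.  The finitely many
    positions do not depend on [m].  Playing in each position as if the notification counters
    had the lexicographically largest value for which the given strategy still wins, with
    recently reset clocks least significant, bounds the counters by a computable number.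
    Hence the second problem reduces to the first with a computable constant. *)

From Stdlib Require Import Reals List Arith ZArith Cantor Lia Lra Bool Classical FinFun.
From Stdlib Require Import ClassicalEpsilon FunctionalExtensionality.
Require Import Defs.
Import ListNotations.

(** * Recursive functions on encoded data *)

Open Scope nat_scope.

(** The obstacle is that a strategy for an unknown [m] may count arbitrarily far, while a bounded
    play cannot remember how far. The bounded play keeps the regions of the tick clocks, the set of
    active clocks and the order of the last resets. In such a state it consults the strategy with
    the largest winning counters, even where these differ from the true ones. Between two ticks of a
    clock that is not reset, the part of the maximal vector up to that clock grows strictly, unless
    a more significant clock is reset meanwhile, which makes the clock itself more significant. The
    maximal vector is a function of the state, so growth of the first kind is bounded by the number
    of states, and the second event occurs at most [k] times; this is the origin of [tick_bound].

    Decidability refers to the recursive functions of the statement, so every test has to be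
    assembled from them. Hence no fixpoint is iterated: reachable sets and winning families are
    searched for in powersets, and valuations enter only as grid points with a fixed denominator. *)

Definition comp1 (F : nat -> nat) : Prop := exists r, forall n, reval r [n] (F n).
Definition comp2 (F : nat -> nat -> nat) : Prop :=
  exists r, forall x y, reval r [x; y] (F x y).

Lemma reval_comp1 r f v x y : reval f v x -> reval r [x] y -> reval (RComp r [f]) v y.
Proof. intros. eapply ev_comp; [repeat econstructor; eassumption|assumption]. Qed.

Lemma reval_comp2 r f g v x y z :
  reval f v x -> reval g v y -> reval r [x; y] z -> reval (RComp r [f; g]) v z.
Proof. intros. eapply ev_comp; [repeat econstructor; eassumption|assumption]. Qed.

Lemma reval_proj i v y : nth i v 0 = y -> reval (RProj i) v y.
Proof. intros <-. constructor. Qed.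

Ltac proj := apply reval_proj; reflexivity.

Lemma comp1_id : comp1 (fun n => n).
Proof. exists (RProj 0). intros n. proj. Qed.

Lemma comp1_comp F G : comp1 F -> comp1 G -> comp1 (fun n => G (F n)).
Proof.
  intros [r Hr] [s Hs]. exists (RComp s [r]). intros n. eapply reval_comp1; eauto.
Qed.

Lemma comp1_comp2 F G H :
  comp1 F -> comp1 G -> comp2 H -> comp1 (fun n => H (F n) (G n)).
Proof.
  intros [r Hr] [s Hs] [t Ht]. exists (RComp t [r; s]). intros n.
  eapply reval_comp2; eauto.
Qed.

Lemma comp2_comp1 F H : comp2 H -> comp1 F -> comp2 (fun x y => F (H x y)).
Proof.
  intros [t Ht] [r Hr]. exists (RComp r [t]). intros x y. eapply reval_comp1; eauto.
Qed.

Lemma comp2_comp2 F G H :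
  comp2 F -> comp2 G -> comp2 H -> comp2 (fun x y => H (F x y) (G x y)).
Proof.
  intros [r Hr] [s Hs] [t Ht]. exists (RComp t [r; s]). intros x y.
  eapply reval_comp2; eauto.
Qed.

Lemma comp2_fst : comp2 (fun x _ => x).
Proof. exists (RProj 0). intros. proj. Qed.

Lemma comp2_snd : comp2 (fun _ y => y).
Proof. exists (RProj 1). intros. proj. Qed.

Lemma comp1_succ : comp1 S.
Proof. exists RSucc. intros. constructor. Qed.

Lemma comp1_const c : comp1 (fun _ => c).
Proof.
  induction c as [|c IH].
  - exists RZero. constructor.
  - apply (comp1_comp (fun _ => c) S IH comp1_succ).
Qed.

Lemma comp2_iter F : comp1 F -> comp2 (fun n x => Nat.iter n F x).
Proof.
  intros [r Hr]. exists (RPrec (RProj 0) (RComp r [RProj 1])). intros n x.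
  induction n as [|n IH]; simpl.
  - apply ev_prec0. proj.
  - eapply ev_precS; [exact IH|]. eapply reval_comp1; [proj|apply Hr].
Qed.

Lemma comp2_ext F G : (forall x y, F x y = G x y) -> comp2 F -> comp2 G.
Proof. intros E [r Hr]. exists r. intros. rewrite <- E. apply Hr. Qed.

Lemma comp1_ext F G : (forall x, F x = G x) -> comp1 F -> comp1 G.
Proof. intros E [r Hr]. exists r. intros. rewrite <- E. apply Hr. Qed.

Lemma comp2_add : comp2 Nat.add.
Proof.
  apply comp2_ext with (fun n x => Nat.iter n S x).
  - intros n x. induction n; simpl; congruence.
  - apply comp2_iter, comp1_succ.
Qed.

Lemma comp1_pred : comp1 Nat.pred.
Proof.
  exists (RPrec RZero (RProj 0)). intros n. induction n as [|n IH].
  - apply ev_prec0. constructor.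
  - eapply ev_precS; [exact IH|]. proj.
Qed.

Lemma comp2_sub : comp2 Nat.sub.
Proof.
  apply comp2_ext with (fun x y => Nat.iter y Nat.pred x).
  - intros x y. induction y; simpl; lia.
  - apply (comp2_comp2 (fun _ y => y) (fun x _ => x) (fun y x => Nat.iter y Nat.pred x)
            comp2_snd comp2_fst (comp2_iter _ comp1_pred)).
Qed.

(** Triangular numbers, written so as to be convertible with the sum inside [Cantor.to_nat]. *)
Fixpoint tri (n : nat) : nat := match n with 0 => 0 | S i => S i + tri i end.

Lemma comp1_tri : comp1 tri.
Proof.
  destruct comp2_add as [ra Ha].
  exists (RPrec RZero (RComp ra [RComp RSucc [RProj 0]; RProj 1])).
  intros n. induction n as [|n IH].
  - apply ev_prec0. constructor.
  - eapply ev_precS; [exact IH|]. eapply reval_comp2; [|proj|apply Ha].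
    eapply reval_comp1; [proj|constructor].
Qed.

Lemma pair_nat_tri x y : pair_nat x y = y + tri (y + x).
Proof. unfold pair_nat, to_nat. f_equal. Qed.

Lemma comp2_pair : comp2 pair_nat.
Proof.
  apply comp2_ext with (fun x y => y + tri (y + x)).
  { intros; symmetry; apply pair_nat_tri. }
  pose proof (comp2_comp2 _ _ _ comp2_snd comp2_fst comp2_add) as H1.
  exact (comp2_comp2 _ _ _ comp2_snd (comp2_comp1 _ _ H1 comp1_tri) comp2_add).
Qed.

Definition ufst (n : nat) : nat := fst (Cantor.of_nat n).
Definition usnd (n : nat) : nat := snd (Cantor.of_nat n).

Lemma ufst_pair x y : ufst (pair_nat x y) = x.
Proof. unfold ufst, pair_nat. now rewrite cancel_of_to. Qed.
Lemma usnd_pair x y : usnd (pair_nat x y) = y.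
Proof. unfold usnd, pair_nat. now rewrite cancel_of_to. Qed.
Lemma pair_unpair n : pair_nat (ufst n) (usnd n) = n.
Proof. unfold ufst, usnd, pair_nat. rewrite <- surjective_pairing. apply cancel_to_of. Qed.

Lemma tri_mono a b : a <= b -> tri a <= tri b.
Proof. induction 1; simpl; lia. Qed.

(* The antidiagonal of [n] is the least [s] with [n < tri (S s)]. *)
Lemma comp1_diag : comp1 (fun n => ufst n + usnd n).
Proof.
  destruct comp2_sub as [rs Hs]. destruct comp1_tri as [rt Ht].
  set (f := RComp rs [RComp RSucc [RProj 1]; RComp rt [RComp RSucc [RProj 0]]]).
  assert (Hf : forall s n, reval f [s; n] (S n - tri (S s))).
  { intros s n. unfold f. eapply reval_comp2; [| |apply Hs].
    - eapply reval_comp1; [proj|constructor].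
    - eapply reval_comp1; [eapply reval_comp1; [proj|constructor]|apply Ht]. }
  exists (RMu f). intros n.
  set (x := ufst n). set (y := usnd n).
  assert (E : n = y + tri (y + x)).
  { rewrite <- pair_nat_tri. symmetry. apply pair_unpair. }
  apply ev_mu.
  - replace 0 with (S n - tri (S (x + y))); [apply Hf|].
    simpl. rewrite (Nat.add_comm x y). lia.
  - intros j Hj. exists (n - tri (S j)).
    assert (tri (S j) <= tri (y + x)) by (apply tri_mono; lia).
    replace (S (n - tri (S j))) with (S n - tri (S j)) by lia. apply Hf.
Qed.

Lemma comp1_snd : comp1 usnd.
Proof.
  apply comp1_ext with (fun n => n - tri (ufst n + usnd n)).
  - intros n. pose proof (pair_unpair n) as E. rewrite pair_nat_tri in E.
    rewrite (Nat.add_comm (ufst n)). lia.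
  - apply (comp1_comp2 (fun n => n) (fun n => tri (ufst n + usnd n)) Nat.sub comp1_id).
    + exact (comp1_comp _ _ comp1_diag comp1_tri).
    + exact comp2_sub.
Qed.

Lemma comp1_fst : comp1 ufst.
Proof.
  apply comp1_ext with (fun n => (ufst n + usnd n) - usnd n); [lia|].
  exact (comp1_comp2 _ _ _ comp1_diag comp1_snd comp2_sub).
Qed.

Definition ifz (c a b : nat) : nat := match c with 0 => a | S _ => b end.

Lemma comp1_ifz C A B :
  comp1 C -> comp1 A -> comp1 B -> comp1 (fun n => ifz (C n) (A n) (B n)).
Proof.
  intros [rc Hc] [ra Ha] [rb Hb].
  (* The step function receives the predecessor, the previous value, [A n] and [B n] in this order,
     so [RProj 3] returns [B n]. *)
  exists (RComp (RPrec (RProj 0) (RProj 3)) [rc; ra; rb]). intros n.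
  eapply ev_comp; [repeat econstructor; eauto|].
  induction (C n) as [|c IH]; simpl.
  - apply ev_prec0. proj.
  - eapply ev_precS; [exact IH|]. proj.
Qed.

Lemma comp1_pair A B : comp1 A -> comp1 B -> comp1 (fun n => pair_nat (A n) (B n)).
Proof. intros HA HB. exact (comp1_comp2 _ _ _ HA HB comp2_pair). Qed.

(** * Encodings and closure properties of computable functions *)

Class Enc (X : Type) := enc : X -> nat.
#[global] Instance Enc_nat : Enc nat := fun n => n.
#[global] Instance Enc_bool : Enc bool := fun b => if b then 1 else 0.
#[global] Instance Enc_prod X Y `{Enc X} `{Enc Y} : Enc (X * Y) :=
  fun p => pair_nat (enc (fst p)) (enc (snd p)).
(** The clauses repeat those of [enc_list] in the statement, so the list codes inside an instance
    are codes in this sense too. *)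
Fixpoint enc_seq {X} `{Enc X} (l : list X) : nat :=
  match l with [] => 0 | x :: l' => S (pair_nat (enc x) (enc_seq l')) end.
#[global] Instance Enc_list X `{Enc X} : Enc (list X) := enc_seq.

(** Off the range of [enc] the values of [F] are unconstrained; only totality is required there. *)
Definition computable {E X} `{Enc E} `{Enc X} (f : E -> X) : Prop :=
  exists F, comp1 F /\ forall e, F (enc e) = enc (f e).

Section Closure.
Context {E : Type} `{Enc E}.

Lemma cmp_const {X} `{Enc X} (c : X) : computable (fun _ : E => c).
Proof. exists (fun _ => enc c). split; [apply comp1_const|reflexivity]. Qed.

Lemma cmp_id : computable (fun e : E => e).
Proof. exists (fun n => n). split; [apply comp1_id|reflexivity]. Qed.

Lemma cmp_comp {X Y} `{Enc X} `{Enc Y} (g : X -> Y) (f : E -> X) :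
  computable g -> computable f -> computable (fun e => g (f e)).
Proof.
  intros (G & HG & EG) (F & HF & EF). exists (fun n => G (F n)). split.
  - exact (comp1_comp _ _ HF HG).
  - intros e. now rewrite EF, EG.
Qed.

Lemma cmp_pair {X Y} `{Enc X} `{Enc Y} (f : E -> X) (g : E -> Y) :
  computable f -> computable g -> computable (fun e => (f e, g e)).
Proof.
  intros (F & HF & EF) (G & HG & EG). exists (fun n => pair_nat (F n) (G n)). split.
  - now apply comp1_pair.
  - intros e. now rewrite EF, EG.
Qed.

Lemma cmp_fst {X Y} `{Enc X} `{Enc Y} (f : E -> X * Y) :
  computable f -> computable (fun e => fst (f e)).
Proof.
  intros (F & HF & EF). exists (fun n => ufst (F n)). split.
  - exact (comp1_comp _ _ HF comp1_fst).
  - intros e. rewrite EF. apply ufst_pair.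
Qed.

Lemma cmp_snd {X Y} `{Enc X} `{Enc Y} (f : E -> X * Y) :
  computable f -> computable (fun e => snd (f e)).
Proof.
  intros (F & HF & EF). exists (fun n => usnd (F n)). split.
  - exact (comp1_comp _ _ HF comp1_snd).
  - intros e. rewrite EF. apply usnd_pair.
Qed.

Lemma cmp_S (f : E -> nat) : computable f -> computable (fun e => S (f e)).
Proof.
  intros (F & HF & EF). exists (fun n => S (F n)). split.
  - exact (comp1_comp _ _ HF comp1_succ).
  - intros e. now rewrite EF.
Qed.

Lemma cmp_if {X} `{Enc X} (c : E -> bool) (a b : E -> X) :
  computable c -> computable a -> computable b ->
  computable (fun e => if c e then a e else b e).
Proof.
  intros (C & HC & EC) (A & HA & EA) (B & HB & EB).
  exists (fun n => ifz (C n) (B n) (A n)). split; [now apply comp1_ifz|].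
  intros e. rewrite EC, EA, EB. now destruct (c e).
Qed.

Lemma cmp_nat_binop (op : nat -> nat -> nat) (f g : E -> nat) :
  comp2 op -> computable f -> computable g -> computable (fun e => op (f e) (g e)).
Proof.
  intros Hop (F & HF & EF) (G & HG & EG). exists (fun n => op (F n) (G n)). split.
  - exact (comp1_comp2 _ _ _ HF HG Hop).
  - intros e. now rewrite EF, EG.
Qed.

Lemma cmp_add (f g : E -> nat) : computable f -> computable g ->
  computable (fun e => f e + g e).
Proof. apply cmp_nat_binop, comp2_add. Qed.

Lemma cmp_sub (f g : E -> nat) : computable f -> computable g ->
  computable (fun e => f e - g e).
Proof. apply cmp_nat_binop, comp2_sub. Qed.

Lemma cmp_eq0 (f : E -> nat) : computable f -> computable (fun e => f e =? 0).
Proof.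
  intros (F & HF & EF). exists (fun n => ifz (F n) 1 0). split.
  - apply comp1_ifz; [exact HF|apply comp1_const|apply comp1_const].
  - intros e. rewrite EF. unfold enc at 1, Enc_nat. now destruct (f e).
Qed.

Lemma cmp_iter {X} `{Enc X} (n : E -> nat) (g : X -> X) (z : E -> X) :
  computable n -> computable g -> computable z ->
  computable (fun e => Nat.iter (n e) g (z e)).
Proof.
  intros (N & HN & EN) (G & HG & EG) (Z & HZ & EZ).
  exists (fun c => Nat.iter (N c) G (Z c)). split.
  - exact (comp1_comp2 _ _ _ HN HZ (comp2_iter _ HG)).
  - intros e. rewrite EN, EZ. unfold enc at 1, Enc_nat.
    induction (n e) as [|i IH]; simpl; [reflexivity|]. now rewrite IH, EG.
Qed.

End Closure.

(** Plain iteration sees neither the parameter nor the index, so the iterated state carries both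
    next to the accumulator. *)
Lemma cmp_nat_rect {E X} `{Enc E} `{Enc X}
  (n : E -> nat) (z : E -> X) (g : E -> nat -> X -> X) :
  computable n -> computable z ->
  computable (fun p : E * (nat * X) => g (fst p) (fst (snd p)) (snd (snd p))) ->
  computable (fun e => nat_rect (fun _ => X) (z e) (g e) (n e)).
Proof.
  intros Hn Hz Hg.
  set (step := fun s : E * (nat * X) =>
    (fst s, (S (fst (snd s)), g (fst s) (fst (snd s)) (snd (snd s))))).
  assert (Hs : computable step).
  { apply cmp_pair; [apply cmp_fst, cmp_id|]. apply cmp_pair; [|exact Hg].
    apply cmp_S, cmp_fst, cmp_snd, cmp_id. }
  assert (HI : computable (fun e => snd (snd (Nat.iter (n e) step (e, (0, z e)))))).
  { apply cmp_snd, cmp_snd, cmp_iter; [exact Hn|exact Hs|].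
    apply cmp_pair; [apply cmp_id|]. apply cmp_pair; [apply cmp_const|exact Hz]. }
  destruct HI as (F & HF & EF). exists F. split; [exact HF|].
  intros e. rewrite EF. f_equal.
  assert (HJ : forall i, Nat.iter i step (e, (0, z e)) =
                 (e, (i, nat_rect (fun _ => X) (z e) (g e) i))).
  { induction i as [|i IH]; [reflexivity|]. simpl. now rewrite IH. }
  now rewrite HJ.
Qed.

Lemma cmp_ext {E X} `{Enc E} `{Enc X} (f g : E -> X) :
  (forall e, f e = g e) -> computable f -> computable g.
Proof. intros Heq (F & HF & EF). exists F. split; [exact HF|]. intros e. now rewrite EF, Heq. Qed.

Section Closure2.
Context {E : Type} `{Enc E}.

Lemma cmp_mul (f g : E -> nat) : computable f -> computable g ->
  computable (fun e => f e * g e).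
Proof.
  intros Hf Hg.
  apply cmp_ext with (fun e => nat_rect (fun _ => nat) 0 (fun _ x => g e + x) (f e)).
  { intros e. induction (f e); simpl; congruence. }
  apply cmp_nat_rect; [exact Hf|apply cmp_const|].
  apply cmp_add; [|apply cmp_snd, cmp_snd, cmp_id].
  apply (cmp_comp g fst Hg). apply cmp_fst, cmp_id.
Qed.

Lemma cmp_leb (f g : E -> nat) : computable f -> computable g ->
  computable (fun e => f e <=? g e).
Proof.
  intros Hf Hg. apply cmp_ext with (fun e => f e - g e =? 0).
  - intros e. destruct (Nat.leb_spec (f e) (g e)); [apply Nat.eqb_eq|apply Nat.eqb_neq]; lia.
  - apply cmp_eq0. now apply cmp_sub.
Qed.

Lemma cmp_ltb (f g : E -> nat) : computable f -> computable g ->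
  computable (fun e => f e <? g e).
Proof. intros Hf Hg. unfold Nat.ltb. apply cmp_leb; [now apply cmp_S|exact Hg]. Qed.

Lemma cmp_andb (f g : E -> bool) : computable f -> computable g ->
  computable (fun e => f e && g e).
Proof.
  intros Hf Hg. apply cmp_ext with (fun e => if f e then g e else false).
  - intros e; now destruct (f e).
  - apply cmp_if; [exact Hf|exact Hg|apply cmp_const].
Qed.

Lemma cmp_orb (f g : E -> bool) : computable f -> computable g ->
  computable (fun e => f e || g e).
Proof.
  intros Hf Hg. apply cmp_ext with (fun e => if f e then true else g e).
  - intros e; now destruct (f e).
  - apply cmp_if; [exact Hf|apply cmp_const|exact Hg].
Qed.

Lemma cmp_negb (f : E -> bool) : computable f -> computable (fun e => negb (f e)).
Proof.
  intros Hf. apply cmp_ext with (fun e => if f e then false else true).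
  - intros e; now destruct (f e).
  - apply cmp_if; [exact Hf|apply cmp_const|apply cmp_const].
Qed.

Lemma cmp_eqb (f g : E -> nat) : computable f -> computable g ->
  computable (fun e => f e =? g e).
Proof.
  intros Hf Hg. apply cmp_ext with (fun e => (f e <=? g e) && (g e <=? f e)).
  - intros e. destruct (Nat.eqb_spec (f e) (g e)) as [->|N];
      [now rewrite Nat.leb_refl|].
    destruct (Nat.leb_spec (f e) (g e)); [|reflexivity]. apply Nat.leb_gt. lia.
  - apply cmp_andb; now apply cmp_leb.
Qed.

Lemma cmp_beqb (f g : E -> bool) : computable f -> computable g ->
  computable (fun e => Bool.eqb (f e) (g e)).
Proof.
  intros Hf Hg. apply cmp_ext with (fun e => if f e then g e else negb (g e)).
  - intros e; now destruct (f e), (g e).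
  - apply cmp_if; [exact Hf|exact Hg|now apply cmp_negb].
Qed.

Lemma cmp_cons {X} `{Enc X} (f : E -> X) (l : E -> list X) :
  computable f -> computable l -> computable (fun e => f e :: l e).
Proof.
  intros (F & HF & EF) (L & HL & EL). exists (fun n => S (pair_nat (F n) (L n))). split.
  - exact (comp1_comp _ _ (comp1_pair _ _ HF HL) comp1_succ).
  - intros e. now rewrite EF, EL.
Qed.

Lemma cmp_enc {X} `{Enc X} (f : E -> X) : computable f -> computable (fun e => enc (f e)).
Proof. intros (F & HF & EF). exists F. split; assumption. Qed.

End Closure2.

(** Supplies fuel: the code of a list, which is at hand for free, is an upper bound for the number
    of steps of a fold over it. *)
Lemma length_enc {X} `{Enc X} (l : list X) : length l <= enc l.
Proof.
  induction l as [|x l IH]; simpl; [lia|].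
  change (enc (x :: l)) with (S (pair_nat (enc x) (enc l))).
  pose proof (to_nat_non_decreasing (enc x) (enc l)). unfold pair_nat. lia.
Qed.

(** One step of a left fold; it is stationary on the empty list, so surplus iterations are
    harmless. *)
Definition lstep {X Y E} (g : E -> X -> Y -> Y) (s : E * (list X * Y)) : E * (list X * Y) :=
  (fst s, match fst (snd s) with
          | [] => snd s
          | x :: l => (l, g (fst s) x (snd (snd s)))
          end).

Lemma cmp_lstep {E X Y} `{Enc E} `{Enc X} `{Enc Y} (g : E -> X -> Y -> Y) :
  computable (fun p : E * (X * Y) => g (fst p) (fst (snd p)) (snd (snd p))) ->
  computable (lstep g).
Proof.
  intros (G & HG & EG).
  set (hd := fun n => ufst (Nat.pred (ufst (usnd n)))).
  set (tl := fun n => usnd (Nat.pred (ufst (usnd n)))).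
  exists (fun n => pair_nat (ufst n) (ifz (ufst (usnd n)) (usnd n)
    (pair_nat (tl n) (G (pair_nat (ufst n) (pair_nat (hd n) (usnd (usnd n)))))))).
  assert (Hus : comp1 (fun n => ufst (usnd n))) by exact (comp1_comp _ _ comp1_snd comp1_fst).
  assert (Hp : comp1 (fun n => Nat.pred (ufst (usnd n)))) by exact (comp1_comp _ _ Hus comp1_pred).
  split.
  - apply comp1_pair; [exact comp1_fst|]. apply comp1_ifz; [exact Hus|exact comp1_snd|].
    apply comp1_pair; [exact (comp1_comp _ _ Hp comp1_snd)|].
    apply (comp1_comp (fun n => pair_nat (ufst n) (pair_nat (hd n) (usnd (usnd n)))) G); [|exact HG].
    apply comp1_pair; [exact comp1_fst|].
    apply comp1_pair; [exact (comp1_comp _ _ Hp comp1_fst)|].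
    exact (comp1_comp _ _ comp1_snd comp1_snd).
  - intros [e [l y]]. unfold lstep, hd, tl. simpl fst. simpl snd.
    change (enc (e, (l, y))) with (pair_nat (enc e) (pair_nat (enc l) (enc y))).
    repeat rewrite ?ufst_pair, ?usnd_pair.
    destruct l as [|x l]; [reflexivity|].
    change (enc (x :: l)) with (S (pair_nat (enc x) (enc l))). simpl ifz. simpl Nat.pred.
    rewrite ufst_pair, usnd_pair.
    change (pair_nat (enc e) (pair_nat (enc x) (enc y))) with (enc (e, (x, y))).
    rewrite EG. reflexivity.
Qed.

Lemma iter_lstep {X Y E} (g : E -> X -> Y -> Y) e n : forall l y, length l <= n ->
  Nat.iter n (lstep g) (e, (l, y)) = (e, ([], fold_left (fun y x => g e x y) l y)).
Proof.
  induction n as [|n IH]; intros l y Hl.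
  - destruct l; [reflexivity|simpl in Hl; lia].
  - rewrite Nat.iter_succ_r. destruct l as [|x l]; simpl in Hl |- *.
    + apply (IH [] y). simpl; lia.
    + apply IH. lia.
Qed.

Lemma cmp_fold_left {E X Y} `{Enc E} `{Enc X} `{Enc Y}
  (l : E -> list X) (z : E -> Y) (g : E -> X -> Y -> Y) :
  computable l -> computable z ->
  computable (fun p : E * (X * Y) => g (fst p) (fst (snd p)) (snd (snd p))) ->
  computable (fun e => fold_left (fun y x => g e x y) (l e) (z e)).
Proof.
  intros Hl Hz Hg.
  apply cmp_ext with (fun e => snd (snd (Nat.iter (enc (l e)) (lstep g) (e, (l e, z e))))).
  - intros e. now rewrite iter_lstep by apply length_enc.
  - apply cmp_snd, cmp_snd, cmp_iter; [now apply cmp_enc|now apply cmp_lstep|].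
    apply cmp_pair; [apply cmp_id|]. now apply cmp_pair.
Qed.

Section Closure3.
Context {E : Type} `{Enc E}.

Lemma cmp_rev {X} `{Enc X} (l : E -> list X) :
  computable l -> computable (fun e => rev (l e)).
Proof.
  intros Hl. apply cmp_ext with (fun e => fold_left (fun y x => x :: y) (l e) []).
  - intros e. rewrite <- fold_left_rev_right, <- (rev_involutive (l e)) at 1.
    rewrite rev_involutive. induction (rev (l e)); simpl; congruence.
  - apply (cmp_fold_left l (fun _ => []) (fun _ x y => x :: y)); [exact Hl|apply cmp_const|].
    apply cmp_cons; [apply cmp_fst, cmp_snd, cmp_id|apply cmp_snd, cmp_snd, cmp_id].
Qed.

Lemma cmp_fold_right {X Y} `{Enc X} `{Enc Y}
  (l : E -> list X) (z : E -> Y) (g : E -> X -> Y -> Y) :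
  computable l -> computable z ->
  computable (fun p : E * (X * Y) => g (fst p) (fst (snd p)) (snd (snd p))) ->
  computable (fun e => fold_right (g e) (z e) (l e)).
Proof.
  intros Hl Hz Hg.
  apply cmp_ext with (fun e => fold_left (fun y x => g e x y) (rev (l e)) (z e)).
  - intros e. rewrite <- (rev_involutive (l e)) at 2. now rewrite fold_left_rev_right.
  - apply cmp_fold_left; [now apply cmp_rev|exact Hz|exact Hg].
Qed.

End Closure3.

Lemma cmp_tl {E X} `{Enc E} `{Enc X} (l : E -> list X) :
  computable l -> computable (fun e => tl (l e)).
Proof.
  intros (L & HL & EL). exists (fun n => usnd (Nat.pred (L n))). split.
  - exact (comp1_comp _ _ (comp1_comp _ _ HL comp1_pred) comp1_snd).
  - intros e. rewrite EL. destruct (l e) as [|x t]; [reflexivity|].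
    apply usnd_pair.
Qed.

(** A hook, redefined as closure lemmas for further operations become available. *)
Ltac cmp_user := fail.

Ltac cmp_core :=
  first
  [ assumption
  | simple apply cmp_const
  | simple apply cmp_id
  | simple apply cmp_fst
  | simple apply cmp_snd
  | simple apply cmp_pair
  | simple apply cmp_S
  | simple apply cmp_add
  | simple apply cmp_sub
  | simple apply cmp_mul
  | simple apply cmp_eqb
  | simple apply cmp_leb
  | simple apply cmp_ltb
  | simple apply cmp_andb
  | simple apply cmp_orb
  | simple apply cmp_negb
  | simple apply cmp_beqb
  | simple apply cmp_if
  | simple apply cmp_cons
  | simple apply cmp_tl
  | simple apply cmp_enc
  | simple apply cmp_rev
  | cmp_user
  | match goal with
    | H : computable ?g |- computable (fun e => ?g (@?f e)) => apply (cmp_comp g f H)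
    | H : computable (fun p => ?g (fst p) (snd p)) |- computable (fun e => ?g (@?a e) (@?b e)) =>
        apply (cmp_comp (fun p => g (fst p) (snd p)) (fun e => (a e, b e)) H)
    end ].

Ltac cmp := repeat (cbv beta; cmp_core).

Section Lists.
Context {E X Y : Type} `{Enc E} `{Enc X} `{Enc Y}.

Lemma cmp_app (l l' : E -> list X) : computable l -> computable l' ->
  computable (fun e => l e ++ l' e).
Proof.
  intros. apply cmp_ext with (fun e => fold_right (fun x t => x :: t) (l' e) (l e)).
  - intros e. induction (l e); simpl; congruence.
  - apply cmp_fold_right; cmp.
Qed.

Lemma cmp_map (g : E -> X -> Y) (l : E -> list X) :
  computable (fun p : E * X => g (fst p) (snd p)) -> computable l ->
  computable (fun e => map (g e) (l e)).
Proof.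
  intros Hg Hl. apply cmp_ext with (fun e => fold_right (fun x t => g e x :: t) [] (l e)).
  - intros e. induction (l e); simpl; congruence.
  - apply (cmp_fold_right l (fun _ => []) (fun e x t => g e x :: t)); cmp.
Qed.

Lemma cmp_filter (g : E -> X -> bool) (l : E -> list X) :
  computable (fun p : E * X => g (fst p) (snd p)) -> computable l ->
  computable (fun e => filter (g e) (l e)).
Proof.
  intros Hg Hl.
  apply cmp_ext with (fun e => fold_right (fun x t => if g e x then x :: t else t) [] (l e)).
  - intros e. induction (l e) as [|x t IH]; simpl; [reflexivity|]. now rewrite IH.
  - apply (cmp_fold_right l (fun _ => []) (fun e x t => if g e x then x :: t else t)); cmp.
Qed.

Lemma cmp_existsb (g : E -> X -> bool) (l : E -> list X) :
  computable (fun p : E * X => g (fst p) (snd p)) -> computable l ->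
  computable (fun e => existsb (g e) (l e)).
Proof.
  intros Hg Hl.
  apply cmp_ext with (fun e => fold_right (fun x t => g e x || t) false (l e)).
  - intros e. induction (l e); simpl; congruence.
  - apply (cmp_fold_right l (fun _ => false) (fun e x t => g e x || t)); cmp.
Qed.

Lemma cmp_forallb (g : E -> X -> bool) (l : E -> list X) :
  computable (fun p : E * X => g (fst p) (snd p)) -> computable l ->
  computable (fun e => forallb (g e) (l e)).
Proof.
  intros Hg Hl.
  apply cmp_ext with (fun e => fold_right (fun x t => g e x && t) true (l e)).
  - intros e. induction (l e); simpl; congruence.
  - apply (cmp_fold_right l (fun _ => true) (fun e x t => g e x && t)); cmp.
Qed.

Lemma cmp_length (l : E -> list X) : computable l -> computable (fun e => length (l e)).
Proof.
  intros Hl. apply cmp_ext with (fun e => fold_right (fun _ n => S n) 0 (l e)).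
  - intros e. induction (l e); simpl; congruence.
  - apply (cmp_fold_right l (fun _ => 0) (fun e x t => S t)); cmp.
Qed.

Lemma cmp_skipn (n : E -> nat) (l : E -> list X) : computable n -> computable l ->
  computable (fun e => skipn (n e) (l e)).
Proof.
  intros Hn Hl.
  apply cmp_ext with (fun e => nat_rect (fun _ => list X) (l e) (fun _ t => tl t) (n e)).
  - intros e. induction (n e) as [|i IH]; [reflexivity|]. simpl. rewrite IH.
    generalize (l e). clear. induction i as [|i IH]; intros [|x l]; try reflexivity.
    simpl. rewrite <- IH. destruct l; [now destruct i|reflexivity].
  - apply (cmp_nat_rect n l (fun _ _ t => tl t)); cmp.
Qed.

Lemma cmp_nth (n : E -> nat) (l : E -> list X) (d : E -> X) :
  computable n -> computable l -> computable d ->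
  computable (fun e => nth (n e) (l e) (d e)).
Proof.
  intros Hn Hl Hd.
  apply cmp_ext with (fun e => fold_right (fun x _ => x) (d e) (skipn (n e) (l e))).
  - intros e. generalize (n e) as i, (l e) as t. clear.
    induction i as [|i IH]; intros [|x l]; try reflexivity. simpl. apply IH.
  - apply (cmp_fold_right (fun e => skipn (n e) (l e)) d (fun _ x _ => x)); cmp.
    now apply cmp_skipn.
Qed.

End Lists.

Lemma cmp_flat_map {E X Y} `{Enc E} `{Enc X} `{Enc Y} (g : E -> X -> list Y) (l : E -> list X) :
  computable (fun p : E * X => g (fst p) (snd p)) -> computable l ->
  computable (fun e => flat_map (g e) (l e)).
Proof.
  intros Hg Hl.
  apply cmp_ext with (fun e => fold_right (fun x t => g e x ++ t) [] (l e)).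
  - intros e. induction (l e); simpl; congruence.
  - apply (cmp_fold_right l (fun _ => []) (fun e x t => g e x ++ t)); cmp.
    apply cmp_app; cmp.
Qed.

Lemma cmp_list_prod {E X Y} `{Enc E} `{Enc X} `{Enc Y} (l : E -> list X) (l' : E -> list Y) :
  computable l -> computable l' -> computable (fun e => list_prod (l e) (l' e)).
Proof.
  intros Hl Hl'.
  apply cmp_ext with (fun e => flat_map (fun x => map (fun y => (x, y)) (l' e)) (l e)).
  - intros e. induction (l e); simpl; congruence.
  - apply (cmp_flat_map (fun e x => map (fun y => (x, y)) (l' e))); [|exact Hl].
    apply (cmp_map (fun p y => (snd p, y))); cmp.
Qed.

Lemma cmp_seq {E} `{Enc E} (a n : E -> nat) : computable a -> computable n ->
  computable (fun e => seq (a e) (n e)).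
Proof.
  intros Ha Hn.
  apply cmp_ext with
    (fun e => rev (nat_rect (fun _ => list nat) [] (fun i t => (a e + i) :: t) (n e))).
  - intros e. induction (n e) as [|i IH]; [reflexivity|]. simpl nat_rect. simpl rev.
    rewrite IH. symmetry. apply seq_S.
  - apply cmp_rev. apply (cmp_nat_rect n (fun _ => []) (fun e i t => (a e + i) :: t)); cmp.
Qed.

Fixpoint powerset {X} (l : list X) : list (list X) :=
  match l with [] => [[]] | x :: t => powerset t ++ map (cons x) (powerset t) end.

(** A search through [powerset l] thus meets every subset cut out by a predicate, including
    predicates decided only classically. *)
Lemma filter_powerset {X} (f : X -> bool) l : In (filter f l) (powerset l).
Proof.
  induction l as [|x l IH]; simpl; [now left|]. apply in_or_app.
  destruct (f x); [right; now apply in_map|now left].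
Qed.

Lemma powerset_incl {X} (l p : list X) : In p (powerset l) -> incl p l.
Proof.
  revert p. induction l as [|x l IH]; intros p Hp; simpl in Hp.
  - destruct Hp as [<-|[]]. intros y [].
  - apply in_app_or in Hp as [Hp|Hp].
    + intros y Hy. right. now apply (IH p).
    + apply in_map_iff in Hp as (p' & <- & Hp). intros y [->|Hy]; [now left|].
      right. now apply (IH p').
Qed.

Lemma cmp_powerset {E X} `{Enc E} `{Enc X} (l : E -> list X) :
  computable l -> computable (fun e => powerset (l e)).
Proof.
  intros Hl.
  apply cmp_ext with (fun e => fold_right (fun x t => t ++ map (cons x) t) [[]] (l e)).
  - intros e. induction (l e); simpl; congruence.
  - apply (cmp_fold_right l (fun _ => [[]]) (fun e x t => t ++ map (cons x) t)); cmp.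
    apply cmp_app; cmp. apply (cmp_map (fun p y => fst (snd p) :: y)); cmp.
Qed.

Definition vectors (n b : nat) : list (list nat) :=
  nat_rect (fun _ => list (list nat)) [[]]
    (fun _ vs => flat_map (fun x => map (cons x) vs) (seq 0 (S b))) n.

Lemma in_vectors n b g :
  In g (vectors n b) <-> length g = n /\ forall x, In x g -> x <= b.
Proof.
  revert g. induction n as [|n IH]; intros g.
  - simpl. split.
    + intros [<-|[]]. split; [reflexivity|intros x []].
    + intros [Hg _]. destruct g; [now left|discriminate].
  - change (vectors (S n) b) with
      (flat_map (fun x => map (cons x) (vectors n b)) (seq 0 (S b))).
    rewrite in_flat_map. split.
    + intros (x & Hx & Hg). apply in_seq in Hx. apply in_map_iff in Hg as (t & <- & Ht).
      apply IH in Ht as [<- Ht]. split; [reflexivity|].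
      intros y [->|Hy]; [lia|now apply Ht].
    + intros [Hl Hg]. destruct g as [|x t]; [discriminate|]. exists x. split.
      * apply in_seq. specialize (Hg x (or_introl eq_refl)). lia.
      * apply in_map, IH. simpl in Hl. split; [lia|]. intros y Hy. apply Hg. now right.
Qed.

Lemma cmp_vectors {E} `{Enc E} (n b : E -> nat) : computable n -> computable b ->
  computable (fun e => vectors (n e) (b e)).
Proof.
  intros Hn Hb. unfold vectors.
  apply (cmp_nat_rect n (fun _ => [[]])
    (fun e _ vs => flat_map (fun x => map (cons x) vs) (seq 0 (S (b e))))); cmp.
  apply (cmp_flat_map (fun p x => map (cons x) (snd (snd p)))).
  - apply (cmp_map (fun p y => snd p :: y)); cmp.
  - apply cmp_seq; cmp.
Qed.

(** * Decoding of lists and course-of-values recursion *)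

Fixpoint tolist_fuel (f n : nat) : list nat :=
  match f, n with
  | S f', S c => ufst c :: tolist_fuel f' (usnd c)
  | _, _ => []
  end.
Definition tolist (n : nat) : list nat := tolist_fuel n n.

Lemma usnd_le n : usnd n <= n.
Proof.
  rewrite <- (pair_unpair n) at 2.
  pose proof (to_nat_non_decreasing (ufst n) (usnd n)). unfold pair_nat. lia.
Qed.

(** Pairing is surjective, so every number codes a list; the fuel [n] suffices because [usnd] does
    not increase its argument and one successor is removed per step. *)
Lemma enc_tolist n : enc (tolist n) = n.
Proof.
  unfold tolist. enough (H : forall f n, n <= f -> enc (tolist_fuel f n) = n) by now apply H.
  clear n. induction f as [|f IH]; intros [|c] Hc; try reflexivity; [lia|].
  simpl. change (S (pair_nat (ufst c) (enc (tolist_fuel f (usnd c)))) = S c).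
  rewrite IH; [|pose proof (usnd_le c); lia]. now rewrite pair_unpair.
Qed.

Definition enc_injective X `{Enc X} : Prop := forall x y : X, enc x = enc y -> x = y.

Lemma enc_prod_inj X Y `{Enc X} `{Enc Y} :
  enc_injective X -> enc_injective Y -> enc_injective (X * Y).
Proof.
  intros HX HY [x y] [x' y'] Hp.
  change (pair_nat (enc x) (enc y) = pair_nat (enc x') (enc y')) in Hp.
  f_equal; [apply HX|apply HY].
  - rewrite <- (ufst_pair (enc x) (enc y)), Hp. apply ufst_pair.
  - rewrite <- (usnd_pair (enc x) (enc y)), Hp. apply usnd_pair.
Qed.

Lemma enc_list_inj X `{Enc X} : enc_injective X -> enc_injective (list X).
Proof.
  intros HX l. induction l as [|x l IH]; intros [|y l'] Hl; try reflexivity; try discriminate.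
  change (S (pair_nat (enc x) (enc l)) = S (pair_nat (enc y) (enc l'))) in Hl.
  apply Nat.succ_inj in Hl. f_equal; [apply HX|apply IH].
  - rewrite <- (ufst_pair (enc x) (enc l)), Hl. apply ufst_pair.
  - rewrite <- (usnd_pair (enc x) (enc l)), Hl. apply usnd_pair.
Qed.

Lemma enc_nat_inj : enc_injective nat.
Proof. intros x y Hxy. exact Hxy. Qed.

Lemma enc_list_enc (l : list nat) : enc_list l = enc l.
Proof.
  induction l as [|x l IH]; [reflexivity|].
  change (S (pair_nat x (enc_list l)) = S (pair_nat x (enc l))). now rewrite IH.
Qed.

Lemma tolist_enc_list l : tolist (enc_list l) = l.
Proof. apply (enc_list_inj nat enc_nat_inj). now rewrite enc_tolist, enc_list_enc. Qed.

(** Decoding leaves the code unchanged, so the function that computes [f] on codes already computes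
    its decoding. *)
Lemma cmp_tolist {E} `{Enc E} (f : E -> nat) : computable f ->
  computable (fun e => tolist (f e)).
Proof.
  intros (F & HF & EF). exists F. split; [exact HF|].
  intros e. rewrite EF. now rewrite enc_tolist.
Qed.

(* Course-of-values recursion: [hist step n] lists the values at [n-1], ..., [0]. *)
Definition hist (step : nat -> list nat -> nat) (n : nat) : list nat :=
  nat_rect (fun _ => list nat) [] (fun i h => step i h :: h) n.
Definition cov (step : nat -> list nat -> nat) (n : nat) : nat := step n (hist step n).
(** The history starts with the most recent value, so the value at [j] has index [n - 1 - j]. *)
Definition prior (h : list nat) (n j : nat) : nat := nth (n - S j) h 0.

Lemma prior_hist step n j : j < n -> prior (hist step n) n j = cov step j.
Proof.
  unfold prior. induction n as [|n IH]; intros Hj; [lia|].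
  change (hist step (S n)) with (cov step n :: hist step n).
  destruct (Nat.eq_dec j n) as [->|Hne].
  - now replace (S n - S n) with 0 by lia.
  - replace (S n - S j) with (S (n - S j)) by lia. simpl. apply IH. lia.
Qed.

Lemma cmp_cov {E} `{Enc E} (step : E -> nat -> list nat -> nat) (n : E -> nat) :
  computable (fun p : E * (nat * list nat) => step (fst p) (fst (snd p)) (snd (snd p))) ->
  computable n -> computable (fun e => cov (step e) (n e)).
Proof.
  intros Hs Hn. unfold cov.
  assert (Hh : computable (fun e => hist (step e) (n e))).
  { apply (cmp_nat_rect n (fun _ => []) (fun e i h => step e i h :: h)); cmp. }
  exact (cmp_comp _ (fun e => (e, (n e, hist (step e) (n e)))) Hs
    (cmp_pair _ _ cmp_id (cmp_pair _ _ Hn Hh))).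
Qed.

Ltac cmp_lists :=
  first
  [ simple apply cmp_app
  | simple apply cmp_map
  | simple apply cmp_filter
  | simple apply cmp_existsb
  | simple apply cmp_forallb
  | simple apply cmp_flat_map
  | simple apply cmp_list_prod
  | simple apply cmp_length
  | simple apply cmp_skipn
  | simple apply cmp_nth
  | simple apply cmp_seq
  | simple apply cmp_powerset
  | simple apply cmp_vectors
  | simple apply cmp_tolist ].
Ltac cmp_user ::= cmp_lists.

Lemma decidable_of_computable (P : nat -> Prop) (f : nat -> bool) :
  computable f -> (forall n, f n = true <-> P n) -> decidable_set P.
Proof.
  intros (F & [r Hr] & EF) Hf. exists r. intros n.
  pose proof (Hr n) as Hn. specialize (EF n). change (enc n) with n in EF. rewrite EF in Hn.
  specialize (Hf n). destruct (f n); split; intros HP; try exact Hn.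
  - now destruct HP; apply Hf.
  - apply Hf in HP. discriminate.
Qed.

(** * Regions *)

Open Scope R_scope.

Definition lt_pred (n : nat) : nat -> Prop := fun i => (i < n)%nat.

(** Natural constants suffice: clocks are nonnegative, and a negative bound on a difference is a
    positive one after swapping the clocks. Differences are recorded even for clocks beyond [M],
    because guards may be diagonal. Strict comparisons follow by negation. *)
Definition eqv (P : nat -> Prop) (M : nat) (v v' : valuation) : Prop :=
  (forall i z, P i -> (z <= M)%nat ->
     (v i <= INR z <-> v' i <= INR z) /\ (INR z <= v i <-> INR z <= v' i)) /\
  (forall i j z, P i -> P j -> (z <= M)%nat ->
     (v i <= v j + INR z <-> v' i <= v' j + INR z) /\
     (v j + INR z <= v i <-> v' j + INR z <= v' i)).

Lemma eqv_refl P M v : eqv P M v v.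
Proof. split; tauto. Qed.

Lemma eqv_sym P M v v' : eqv P M v v' -> eqv P M v' v.
Proof.
  intros [H1 H2]. split.
  - intros i z Hi Hz. specialize (H1 i z Hi Hz). tauto.
  - intros i j z Hi Hj Hz. specialize (H2 i j z Hi Hj Hz). tauto.
Qed.

Lemma eqv_trans P M v1 v2 v3 : eqv P M v1 v2 -> eqv P M v2 v3 -> eqv P M v1 v3.
Proof.
  intros [H1 H2] [K1 K2]. split.
  - intros i z Hi Hz. specialize (H1 i z Hi Hz). specialize (K1 i z Hi Hz). tauto.
  - intros i j z Hi Hj Hz. specialize (H2 i j z Hi Hj Hz). specialize (K2 i j z Hi Hj Hz). tauto.
Qed.

Lemma eqv_weaken (P Q : nat -> Prop) M M' v v' :
  (forall i, Q i -> P i) -> (M' <= M)%nat -> eqv P M v v' -> eqv Q M' v v'.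
Proof.
  intros HP HM [H1 H2]. split.
  - intros i z Hi Hz. apply H1; [auto|lia].
  - intros i j z Hi Hj Hz. apply H2; [auto|auto|lia].
Qed.

Lemma eqv_agree (P : nat -> Prop) M v v' : (forall i, P i -> v i = v' i) -> eqv P M v v'.
Proof.
  intros H. split.
  - intros i z Hi Hz. rewrite (H i Hi). tauto.
  - intros i j z Hi Hj Hz. rewrite (H i Hi), (H j Hj). tauto.
Qed.

Lemma eqv_le_Z P M v v' i (z : Z) : clock_valuation v -> clock_valuation v' ->
  eqv P M v v' -> P i -> (Z.abs z <= Z.of_nat M)%Z ->
  (v i <= IZR z <-> v' i <= IZR z) /\ (IZR z <= v i <-> IZR z <= v' i).
Proof.
  intros Hv Hv' [H1 _] Hi Hz. specialize (Hv i). specialize (Hv' i).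
  destruct (Z_lt_le_dec z 0) as [Hneg|Hpos].
  - apply IZR_lt in Hneg. split; split; intros; lra.
  - rewrite <- (Z2Nat.id z Hpos), <- INR_IZR_INZ. apply H1; [exact Hi|lia].
Qed.

Lemma eqv_diff_Z P M v v' i j (z : Z) :
  eqv P M v v' -> P i -> P j -> (Z.abs z <= Z.of_nat M)%Z ->
  (v i - v j <= IZR z <-> v' i - v' j <= IZR z) /\
  (IZR z <= v i - v j <-> IZR z <= v' i - v' j).
Proof.
  intros [_ H2] Hi Hj Hz.
  destruct (Z_lt_le_dec z 0) as [Hneg|Hpos].
  - assert (E : IZR z = - INR (Z.to_nat (- z))).
    { rewrite INR_IZR_INZ, Z2Nat.id by lia. rewrite opp_IZR. ring. }
    rewrite E. destruct (H2 j i (Z.to_nat (- z)) Hj Hi ltac:(lia)) as [A B].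
    split; split; intros K; lra.
  - assert (E : IZR z = INR (Z.to_nat z)).
    { now rewrite INR_IZR_INZ, Z2Nat.id. }
    rewrite E. destruct (H2 i j (Z.to_nat z) Hi Hj ltac:(lia)) as [A B].
    split; split; intros K; lra.
Qed.

Lemma cmp_sem_iff c a b z :
  (a <= z <-> b <= z) /\ (z <= a <-> z <= b) -> (cmp_sem c a z <-> cmp_sem c b z).
Proof.
  intros [[H1 H2] [H3 H4]].
  destruct (Rle_dec a z), (Rle_dec z a), (Rle_dec b z), (Rle_dec z b); try tauto;
    destruct c; simpl; split; intros; try lra; tauto.
Qed.

Lemma sat_eqv n M g v v' : guard_clocks_lt n g -> guard_consts_le M g ->
  clock_valuation v -> clock_valuation v' -> eqv (lt_pred n) M v v' ->
  (sat v g <-> sat v' g).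
Proof.
  intros Hn HM Hv Hv' He. induction g as [|x c z|x y c z|g IH|g1 IH1 g2 IH2|g1 IH1 g2 IH2];
    simpl in Hn, HM |- *; try tauto.
  - apply cmp_sem_iff. now apply eqv_le_Z with (lt_pred n) M.
  - destruct Hn. apply cmp_sem_iff. now apply eqv_diff_Z with (lt_pred n) M.
Qed.

Lemma list_lower_bound (hi : list R) : exists x, forall b, In b hi -> x < b.
Proof.
  induction hi as [|b hi [x Hx]]; [exists 0; intros b []|].
  exists (Rmin x (b - 1)). intros c [<-|Hc].
  - pose proof (Rmin_r x (b - 1)). lra.
  - specialize (Hx c Hc). pose proof (Rmin_l x (b - 1)). lra.
Qed.

Lemma between_point_list a (hi : list R) : (forall b, In b hi -> a < b) ->
  exists x, a < x /\ forall b, In b hi -> x < b.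
Proof.
  induction hi as [|b hi IH]; intros H; [exists (a + 1); split; [lra|intros b []]|].
  destruct IH as (x & Hax & Hx); [intros c Hc; apply H; now right|].
  specialize (H b (or_introl eq_refl)).
  exists (Rmin x ((a + b) / 2)). split; [apply Rmin_glb_lt; lra|]. intros c [<-|Hc].
  - pose proof (Rmin_r x ((a + b) / 2)). lra.
  - specialize (Hx c Hc). pose proof (Rmin_l x ((a + b) / 2)). lra.
Qed.

Lemma list_max_real (l : list R) : l = [] \/ exists a, In a l /\ forall b, In b l -> b <= a.
Proof.
  induction l as [|c l [->|(a & Ha & H)]]; [now left| |]; right.
  - exists c. split; [now left|]. intros b [->|[]]. lra.
  - destruct (Rle_dec a c).
    + exists c. split; [now left|]. intros b [->|Hb]; [lra|]. specialize (H b Hb). lra.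
    + exists a. split; [now right|]. intros b [->|Hb]; [lra|]. now apply H.
Qed.

Lemma between_lists (lo hi : list R) : (forall a b, In a lo -> In b hi -> a < b) ->
  exists x, (forall a, In a lo -> a < x) /\ (forall b, In b hi -> x < b).
Proof.
  intros H. destruct (list_max_real lo) as [->|(a & Ha & Hm)].
  - destruct (list_lower_bound hi) as [x Hx]. exists x. split; [intros a []|exact Hx].
  - destruct (between_point_list a hi) as (x & Hax & Hx); [auto|].
    exists x. split; [|exact Hx]. intros b Hb. specialize (Hm b Hb). lra.
Qed.

(** The back-and-forth step for dense orders without endpoints: [L] is the graph of a finite order
    isomorphism, which extends to one more point. *)
Lemma extend_order (L : list (R * R)) d :
  (forall p q, In p L -> In q L -> (fst p <= fst q <-> snd p <= snd q)) ->
  exists d', forall p, In p L ->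
    (fst p <= d <-> snd p <= d') /\ (d <= fst p <-> d' <= snd p).
Proof.
  intros H. destruct (classic (exists p, In p L /\ fst p = d)) as [(p & Hp & <-)|Hno].
  - exists (snd p). intros q Hq. split; apply H; assumption.
  - destruct (between_lists
      (map snd (filter (fun p => if Rlt_dec (fst p) d then true else false) L))
      (map snd (filter (fun p => if Rlt_dec d (fst p) then true else false) L)))
      as (x & Hlo & Hhi).
    + intros a b Ha Hb. apply in_map_iff in Ha as (p & <- & Hp), Hb as (q & <- & Hq).
      apply filter_In in Hp as [Hp Hpd], Hq as [Hq Hqd].
      destruct (Rlt_dec (fst p) d); [|discriminate]. destruct (Rlt_dec d (fst q)); [|discriminate].
      apply Rnot_le_lt. intros K. apply H in K; [lra|assumption|assumption].
    + exists x. intros p Hp.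
      destruct (Rtotal_order (fst p) d) as [Hlt|[Heq|Hgt]].
      * assert (snd p < x).
        { apply Hlo, in_map, filter_In. split; [exact Hp|]. now destruct (Rlt_dec (fst p) d). }
        split; split; intros; lra.
      * destruct Hno. now exists p.
      * assert (x < snd p).
        { apply Hhi, in_map, filter_In. split; [exact Hp|]. now destruct (Rlt_dec d (fst p)). }
        split; split; intros; lra.
Qed.

Lemma clock_valuation_shift v d : clock_valuation v -> 0 <= d -> clock_valuation (shift v d).
Proof. intros Hv Hd i. specialize (Hv i). unfold shift. lra. Qed.

Lemma INR_diff_le (x y : R) (z1 z2 : nat) :
  INR z1 - x <= INR z2 - y <->
  (if (z1 <=? z2)%nat then y <= x + INR (z2 - z1) else y + INR (z1 - z2) <= x).
Proof.
  destruct (Nat.leb_spec z1 z2) as [Hle|Hlt].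
  - rewrite minus_INR by exact Hle. split; intros; lra.
  - rewrite minus_INR by lia. split; intros; lra.
Qed.

(* Only the events "clock i reaches z" with 0 <= z <= M matter, and their relative order is
   recorded by the difference constraints with constants at most M. *)
Lemma eqv_delay N M v v' d : clock_valuation v -> clock_valuation v' ->
  eqv (lt_pred N) M v v' -> 0 <= d ->
  exists d', 0 <= d' /\ eqv (lt_pred N) M (shift v d) (shift v' d').
Proof.
  intros Hv Hv' [H1 H2] Hd.
  (* The pair [(0, 0)] forces the matching delay to be nonnegative. *)
  set (L := (0, 0) :: map (fun p => (INR (snd p) - v (fst p), INR (snd p) - v' (fst p)))
              (list_prod (seq 0 N) (seq 0 (S M)))).
  destruct (extend_order L d) as [d' Hd'].
  { assert (HL : forall p, In p L -> p = (0, 0) \/ exists i z, (i < N)%nat /\ (z <= M)%nat /\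
        p = (INR z - v i, INR z - v' i)).
    { intros p [<-|Hp]; [now left|right]. apply in_map_iff in Hp as ([i z] & <- & Hp).
      apply in_prod_iff in Hp as [Hi Hz]. apply in_seq in Hi, Hz. exists i, z. simpl.
      repeat split; lia. }
    intros p q Hp Hq. apply HL in Hp, Hq.
    destruct Hp as [->|(i & z & Hi & Hz & ->)], Hq as [->|(j & y & Hj & Hy & ->)]; simpl.
    - tauto.
    - destruct (H1 j y Hj Hy) as [A _]. split; intros K; lra.
    - destruct (H1 i z Hi Hz) as [_ A]. split; intros K; lra.
    - rewrite !INR_diff_le. destruct (Nat.leb_spec z y).
      + apply (H2 j i (y - z)%nat Hj Hi). lia.
      + apply (H2 i j (z - y)%nat Hi Hj). lia. }
  exists d'. split.
  - destruct (Hd' (0, 0) (or_introl eq_refl)) as [A _]. now apply A.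
  - split.
    + intros i z Hi Hz.
      destruct (Hd' (INR z - v i, INR z - v' i)) as [A B].
      { right. apply in_map_iff. exists (i, z). split; [reflexivity|].
        apply in_prod; apply in_seq; unfold lt_pred in Hi; lia. }
      simpl in A, B. unfold shift. split; split; intros K; lra.
    + intros i j z Hi Hj Hz. destruct (H2 i j z Hi Hj Hz) as [A B].
      unfold shift. split; split; intros K; lra.
Qed.

(** The difference between a reset clock and another one is, up to sign, the value of the other
    clock, whose comparisons with constants are already recorded. *)
Lemma eqv_zero_on P M v v' (Q : nat -> bool) : clock_valuation v -> clock_valuation v' ->
  eqv P M v v' ->
  eqv P M (fun i => if Q i then 0 else v i) (fun i => if Q i then 0 else v' i).
Proof.
  intros Hv Hv' [H1 H2]. split.
  - intros i z Hi Hz. destruct (Q i); [tauto|]. now apply H1.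
  - intros i j z Hi Hj Hz. destruct (Q i), (Q j).
    + tauto.
    + specialize (H1 j 0%nat Hj ltac:(lia)). simpl INR in H1.
      pose proof (Hv j). pose proof (Hv' j). pose proof (pos_INR z).
      split; [split; intros; lra|].
      destruct z as [|z].
      * simpl INR. rewrite !Rplus_0_r. tauto.
      * assert (0 < INR (S z)) by (apply lt_0_INR; lia). split; intros; lra.
    + rewrite !Rplus_0_l. now apply H1.
    + now apply H2.
Qed.

(** * Grid representatives of regions *)

Definition gval (D : nat) (g : list nat) : valuation :=
  fun i => INR (nth i g 0%nat) / INR D.

Lemma gval_nonneg D g : (0 < D)%nat -> clock_valuation (gval D g).
Proof.
  intros HD i. unfold gval. apply Rle_mult_inv_pos; [apply pos_INR|now apply lt_0_INR].
Qed.

Lemma div_le_iff D a b z : (0 < D)%nat ->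
  (INR a / INR D <= INR b / INR D + INR z <-> (a <= b + z * D)%nat).
Proof.
  intros HD. assert (0 < INR D) by now apply lt_0_INR.
  assert (E : INR b / INR D + INR z = INR (b + z * D) / INR D).
  { rewrite plus_INR, mult_INR. field. lra. }
  rewrite E. split; intros K.
  - apply INR_le. apply Rmult_le_reg_r with (/ INR D); [now apply Rinv_0_lt_compat|exact K].
  - apply Rmult_le_compat_r; [left; now apply Rinv_0_lt_compat|now apply le_INR].
Qed.

Lemma div_ge_iff D a b z : (0 < D)%nat ->
  (INR b / INR D + INR z <= INR a / INR D <-> (b + z * D <= a)%nat).
Proof.
  intros HD. assert (0 < INR D) by now apply lt_0_INR.
  assert (E : INR b / INR D + INR z = INR (b + z * D) / INR D).
  { rewrite plus_INR, mult_INR. field. lra. }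
  rewrite E. split; intros K.
  - apply INR_le. apply Rmult_le_reg_r with (/ INR D); [now apply Rinv_0_lt_compat|exact K].
  - apply Rmult_le_compat_r; [left; now apply Rinv_0_lt_compat|now apply le_INR].
Qed.

Lemma div_le_nat D a z : (0 < D)%nat -> (INR a / INR D <= INR z <-> (a <= z * D)%nat).
Proof.
  intros HD. rewrite <- (div_le_iff D a 0 z HD). simpl INR.
  replace (0 / INR D + INR z) with (INR z); [tauto|]. unfold Rdiv. ring.
Qed.

Lemma div_ge_nat D a z : (0 < D)%nat -> (INR z <= INR a / INR D <-> (z * D <= a)%nat).
Proof.
  intros HD. rewrite <- (div_ge_iff D a 0 z HD). simpl INR.
  replace (0 / INR D + INR z) with (INR z); [tauto|]. unfold Rdiv. ring.
Qed.

Definition geqv (N M D : nat) (g g' : nat -> nat) : Prop :=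
  (forall i z, (i < N)%nat -> (z <= M)%nat ->
     ((g i <= z * D)%nat <-> (g' i <= z * D)%nat) /\ ((z * D <= g i)%nat <-> (z * D <= g' i)%nat)) /\
  (forall i j z, (i < N)%nat -> (j < N)%nat -> (z <= M)%nat ->
     ((g i <= g j + z * D)%nat <-> (g' i <= g' j + z * D)%nat) /\
     ((g j + z * D <= g i)%nat <-> (g' j + z * D <= g' i)%nat)).

Lemma geqv_eqv N M D g g' : (0 < D)%nat ->
  geqv N M D g g' <->
  eqv (lt_pred N) M (fun i => INR (g i) / INR D) (fun i => INR (g' i) / INR D).
Proof.
  intros HD. unfold geqv, eqv, lt_pred.
  split; intros [H1 H2]; split.
  - intros i z Hi Hz. rewrite !div_le_nat, !div_ge_nat by exact HD. now apply H1.
  - intros i j z Hi Hj Hz. rewrite !div_le_iff, !div_ge_iff by exact HD. now apply H2.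
  - intros i z Hi Hz. specialize (H1 i z Hi Hz).
    rewrite !div_le_nat, !div_ge_nat in H1 by exact HD. exact H1.
  - intros i j z Hi Hj Hz. specialize (H2 i j z Hi Hj Hz).
    rewrite !div_le_iff, !div_ge_iff in H2 by exact HD. exact H2.
Qed.

Lemma nat_floor x : 0 <= x -> exists n, INR n <= x < INR n + 1.
Proof.
  intros Hx. destruct (archimed x) as [A B].
  assert (0 < up x)%Z by (apply lt_IZR; lra).
  exists (Z.to_nat (up x - 1)). rewrite INR_IZR_INZ, Z2Nat.id by lia.
  rewrite minus_IZR. lra.
Qed.

Lemma filter_length_mono {X} (f g : X -> bool) l :
  (forall x, In x l -> f x = true -> g x = true) ->
  (length (filter f l) <= length (filter g l))%nat.
Proof.
  induction l as [|x l IH]; intros H; [auto|]. simpl.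
  assert (length (filter f l) <= length (filter g l))%nat by (apply IH; intros; apply H; simpl; auto).
  pose proof (H x (or_introl eq_refl)) as Hx.
  destruct (f x), (g x); simpl; try lia; now discriminate Hx.
Qed.

Lemma filter_length_lt {X} (f g : X -> bool) l y :
  (forall x, In x l -> f x = true -> g x = true) ->
  In y l -> f y = false -> g y = true ->
  (length (filter f l) < length (filter g l))%nat.
Proof.
  induction l as [|x l IH]; intros H Hy Hf Hg; [destruct Hy|]. simpl.
  assert (length (filter f l) <= length (filter g l))%nat
    by (apply filter_length_mono; intros; apply H; simpl; auto).
  pose proof (H x (or_introl eq_refl)) as Hx.
  destruct Hy as [->|Hy].
  - rewrite Hf, Hg. simpl. lia.
  - assert (length (filter f l) < length (filter g l))%nat
      by (apply IH; auto; intros; apply H; simpl; auto).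
    destruct (f x), (g x); simpl; try lia; now discriminate Hx.
Qed.

Lemma filter_false {X} (l : list X) : filter (fun _ => false) l = [].
Proof. induction l; auto. Qed.

Lemma lex_real a b x y : 0 <= x < 1 -> 0 <= y < 1 ->
  (INR a + x <= INR b + y <-> (a < b)%nat \/ (a = b /\ x <= y)).
Proof.
  intros Hx Hy. split.
  - intros K. destruct (Nat.lt_trichotomy a b) as [Hl|[->|Hl]]; [now left|right; split; [auto|lra]|].
    apply le_INR in Hl. rewrite S_INR in Hl. lra.
  - intros [Hl|[-> Hl]]; [|lra]. apply le_INR in Hl. rewrite S_INR in Hl. lra.
Qed.

Lemma lex_nat D a b r s : (r < D)%nat -> (s < D)%nat ->
  ((a * D + r <= b * D + s)%nat <-> (a < b)%nat \/ (a = b /\ (r <= s)%nat)).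
Proof.
  intros Hr Hs. split.
  - intros K. destruct (Nat.lt_trichotomy a b) as [Hl|[->|Hl]]; [now left|right; split; [auto|lia]|].
    assert (S b * D <= a * D)%nat by now apply Nat.mul_le_mono_r. simpl in *. lia.
  - intros [Hl|[-> Hl]]; [|lia].
    assert (S a * D <= b * D)%nat by now apply Nat.mul_le_mono_r. simpl in *. lia.
Qed.

(** Only the order of the fractional parts and whether they vanish matter for a region. Each
    fractional part is replaced by its rank over [D]; there are at most [N] nonzero ones, so ranks
    stay below [D]. The result serves all constants [M] at once. *)
Lemma grid_of_valuation N D v : (N < D)%nat -> clock_valuation v ->
  exists g : nat -> nat, forall M, eqv (lt_pred N) M (fun i => INR (g i) / INR D) v.
Proof.
  intros HD Hv.
  destruct (choice (fun i n => INR n <= v i < INR n + 1)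
              (fun i => nat_floor (v i) (Hv i))) as [fl Hfl].
  set (fr := fun i => v i - INR (fl i)).
  assert (Hfr : forall i, 0 <= fr i < 1) by (intros i; specialize (Hfl i); unfold fr; lra).
  (* Only nonzero fractional parts are counted, so that rank 0 means an integer value. *)
  set (below := fun i j => if Rlt_dec 0 (fr j) then if Rle_dec (fr j) (fr i) then true else false
                           else false).
  set (rk := fun i => length (filter (below i) (seq 0 N))).
  assert (Hrk : forall i, (rk i < D)%nat).
  { intros i. unfold rk. pose proof (filter_length_le (below i) (seq 0 N)) as Hle.
    rewrite length_seq in Hle. lia. }
  assert (Hord : forall i j, (i < N)%nat -> (rk i <= rk j)%nat <-> fr i <= fr j).
  { intros i j Hi. split; intros K.
    - apply Rnot_lt_le. intros Hlt. apply Nat.le_ngt in K. apply K. unfold rk.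
      apply filter_length_lt with i.
      + intros x _. unfold below. destruct (Rlt_dec 0 (fr x)); [|auto].
        destruct (Rle_dec (fr x) (fr j)); [|discriminate].
        destruct (Rle_dec (fr x) (fr i)); [auto|lra].
      + apply in_seq. lia.
      + unfold below. destruct (Rlt_dec 0 (fr i)); [|auto].
        destruct (Rle_dec (fr i) (fr j)); [lra|auto].
      + unfold below. pose proof (Hfr j). destruct (Rlt_dec 0 (fr i)); [|lra].
        destruct (Rle_dec (fr i) (fr i)); [auto|lra].
    - apply filter_length_mono. intros x _. unfold below. destruct (Rlt_dec 0 (fr x)); [|auto].
      destruct (Rle_dec (fr x) (fr i)); [|discriminate].
      destruct (Rle_dec (fr x) (fr j)); [auto|lra]. }
  assert (Hzero : forall i, (i < N)%nat -> (rk i <= 0)%nat <-> fr i <= 0).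
  { intros i Hi. split; intros K.
    - apply Rnot_lt_le. intros Hlt. apply Nat.le_ngt in K. apply K.
      apply Nat.le_lt_trans with (length (filter (fun _ : nat => false) (seq 0 N))); [lia|].
      apply filter_length_lt with i; [discriminate|apply in_seq; lia|auto|].
      unfold below. destruct (Rlt_dec 0 (fr i)); [|lra]. destruct (Rle_dec (fr i) (fr i)); [auto|lra].
    - unfold rk. rewrite (filter_ext _ (fun _ => false)).
      + rewrite filter_false. auto.
      + intros x. unfold below. destruct (Rlt_dec 0 (fr x)); [|auto].
        destruct (Rle_dec (fr x) (fr i)); [lra|auto]. }
  assert (Hpos : (0 < D)%nat) by lia.
  assert (Ev : forall i, v i = INR (fl i) + fr i) by (intros; unfold fr; ring).
  assert (Ez : forall z, INR z = INR z + 0) by (intros; ring).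
  exists (fun i => fl i * D + rk i)%nat. intros M. split.
  - intros i z Hi Hz. rewrite div_le_nat, div_ge_nat by exact Hpos.
    rewrite (Ev i), (Ez z), <- (Nat.add_0_r (z * D)).
    rewrite !lex_nat, !lex_real by (try apply Hfr; try apply Hrk; lia || lra).
    rewrite (Hzero i Hi). pose proof (Hfr i). split; [tauto|].
    split; (intros [K|[K K']]; [now left|right; split; [exact K|lia || lra]]).
  - intros i j z Hi Hj Hz. rewrite div_le_iff, div_ge_iff by exact Hpos.
    rewrite (Ev i), (Ev j).
    replace (INR (fl j) + fr j + INR z) with (INR (fl j + z) + fr j) by (rewrite plus_INR; ring).
    replace (fl j * D + rk j + z * D)%nat with ((fl j + z) * D + rk j)%nat by ring.
    rewrite !lex_nat, !lex_real by (try apply Hfr; try apply Hrk).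
    rewrite (Hord i j Hi), (Hord j i Hj). tauto.
Qed.

Fixpoint sum_upto (g : nat -> nat) (n : nat) : nat :=
  match n with 0 => 0 | S i => g i + sum_upto g i end%nat.

Lemma sum_upto_le g h n : (forall i, (i < n)%nat -> (g i <= h i)%nat) ->
  (sum_upto g n <= sum_upto h n)%nat.
Proof.
  induction n as [|n IH]; intros H; simpl; [lia|].
  pose proof (H n ltac:(lia)). specialize (IH ltac:(auto)). lia.
Qed.

Lemma sum_upto_lt g h n i : (forall i, (i < n)%nat -> (g i <= h i)%nat) ->
  (i < n)%nat -> (g i < h i)%nat -> (sum_upto g n < sum_upto h n)%nat.
Proof.
  induction n as [|n IH]; intros H Hi Hlt; simpl; [lia|].
  pose proof (H n ltac:(lia)).
  destruct (Nat.eq_dec i n) as [->|Hne].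
  - pose proof (sum_upto_le g h n ltac:(auto)). lia.
  - specialize (IH ltac:(auto) ltac:(lia) Hlt). lia.
Qed.

(* An empty window of width (M+2)D below a large entry can be narrowed by D
   without changing any comparison. *)
Lemma grid_compress N M D g : (0 < D)%nat ->
  exists g', geqv N M D g g' /\ forall i, (i < N)%nat -> (g' i <= N * ((M + 2) * D))%nat.
Proof.
  intros HD. set (w := ((M + 2) * D)%nat).
  remember (sum_upto g N) as s eqn:Es. revert g Es.
  induction s as [s IH] using lt_wf_ind. intros g ->.
  destruct (classic (exists i, (i < N)%nat /\ (N * w < g i)%nat)) as [(i0 & Hi0 & Hbig)|Hno].
  2:{ exists g. split.
      - split; intros; tauto.
      - intros i Hi. apply Nat.nlt_ge. intros K. apply Hno. now exists i. }
  assert (Hgap : exists t, (t < N)%nat /\ forall i, (i < N)%nat ->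
             (g i <= t * w)%nat \/ (S t * w < g i)%nat).
  { apply NNPP. intros Hn.
    (* Pigeonhole: if each of the [N] windows contained an entry, choosing one per window would be
       an injection of the [N] indices into themselves, hence onto, although entry [i0] lies above
       all windows. *)
    assert (Hall : forall t, exists i, (t < N)%nat -> (i < N)%nat /\ (t * w < g i <= S t * w)%nat).
    { intros t. apply NNPP. intros K. apply Hn. exists t.
      assert (Ht : (t < N)%nat).
      { apply Nat.nle_gt. intros K'. apply K. exists 0%nat. lia. }
      split; [exact Ht|]. intros i Hi. destruct (le_lt_dec (g i) (t * w)); [now left|right].
      apply Nat.nle_gt. intros K'. apply K. exists i. auto. }
    destruct (choice _ Hall) as [h Hh].
    assert (Hinj : bInjective N h).
    { intros a b Ha Hb Hab. destruct (Hh a Ha) as [_ Ka], (Hh b Hb) as [_ Kb].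
      rewrite Hab in Ka.
      destruct (Nat.lt_trichotomy a b) as [Hl|[->|Hl]]; [|reflexivity|].
      - assert (S a * w <= b * w)%nat by now apply Nat.mul_le_mono_r. lia.
      - assert (S b * w <= a * w)%nat by now apply Nat.mul_le_mono_r. lia. }
    apply bInjective_bSurjective in Hinj; [|intros t Ht; now apply Hh].
    destruct (Hinj i0 Hi0) as (t & Ht & E). destruct (Hh t Ht) as [_ K]. rewrite E in K.
    assert (S t * w <= N * w)%nat by now apply Nat.mul_le_mono_r. lia. }
  destruct Hgap as (t & Ht & Hgap).
  set (g1 := fun i => if (g i <=? t * w)%nat then g i else (g i - D)%nat).
  assert (HwD : (D <= w)%nat) by (unfold w; nia).
  assert (HSt : (S t * w = t * w + w)%nat) by ring.
  assert (HStN : (S t * w <= N * w)%nat) by now apply Nat.mul_le_mono_r.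
  assert (Hcase : forall i, (i < N)%nat -> ((g i <= t * w)%nat /\ g1 i = g i) \/
             ((S t * w < g i)%nat /\ (g1 i + D = g i)%nat)).
  { intros i Hi. unfold g1. destruct (Nat.leb_spec (g i) (t * w)); [now left|right].
    destruct (Hgap i Hi); lia. }
  assert (Hzw : forall z, (z <= M)%nat -> (z * D + D + D <= w)%nat).
  { intros z Hz. assert (z * D <= M * D)%nat by now apply Nat.mul_le_mono_r. unfold w. lia. }
  assert (Hg1 : geqv N M D g g1).
  { split.
    - intros i z Hi Hz. specialize (Hzw z Hz). destruct (Hcase i Hi) as [[A B]|[A B]]; lia.
    - intros i j z Hi Hj Hz. specialize (Hzw z Hz).
      destruct (Hcase i Hi) as [[A B]|[A B]], (Hcase j Hj) as [[A' B']|[A' B']]; lia. }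
  destruct (IH (sum_upto g1 N)) with (g := g1) as (g' & Hg' & Hb); [|reflexivity|].
  { apply sum_upto_lt with i0; [|exact Hi0|].
    - intros i Hi. destruct (Hcase i Hi) as [[A B]|[A B]]; lia.
    - destruct (Hcase i0 Hi0) as [[A B]|[A B]]; lia. }
  exists g'. split; [|exact Hb].
  apply geqv_eqv; [exact HD|]. apply geqv_eqv in Hg1, Hg'; try exact HD.
  eapply eqv_trans; eassumption.
Qed.

Lemma nth_map_seq (f : nat -> nat) N i : (i < N)%nat -> nth i (map f (seq 0 N)) 0%nat = f i.
Proof.
  intros Hi. rewrite nth_indep with (d' := f 0%nat) by (rewrite length_map, length_seq; exact Hi).
  rewrite map_nth, seq_nth by exact Hi. reflexivity.
Qed.

(** Bounded numerators make the set of representatives finite; this is where the game becomes a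
    finite graph. *)
Lemma grid_rep N M D B v : (N < D)%nat -> (N * ((M + 2) * D) <= B)%nat -> clock_valuation v ->
  exists g, length g = N /\ (forall x, In x g -> (x <= B)%nat) /\
            eqv (lt_pred N) M (gval D g) v.
Proof.
  intros HD HB Hv. destruct (grid_of_valuation N D v HD Hv) as [g Hg].
  destruct (grid_compress N M D g ltac:(lia)) as (g' & Hgg & Hb).
  exists (map g' (seq 0 N)). split; [now rewrite length_map, length_seq|]. split.
  - intros x Hx. apply in_map_iff in Hx as (i & <- & Hi). apply in_seq in Hi.
    specialize (Hb i ltac:(lia)). lia.
  - apply eqv_trans with (fun i => INR (g' i) / INR D).
    + apply eqv_agree. intros i Hi. unfold gval. now rewrite nth_map_seq.
    + eapply eqv_trans; [|apply Hg]. apply eqv_sym, geqv_eqv; [lia|exact Hgg].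
Qed.

(** * The separation game *)

(** A classical decision, used in proofs to name subsets of finite lists; the decision procedure
    never evaluates it. *)
Definition cdec (P : Prop) : bool := if excluded_middle_informative P then true else false.

Lemma cdec_true P : cdec P = true <-> P.
Proof. unfold cdec. destruct (excluded_middle_informative P); split; auto; discriminate. Qed.

Definition conf := nat -> valuation -> Prop.

(* A joint valuation holds the clocks of the separator at indices below [k] and the clocks of
   the automaton from index [k] on. *)
Section Joint.
Variable k : nat.
Variable U : list transition.

Definition av (v : valuation) : valuation := fun i => v (k + i)%nat.

Definition jreset (v : valuation) (X r : list nat) : valuation :=
  fun i => if (if (i <? k)%nat then existsb (Nat.eqb i) X else existsb (Nat.eqb (i - k)) r)
           then 0 else v i.

(** Silent runs indexed by their duration. Delays are steps of their own, so that a run can be cut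
    at any moment and each step can be matched separately in an equivalent valuation. *)
Inductive erun : nat -> valuation -> R -> nat -> valuation -> Prop :=
| er_nil q v : erun q v 0 q v
| er_delay q v d e q' v' : 0 <= d -> erun q (shift v d) e q' v' -> erun q v (d + e) q' v'
| er_eps tr v e q' v' : In tr U -> lab tr = None -> sat (av v) (grd tr) ->
    erun (tgt tr) (jreset v [] (rst tr)) e q' v' -> erun (src tr) v e q' v'.

Definition post (a : nat) (phi : valuation -> Prop) (X : list nat) (C : conf) : conf :=
  fun q' v' => exists q v d v1 tr, C q v /\ erun q v d (src tr) v1 /\ phi v1 /\ In tr U /\
    lab tr = Some a /\ sat (av v1) (grd tr) /\ q' = tgt tr /\ v' = jreset v1 X (rst tr).

(* A silent observation, at which only separator clocks are reset. *)
Definition tick (phi : valuation -> Prop) (X : list nat) (C : conf) : conf :=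
  fun q' v' => exists q v d v1, C q v /\ erun q v d q' v1 /\ phi v1 /\ v' = jreset v1 X [].

Definition reaches (C : conf) (F : nat -> Prop) : Prop :=
  exists q v d q1 v1, C q v /\ erun q v d q1 v1 /\ F q1.

Definition safe (FA FB : nat -> Prop) (C : conf) : Prop := ~ (reaches C FA /\ reaches C FB).

Definition nonneg_conf (C : conf) : Prop := forall q v, C q v -> clock_valuation v.

(* The separator observes letters and clock regions up to [m] and answers with resets; it wins
   if words of both languages never become indistinguishable. *)
Definition Gwin (FA FB : nat -> Prop) (m : nat) (C0 : conf) : Prop :=
  exists Fam : conf -> Prop, Fam C0 /\ forall C, Fam C -> nonneg_conf C /\ safe FA FB C /\
    forall a u, clock_valuation u -> exists X, incl X (seq 0 k) /\
      exists C', Fam C' /\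
        forall q v, post a (fun w => eqv (lt_pred k) m w u) X C q v -> C' q v.

Lemma shift_shift v d e : shift (shift v d) e = shift v (d + e).
Proof. apply functional_extensionality. intros i. unfold shift. ring. Qed.

Lemma shift_0 v : shift v 0 = v.
Proof. apply functional_extensionality. intros i. unfold shift. ring. Qed.

Lemma clock_valuation_jreset v X r : clock_valuation v -> clock_valuation (jreset v X r).
Proof. intros Hv i. unfold jreset. destruct (if (i <? k)%nat then _ else _); [lra|apply Hv]. Qed.

Lemma clock_valuation_av v : clock_valuation v -> clock_valuation (av v).
Proof. intros Hv i. apply Hv. Qed.

Lemma erun_nonneg q v d q' v' : erun q v d q' v' -> clock_valuation v ->
  0 <= d /\ clock_valuation v'.
Proof.
  induction 1 as [q v|q v d e q' v' Hd Hr IH|tr v e q' v' Hin Hlab Hs Hr IH]; intros Hv.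
  - split; [lra|exact Hv].
  - destruct IH as [He Hv']; [now apply clock_valuation_shift|]. split; [lra|exact Hv'].
  - apply IH. now apply clock_valuation_jreset.
Qed.

Lemma erun_observed q v d q' v' : erun q v d q' v' -> forall x, (x < k)%nat -> v' x = v x + d.
Proof.
  induction 1 as [q v|q v d e q' v' Hd Hr IH|tr v e q' v' Hin Hlab Hs Hr IH]; intros x Hx.
  - ring.
  - rewrite IH by exact Hx. unfold shift. ring.
  - rewrite IH by exact Hx. unfold jreset. apply Nat.ltb_lt in Hx. rewrite Hx. reflexivity.
Qed.

Lemma erun_trans q v d q1 v1 e q2 v2 : erun q v d q1 v1 -> erun q1 v1 e q2 v2 ->
  erun q v (d + e) q2 v2.
Proof.
  induction 1 as [q v|q v d e' q' v' Hd Hr IH|tr v e' q' v' Hin Hlab Hs Hr IH]; intros He.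
  - now rewrite Rplus_0_l.
  - rewrite Rplus_assoc. apply er_delay; [exact Hd|now apply IH].
  - apply er_eps; auto.
Qed.

Lemma erun_split q v d q' v' : erun q v d q' v' -> forall s, 0 <= s <= d ->
  exists q1 v1, erun q v s q1 v1 /\ erun q1 v1 (d - s) q' v'.
Proof.
  induction 1 as [q v|q v d e q' v' Hd Hr IH|tr v e q' v' Hin Hlab Hs Hr IH]; intros s Hs'.
  - exists q, v. replace s with 0 by lra. rewrite Rminus_0_r. split; constructor.
  - destruct (Rle_dec s d).
    + exists q, (shift v s). split.
      * replace s with (s + 0) at 1 by ring. apply er_delay; [lra|constructor].
      * replace (d + e - s) with ((d - s) + e) by ring. apply er_delay; [lra|].
        rewrite shift_shift. now replace (s + (d - s)) with d by ring.
    + destruct (IH (s - d)) as (q1 & v1 & H1 & H2); [lra|]. exists q1, v1. split.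
      * replace s with (d + (s - d)) by ring. now apply er_delay.
      * now replace (d + e - s) with (e - (s - d)) by ring.
  - destruct (IH s Hs') as (q1 & v1 & H1 & H2). exists q1, v1. split; [|exact H2].
    now apply er_eps.
Qed.

Definition patch (w v : valuation) : valuation := fun i => if (i <? k)%nat then w i else v i.

(* Epsilon-runs neither read nor reset the separator clocks. *)
Lemma erun_patch q v d q' v' : erun q v d q' v' -> forall w,
  erun q (patch w v) d q' (patch (shift w d) v').
Proof.
  induction 1 as [q v|q v d e q' v' Hd Hr IH|tr v e q' v' Hin Hlab Hs Hr IH]; intros w.
  - rewrite shift_0. constructor.
  - rewrite <- shift_shift. apply er_delay; [exact Hd|].
    replace (shift (patch w v) d) with (patch (shift w d) (shift v d)); [apply IH|].
    apply functional_extensionality. intros i. unfold shift, patch. now destruct (i <? k)%nat.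
  - apply er_eps; [exact Hin|exact Hlab| |].
    + replace (av (patch w v)) with (av v); [exact Hs|].
      apply functional_extensionality. intros i. unfold av, patch.
      destruct (Nat.ltb_spec (k + i) k); [lia|reflexivity].
    + replace (jreset (patch w v) [] (rst tr)) with (patch w (jreset v [] (rst tr))); [apply IH|].
      apply functional_extensionality. intros i. unfold jreset, patch.
      destruct (i <? k)%nat; reflexivity.
Qed.

Lemma av_patch w v : av (patch w v) = av v.
Proof.
  apply functional_extensionality. intros i. unfold av, patch.
  destruct (Nat.ltb_spec (k + i) k); [lia|reflexivity].
Qed.

Lemma eqv_av n M v v' : eqv (lt_pred (k + n)) M v v' -> eqv (lt_pred n) M (av v) (av v').
Proof.
  intros [H1 H2]. split.
  - intros i z Hi Hz. apply H1; [|exact Hz]. unfold lt_pred in *. lia.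
  - intros i j z Hi Hj Hz. apply H2; [| |exact Hz]; unfold lt_pred in *; lia.
Qed.

Lemma eqv_jreset P M v v' X r : clock_valuation v -> clock_valuation v' ->
  eqv P M v v' -> eqv P M (jreset v X r) (jreset v' X r).
Proof. apply eqv_zero_on. Qed.

Definition bounded_guards (n M : nat) : Prop :=
  forall tr, In tr U -> guard_clocks_lt n (grd tr) /\ guard_consts_le M (grd tr).

Lemma sat_av_eqv n M tr v v' : bounded_guards n M -> In tr U ->
  clock_valuation v -> clock_valuation v' -> eqv (lt_pred (k + n)) M v v' ->
  sat (av v) (grd tr) -> sat (av v') (grd tr).
Proof.
  intros HU Hin Hv Hv' He Hs. destruct (HU tr Hin) as [Hc HM].
  apply (sat_eqv n M (grd tr) (av v) (av v')); auto using clock_valuation_av, eqv_av.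
Qed.

(** Region equivalence is a time-abstract bisimulation: every delay is matched by [eqv_delay], so
    the duration of the matching run may be different. *)
Lemma erun_eqv n M : bounded_guards n M -> forall q v d q1 v1, erun q v d q1 v1 ->
  forall v', clock_valuation v -> clock_valuation v' -> eqv (lt_pred (k + n)) M v v' ->
  exists d' v1', erun q v' d' q1 v1' /\ eqv (lt_pred (k + n)) M v1 v1'.
Proof.
  intros HU q v d q1 v1.
  induction 1 as [q v|q v d e q1 v1 Hd Hr IH|tr v e q1 v1 Hin Hlab Hs Hr IH]; intros v' Hv Hv' He.
  - exists 0, v'. split; [constructor|exact He].
  - destruct (eqv_delay (k + n) M v v' d Hv Hv' He Hd) as (d' & Hd' & He').
    destruct (IH (shift v' d')) as (e' & v1' & H1 & H2); auto using clock_valuation_shift.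
    exists (d' + e'), v1'. split; [now apply er_delay|exact H2].
  - destruct (IH (jreset v' [] (rst tr))) as (e' & v1' & H1 & H2);
      auto using clock_valuation_jreset, eqv_jreset.
    exists e', v1'. split; [|exact H2]. apply er_eps; auto.
    now apply sat_av_eqv with n M v.
Qed.

Lemma post_nonneg a phi X C : nonneg_conf C -> nonneg_conf (post a phi X C).
Proof.
  intros HC q' v' (q & v & d & v1 & tr & Hq & Hr & _ & _ & _ & _ & _ & ->).
  apply clock_valuation_jreset. now apply (erun_nonneg _ _ _ _ _ Hr), (HC q).
Qed.

Lemma tick_nonneg phi X C : nonneg_conf C -> nonneg_conf (tick phi X C).
Proof.
  intros HC q' v' (q & v & d & v1 & Hq & Hr & _ & ->).
  apply clock_valuation_jreset. now apply (erun_nonneg _ _ _ _ _ Hr), (HC q).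
Qed.

End Joint.

(** * Finite abstraction of sets of configurations *)

Definition rep (N M : nat) (C : conf) : conf :=
  fun q w => exists v, C q v /\ eqv (lt_pred N) M v w.

Definition node := (nat * list nat)%type.

(** The regions that meet [C], named by all grid points in them. If [nodes] covers every region,
    this list determines the region closure of [C]. *)
Definition code (N M D : nat) (nodes : list node) (C : conf) : list node :=
  filter (fun nd => cdec (rep N M C (fst nd) (gval D (snd nd)))) nodes.

Lemma in_code N M D nodes C nd :
  In nd (code N M D nodes C) <-> In nd nodes /\ rep N M C (fst nd) (gval D (snd nd)).
Proof. unfold code. rewrite filter_In, cdec_true. tauto. Qed.

Lemma rep_eqv N M C q w w' : rep N M C q w -> eqv (lt_pred N) M w w' -> rep N M C q w'.
Proof. intros (v & Hv & He) He'. exists v. split; [exact Hv|]. eapply eqv_trans; eassumption. Qed.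

(** A run from a valuation merely equivalent to a member of [C] is matched by a run from that
    member. The predicate [phi] has to be invariant, so that the matching run is observed alike. *)
Lemma post_rep k U n M a (phi : valuation -> Prop) X C q v :
  bounded_guards U n M -> nonneg_conf C ->
  (forall w w', eqv (lt_pred (k + n)) M w w' -> phi w -> phi w') ->
  clock_valuation v -> rep (k + n) M C q v ->
  forall d tr v1, erun k U q v d (src tr) v1 -> phi v1 -> In tr U -> lab tr = Some a ->
  sat (av k v1) (grd tr) ->
  rep (k + n) M (post k U a phi X C) (tgt tr) (jreset k v1 X (rst tr)).
Proof.
  intros HU HC Hphi Hv (v0 & Hv0 & He) d tr v1 Hr Hp Hin Hlab Hs.
  assert (Hn0 : clock_valuation v0) by now apply (HC q).
  destruct (erun_eqv k U n M HU _ _ _ _ _ Hr v0 Hv Hn0 (eqv_sym _ _ _ _ He))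
    as (d' & v1' & Hr' & He').
  assert (clock_valuation v1) by now apply (erun_nonneg _ _ _ _ _ _ _ Hr).
  assert (clock_valuation v1') by now apply (erun_nonneg _ _ _ _ _ _ _ Hr').
  exists (jreset k v1' X (rst tr)). split.
  - exists q, v0, d', v1', tr. repeat split; auto.
    + now apply Hphi with v1.
    + now apply sat_av_eqv with U n M v1.
  - apply eqv_jreset; auto. now apply eqv_sym.
Qed.

Lemma tick_rep k U n M (phi : valuation -> Prop) X C q v :
  bounded_guards U n M -> nonneg_conf C ->
  (forall w w', eqv (lt_pred (k + n)) M w w' -> phi w -> phi w') ->
  clock_valuation v -> rep (k + n) M C q v ->
  forall d q1 v1, erun k U q v d q1 v1 -> phi v1 ->
  rep (k + n) M (tick k U phi X C) q1 (jreset k v1 X []).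
Proof.
  intros HU HC Hphi Hv (v0 & Hv0 & He) d q1 v1 Hr Hp.
  assert (Hn0 : clock_valuation v0) by now apply (HC q).
  destruct (erun_eqv k U n M HU _ _ _ _ _ Hr v0 Hv Hn0 (eqv_sym _ _ _ _ He))
    as (d' & v1' & Hr' & He').
  assert (clock_valuation v1) by now apply (erun_nonneg _ _ _ _ _ _ _ Hr).
  assert (clock_valuation v1') by now apply (erun_nonneg _ _ _ _ _ _ _ Hr').
  exists (jreset k v1' X []). split.
  - exists q, v0, d', v1'. repeat split; auto. now apply Hphi with v1.
  - apply eqv_jreset; auto. now apply eqv_sym.
Qed.

Lemma reaches_rep k U n M (F : nat -> Prop) C q v :
  bounded_guards U n M -> nonneg_conf C -> clock_valuation v -> rep (k + n) M C q v ->
  forall d q1 v1, erun k U q v d q1 v1 -> F q1 -> reaches k U C F.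
Proof.
  intros HU HC Hv (v0 & Hv0 & He) d q1 v1 Hr HF.
  destruct (erun_eqv k U n M HU _ _ _ _ _ Hr v0 Hv (HC q v0 Hv0) (eqv_sym _ _ _ _ He))
    as (d' & v1' & Hr' & He').
  now exists q, v0, d', q1, v1'.
Qed.

(** * Counters *)

Open Scope nat_scope.

(** The digits [l] read in base [b], most significant first: for digits below [b] and equal lengths,
    lexicographic order is the order of these numbers. *)
Definition horner (b : nat) (l : list nat) : nat := fold_left (fun acc d => acc * b + d) l 0.

Lemma horner_acc b l : forall a,
  fold_left (fun acc d => acc * b + d) l a = a * b ^ length l + horner b l.
Proof.
  unfold horner. induction l as [|d l IH]; intros a; simpl; [lia|].
  rewrite (IH (a * b + d)), (IH d). ring.
Qed.

Lemma horner_app b l r : horner b (l ++ r) = horner b l * b ^ length r + horner b r.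
Proof. unfold horner at 1. rewrite fold_left_app. apply horner_acc. Qed.

Lemma horner_snoc b l x : horner b (l ++ [x]) = horner b l * b + x.
Proof. rewrite horner_app. simpl. unfold horner. simpl. lia. Qed.

Lemma horner_lt b l : (forall d, In d l -> d < b) -> horner b l < b ^ length l.
Proof.
  induction l as [|d l IH] using rev_ind; intros H; [simpl; auto|].
  rewrite horner_snoc, length_app. simpl length.
  replace (length l + 1) with (S (length l)) by lia. rewrite Nat.pow_succ_r'.
  assert (horner b l < b ^ length l) by (apply IH; intros; apply H, in_or_app; auto).
  assert (d < b) by (apply H, in_or_app; simpl; auto). nia.
Qed.

Lemma horner_prefix b l1 r1 l2 r2 : length r1 = length r2 -> (forall d, In d r2 -> d < b) ->
  horner b (l1 ++ r1) <= horner b (l2 ++ r2) -> horner b l1 <= horner b l2.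
Proof.
  intros Hlen Hd. rewrite !horner_app, Hlen. pose proof (horner_lt b r2 Hd). nia.
Qed.

Lemma horner_mono b (c c' : nat -> nat) l : (forall x, In x l -> c x <= c' x) ->
  horner b (map c l) <= horner b (map c' l).
Proof.
  induction l as [|x l IH] using rev_ind; intros H; [simpl; auto|].
  rewrite !map_app. simpl map. rewrite !horner_snoc.
  assert (horner b (map c l) <= horner b (map c' l)) by (apply IH; intros; apply H, in_or_app; auto).
  assert (c x <= c' x) by (apply H, in_or_app; simpl; auto). nia.
Qed.

Lemma bounded_max (P : nat -> Prop) b : (forall n, P n -> n <= b) -> (exists n, P n) ->
  exists n, P n /\ forall n', P n' -> n' <= n.
Proof.
  intros Hb [n Hn]. remember (b - n) as d eqn:Ed. revert n Hn Ed.
  induction d as [d IH] using lt_wf_ind. intros n Hn ->.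
  destruct (classic (exists n', P n' /\ n < n')) as [(n' & Hn' & Hlt)|Hno].
  - pose proof (Hb n' Hn'). pose proof (Hb n Hn).
    apply (IH (b - n')) with n'; auto. lia.
  - exists n. split; [exact Hn|]. intros n' Hn'. apply Nat.nlt_ge. intros K. apply Hno.
    now exists n'.
Qed.

(* A play with [k] unbounded counters, each bounded by [m] along some strategy [W], is turned
   into one whose counters are bounded independently of [m]: in every state the new strategy
   plays as if the counters had the value that is lexicographically maximal in [W], where
   recently reset counters are the least significant ones. *)
Section Counters.
Variable K : Type.
Variable keys : list K.
Variable W : K -> (nat -> nat) -> Prop.
Variables k m : nat.
Hypothesis W_le : forall s c x, W s c -> c x <= m.

(** The second component stands for a reset order; [vectors k k] contains all permutations of the
    clocks. *)
Definition states : list (K * list nat) := list_prod keys (vectors k k).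

(** Counters are at most [m], so base [S m] turns vectors into numbers with a bounded, hence
    attained, maximum. The premise sits under the quantifier so that choice yields a total function,
    with junk on states without winning counters. *)
Lemma lexmax_exists (s : K * list nat) : exists c, (exists c', W (fst s) c') ->
  W (fst s) c /\
  forall c', W (fst s) c' -> horner (S m) (map c' (snd s)) <= horner (S m) (map c (snd s)).
Proof.
  destruct s as [s pi]. simpl.
  destruct (classic (exists c, W s c)) as [[c0 H0]|Hno].
  2:{ exists (fun _ => 0). tauto. }
  destruct (bounded_max (fun n => exists c, W s c /\ n = horner (S m) (map c pi))
              (S m ^ length pi)) as (n & (c & Hc & ->) & Hmax).
  - intros n (c & Hc & ->). apply Nat.lt_le_incl. rewrite <- (length_map c pi). apply horner_lt.
    intros d Hd. apply in_map_iff in Hd as (x & <- & _). apply Nat.lt_succ_r. now apply W_le with s.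
  - now exists (horner (S m) (map c0 pi)), c0.
  - exists c. intros _. split; [exact Hc|]. intros c' Hc'. apply Hmax. now exists c'.
Qed.

Definition lexmax (s : K * list nat) : nat -> nat :=
  proj1_sig (constructive_indefinite_description _ (lexmax_exists s)).

Lemma lexmax_spec s : (exists c, W (fst s) c) -> W (fst s) (lexmax s) /\
  forall c', W (fst s) c' ->
    horner (S m) (map c' (snd s)) <= horner (S m) (map (lexmax s) (snd s)).
Proof. unfold lexmax. destruct (constructive_indefinite_description _ _). auto. Qed.

Definition prefix_value (j : nat) (s : K * list nat) : nat :=
  horner (S m) (map (lexmax s) (firstn j (snd s))).

(** Prefix values may grow with [m]; their position among the values of the finitely many states
    keeps every strict increase but is bounded independently of [m]. *)
Definition rank (j : nat) (s : K * list nat) : nat :=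
  length (filter (fun s' => prefix_value j s' <? prefix_value j s) states).

Lemma rank_le j s : rank j s <= length states.
Proof. apply filter_length_le. Qed.

Lemma rank_mono j s s' : prefix_value j s <= prefix_value j s' -> rank j s <= rank j s'.
Proof. intros H. apply filter_length_mono. intros x _. rewrite !Nat.ltb_lt. lia. Qed.

Lemma rank_strict j s s' : In s states -> prefix_value j s < prefix_value j s' ->
  rank j s < rank j s'.
Proof.
  intros Hs H. apply filter_length_lt with s; [|exact Hs| |].
  - intros x _. rewrite !Nat.ltb_lt. lia.
  - apply Nat.ltb_irrefl.
  - now apply Nat.ltb_lt.
Qed.

(** In [good_bound], a counter is paid for in two ways. While its clock keeps its place in [pi], the
    rank rises with each tick; each move towards the front releases a fresh block of
    [S (length states)]. *)
Record good (s : K) (pi : list nat) (ct : nat -> nat) : Prop := {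
  good_key : In s keys;
  good_W : exists c, W s c;
  good_len : length pi = k;
  good_ran : forall x, In x pi <-> x < k;
  good_bound : forall x, x < k -> exists l1 l2, pi = l1 ++ x :: l2 /\
    ct x <= (k - length l1) * S (length states) + rank (S (length l1)) (s, pi)
}.

Lemma good_state s pi ct : good s pi ct -> In (s, pi) states.
Proof.
  intros Hg. apply in_prod; [apply Hg|]. apply in_vectors. split; [apply Hg|].
  intros x Hx. apply Hg in Hx. lia.
Qed.

Lemma good_le s pi ct x : good s pi ct -> x < k -> ct x < S k * S (length states).
Proof.
  intros Hg Hx. destruct (good_bound _ _ _ Hg x Hx) as (l1 & l2 & _ & Hb).
  pose proof (rank_le (S (length l1)) (s, pi)). nia.
Qed.

Definition move_last (Q : nat -> bool) (pi : list nat) : list nat :=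
  filter (fun x => negb (Q x)) pi ++ filter Q pi.

Lemma firstn_snoc {X} (l1 : list X) x l2 : firstn (S (length l1)) (l1 ++ x :: l2) = l1 ++ [x].
Proof.
  replace (S (length l1)) with (length (l1 ++ [x])) by (rewrite length_app; simpl; lia).
  change (l1 ++ x :: l2) with (l1 ++ [x] ++ l2). rewrite app_assoc.
  rewrite firstn_app, Nat.sub_diag, firstn_all. simpl. apply app_nil_r.
Qed.

Lemma filter_all {X} (f : X -> bool) l : (forall x, In x l -> f x = true) -> filter f l = l.
Proof.
  induction l as [|x l IH]; intros H; [reflexivity|]. simpl.
  rewrite (H x (or_introl eq_refl)). f_equal. apply IH. intros; apply H. now right.
Qed.

Lemma filter_drop {X} (f : X -> bool) l y : In y l -> f y = false ->
  length (filter f l) < length l.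
Proof.
  intros Hy Hf. pose proof (filter_length_lt f (fun _ => true) l y) as H.
  rewrite (filter_all (fun _ => true)) in H by auto. auto.
Qed.

(** The given strategy moves from the maximal counters of the old state to [c'], which then competes
    for the maximum of the new state. Clocks in [Q] go to the least significant end, and [delta]
    marks the clocks that tick. *)
Lemma good_step s pi ct s' c' ct' (Q : nat -> bool) (delta : nat -> nat) :
  good s pi ct -> In s' keys -> W s' c' ->
  (forall x, delta x <= 1) ->
  (forall x, x < k -> Q x = false ->
     c' x = lexmax (s, pi) x + delta x /\ ct' x <= ct x + delta x) ->
  (forall x, x < k -> Q x = true -> ct' x = 0) ->
  good s' (move_last Q pi) ct'.
Proof.
  intros Hg Hs' Hc' Hdelta Hkeep Hreset.
  assert (Hin : forall x, In x (move_last Q pi) <-> x < k).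
  { intros x. rewrite <- (good_ran _ _ _ Hg). unfold move_last. rewrite in_app_iff, !filter_In.
    destruct (Q x); simpl; intuition congruence. }
  split.
  - exact Hs'.
  - now exists c'.
  - unfold move_last. rewrite length_app, Nat.add_comm, filter_length. apply Hg.
  - exact Hin.
  - intros x Hx. destruct (Q x) eqn:Qx.
    { apply Hin in Hx as Hx'. apply in_split in Hx' as (l1 & l2 & E). exists l1, l2.
      split; [exact E|]. rewrite (Hreset x Hx Qx). apply Nat.le_0_l. }
    destruct (Hkeep x Hx Qx) as [Ec Ect].
    destruct (good_bound _ _ _ Hg x Hx) as (l1 & l2 & E & Hb).
    assert (Hlen : length l1 < k).
    { rewrite <- (good_len _ _ _ Hg), E, length_app. simpl. lia. }
    assert (E' : move_last Q pi = filter (fun x => negb (Q x)) l1 ++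
               x :: (filter (fun x => negb (Q x)) l2 ++ filter Q pi)).
    { unfold move_last. rewrite E at 1. rewrite filter_app. simpl. rewrite Qx. simpl.
      rewrite <- app_assoc. reflexivity. }
    eexists _, _. split; [exact E'|].
    destruct (classic (exists y, In y l1 /\ Q y = true)) as [(y & Hy & Qy)|Hno].
    (* A reset clock ahead of [x] moves [x] forward; the additional block covers the old rank
       together with the tick. *)
    + pose proof (filter_drop (fun x => negb (Q x)) l1 y Hy ltac:(simpl; now rewrite Qy)) as Hshort.
      pose proof (rank_le (S (length l1)) (s, pi)). specialize (Hdelta x).
      assert ((k - length l1 + 1) * S (length states) <=
        (k - length (filter (fun x => negb (Q x)) l1)) * S (length states)) as Hmul by
        (apply Nat.mul_le_mono_r; lia).
      rewrite Nat.mul_add_distr_r, Nat.mul_1_l in Hmul. lia.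
    + assert (Hl1 : filter (fun x => negb (Q x)) l1 = l1).
      { apply filter_all. intros y Hy. destruct (Q y) eqn:Qy; [|reflexivity].
        destruct Hno. now exists y. }
      rewrite Hl1 in E' |- *.
      assert (Hl1k : forall y, In y l1 -> y < k).
      { intros y Hy. apply (good_ran _ _ _ Hg). rewrite E. apply in_or_app. now left. }
      assert (Hl1Q : forall y, In y l1 -> Q y = false).
      { intros y Hy. destruct (Q y) eqn:Qy; [|reflexivity]. destruct Hno. now exists y. }
      destruct (lexmax_spec (s', move_last Q pi)) as [HW' Hmax]; [now exists c'|].
      simpl fst in HW', Hmax. simpl snd in Hmax.
      (* On this prefix [c'] exceeds the old maximum by at least [delta x]. As [c'] wins in the new
         state, the new maximum is at least [c'], and [horner_prefix] restricts this comparison to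
         the prefix. *)
      assert (Hpv : prefix_value (S (length l1)) (s, pi) + delta x <=
                    prefix_value (S (length l1)) (s', move_last Q pi)).
      { unfold prefix_value. simpl snd.
        rewrite E' at 2. rewrite E at 2. rewrite !firstn_snoc.
        apply Nat.le_trans with (horner (S m) (map c' (l1 ++ [x]))).
        - rewrite !map_app. simpl map. rewrite !horner_snoc, Ec.
          assert (horner (S m) (map (lexmax (s, pi)) l1) <= horner (S m) (map c' l1)).
          { apply horner_mono. intros y Hy.
            destruct (Hkeep y (Hl1k y Hy) (Hl1Q y Hy)). lia. }
          nia.
        - specialize (Hmax c' Hc').
          assert (E2 : move_last Q pi = (l1 ++ [x]) ++ (filter (fun x => negb (Q x)) l2 ++ filter Q pi))
            by (rewrite <- app_assoc; exact E').
          rewrite E2 in Hmax at 1 3. rewrite !(map_app _ (l1 ++ [x])) in Hmax.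
          apply horner_prefix in Hmax; [exact Hmax|now rewrite !length_map|].
          intros d Hd. apply in_map_iff in Hd as (y & <- & _). apply Nat.lt_succ_r.
          now apply W_le with s'. }
      pose proof (good_state _ _ _ Hg) as Hst.
      assert (rank (S (length l1)) (s, pi) + delta x <=
              rank (S (length l1)) (s', move_last Q pi)).
      { specialize (Hdelta x). destruct (delta x) as [|[|]]; [| |lia].
        - rewrite Nat.add_0_r in *. now apply rank_mono.
        - pose proof (rank_strict (S (length l1)) (s, pi) (s', move_last Q pi) Hst). lia. }
      lia.
Qed.

Lemma good_init s : In s keys -> W s (fun _ => 0) -> good s (seq 0 k) (fun _ => 0).
Proof.
  intros Hs HW. split.
  - exact Hs.
  - now exists (fun _ => 0).
  - apply length_seq.
  - intros x. rewrite in_seq. lia.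
  - intros x Hx. assert (In x (seq 0 k)) as Hx' by (apply in_seq; lia).
    apply in_split in Hx' as (l1 & l2 & E). exists l1, l2. split; [exact E|apply Nat.le_0_l].
Qed.

End Counters.

(** * Bounding the constants *)

Open Scope R_scope.

Lemma existsb_In x l : existsb (Nat.eqb x) l = true <-> In x l.
Proof.
  rewrite existsb_exists. split.
  - intros (y & Hy & E). apply Nat.eqb_eq in E. now subst.
  - intros Hx. exists x. split; [exact Hx|apply Nat.eqb_refl].
Qed.

Section Ticks.
Variables (k : nat) (U : list transition) (FA FB : nat -> Prop).
Variables (n M D : nat) (nodes : list node) (Q : nat -> Prop).
Hypothesis HM : (1 <= M)%nat.
Hypothesis HU : bounded_guards U n M.
Hypothesis Hcov : forall q v, Q q -> clock_valuation v ->
  exists g, In (q, g) nodes /\ eqv (lt_pred (k + n)) M (gval D g) v.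
Hypothesis HQ : forall tr, In tr U -> Q (tgt tr).

(** The finite part of a tick position. Neither counters nor [m] enter, so the number of keys does
    not depend on the strategy. *)
Definition key (CT : conf) (act : nat -> bool) : list node * list nat :=
  (code (k + n) M D nodes CT, filter act (seq 0 k)).
Definition keys : list (list node * list nat) :=
  list_prod (powerset nodes) (powerset (seq 0 k)).
Definition tick_states : list ((list node * list nat) * list nat) :=
  list_prod keys (vectors k k).
(** The bound of [good_le] for these keys; it is computable from [k] and [nodes]. *)
Definition tick_bound : nat := S k * S (length tick_states).

Lemma key_in CT act : In (key CT act) keys.
Proof. apply in_prod; apply filter_powerset. Qed.

Lemma filter_seq_inj (f g : nat -> bool) : filter f (seq 0 k) = filter g (seq 0 k) ->
  forall x, (x < k)%nat -> f x = g x.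
Proof.
  intros E x Hx. assert (Hin : In x (seq 0 k)) by (apply in_seq; lia).
  destruct (f x) eqn:Ef.
  - assert (In x (filter g (seq 0 k))) as Hg by (rewrite <- E; apply filter_In; auto).
    apply filter_In in Hg as [_ ->]. reflexivity.
  - destruct (g x) eqn:Eg; [|reflexivity].
    assert (In x (filter f (seq 0 k))) as Hf by (rewrite E; apply filter_In; auto).
    apply filter_In in Hf as [_ Hf]. congruence.
Qed.

Lemma erun_loc q v d q' v' : erun k U q v d q' v' -> Q q -> Q q'.
Proof. induction 1; auto. Qed.

(* [v'] holds the tick clocks of the valuation [v]: an active clock is counted from its last
   integer value [c x]. *)
Definition trel (act : nat -> bool) (c : nat -> nat) (v v' : valuation) : Prop :=
  (forall i, (k <= i)%nat -> v' i = v i) /\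
  (forall x, (x < k)%nat -> act x = true -> v' x = v x - INR (c x)).

Definition active (act : nat -> bool) : nat -> Prop := fun x => (x < k)%nat /\ act x = true.
(** Constant 1 is enough, because a tick clock is restarted or switched off as soon as it reaches
    1. *)
Definition tobs (act : nat -> bool) (u : valuation) : valuation -> Prop :=
  fun w => eqv (active act) 1 w u.

Lemma tobs_invariant act u w w' :
  eqv (lt_pred (k + n)) M w w' -> tobs act u w -> tobs act u w'.
Proof.
  intros He Hw. apply eqv_trans with w; [|exact Hw]. apply eqv_sym.
  apply eqv_weaken with (lt_pred (k + n)) M; [|exact HM|exact He].
  intros i [Hi _]. unfold lt_pred. lia.
Qed.

Lemma patch_agree v v' : (forall i, (k <= i)%nat -> v' i = v i) -> patch k v v' = v.
Proof.
  intros H. apply functional_extensionality. intros i. unfold patch.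
  destruct (Nat.ltb_spec i k); auto.
Qed.

(** Silent runs ignore the separator clocks, so they can be replayed with real clocks in place of
    tick clocks. Both kinds advance by [d], which preserves the offsets [c]. *)
Lemma erun_transfer act c v v' q d q1 v1' : trel act c v v' -> erun k U q v' d q1 v1' ->
  erun k U q v d q1 (patch k (shift v d) v1') /\ trel act c (patch k (shift v d) v1') v1'.
Proof.
  intros [H1 H2] Hr. split.
  - pose proof (erun_patch _ _ _ _ _ _ _ Hr v) as K. now rewrite patch_agree in K.
  - split.
    + intros i Hi. unfold patch. destruct (Nat.ltb_spec i k); [lia|reflexivity].
    + intros x Hx Ha. rewrite (erun_observed _ _ _ _ _ _ _ Hr x Hx).
      unfold patch, shift. apply Nat.ltb_lt in Hx as Hb. rewrite Hb, H2 by assumption. ring.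
Qed.

Lemma erun_transfer_back act c v v' q d q1 v1 : trel act c v v' -> erun k U q v d q1 v1 ->
  erun k U q v' d q1 (patch k (shift v' d) v1) /\ trel act c v1 (patch k (shift v' d) v1).
Proof.
  intros [H1 H2] Hr. split.
  - pose proof (erun_patch _ _ _ _ _ _ _ Hr v') as K. rewrite patch_agree in K; [exact K|].
    intros i Hi. symmetry. now apply H1.
  - split.
    + intros i Hi. unfold patch. destruct (Nat.ltb_spec i k); [lia|reflexivity].
    + intros x Hx Ha. rewrite (erun_observed _ _ _ _ _ _ _ Hr x Hx).
      unfold patch, shift. apply Nat.ltb_lt in Hx as Hb. rewrite Hb, H2 by assumption. ring.
Qed.

(** A comparison of tick clocks with [z <= 1] is one of the real clocks with [z + ct x], or with
    [z + ct x - ct y] for differences; both stay within [m1]. *)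
Lemma tobs_of_region act ct m1 v1 v1' u :
  eqv (lt_pred k) m1 v1 u ->
  (forall x, (x < k)%nat -> act x = true -> (S (ct x) <= m1)%nat) ->
  (forall x, (x < k)%nat -> act x = true -> v1' x = v1 x - INR (ct x)) ->
  tobs act (fun x => u x - INR (ct x)) v1'.
Proof.
  intros He Hct Hv. split.
  - intros x z [Hx Ha] Hz. rewrite (Hv x Hx Ha). specialize (Hct x Hx Ha).
    destruct He as [H1 _]. destruct (H1 x (z + ct x)%nat Hx ltac:(lia)) as [A B].
    rewrite plus_INR in A, B. split; split; intros K; lra.
  - intros x y z [Hx Hax] [Hy Hay] Hz. rewrite (Hv x Hx Hax), (Hv y Hy Hay).
    pose proof (Hct x Hx Hax). pose proof (Hct y Hy Hay).
    destruct (eqv_diff_Z _ _ _ _ x y (Z.of_nat z + Z.of_nat (ct x) - Z.of_nat (ct y)) He Hx Hy)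
      as [A B]; [lia|].
    rewrite minus_IZR, plus_IZR, <- !INR_IZR_INZ in A, B. split; split; intros K; lra.
Qed.

(** Differences survive delays, so they agree from the start. As for constants, an active clock lies
    in the unit interval above [c x] and touches its endpoints in both valuations alike, and an
    inactive clock is beyond [m]. *)
Lemma region_of_tobs act c m va vb da db :
  eqv (lt_pred k) m va vb -> 0 <= da -> 0 <= db ->
  (forall x, (x < k)%nat -> act x = false -> INR m < va x /\ INR m < vb x) ->
  (forall x, (x < k)%nat -> act x = true ->
     0 <= va x + da - INR (c x) <= 1 /\ 0 <= vb x + db - INR (c x) <= 1 /\
     (va x + da - INR (c x) <= 0 <-> vb x + db - INR (c x) <= 0) /\
     (1 <= va x + da - INR (c x) <-> 1 <= vb x + db - INR (c x))) ->
  eqv (lt_pred k) m (shift va da) (shift vb db).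
Proof.
  intros [_ H2] Hda Hdb Hin Hact. unfold shift. split.
  - intros x z Hx Hz. destruct (act x) eqn:Ha.
    + destruct (Hact x Hx Ha) as ([A1 A2] & [B1 B2] & [C1 C2] & [D1 D2]).
      destruct (Nat.lt_trichotomy z (c x)) as [Hl|[->|Hl]].
      * apply lt_INR in Hl. split; split; intros; lra.
      * split; split; intros; lra.
      * apply le_INR in Hl. rewrite S_INR in Hl.
        destruct (Req_dec (INR z) (INR (c x) + 1)) as [->|Hne]; split; split; intros K; lra.
    + destruct (Hin x Hx Ha). apply le_INR in Hz. split; split; intros; lra.
  - intros i j z Hi Hj Hz. destruct (H2 i j z Hi Hj Hz) as [A B]. split; split; intros K; lra.
Qed.

(** * Tick positions won by the given strategy *)

Section Source.
Variables (m : nat) (Fam : conf -> Prop).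
Hypothesis HFam : forall C, Fam C -> nonneg_conf C /\ safe k U FA FB C /\
    forall a u, clock_valuation u -> exists X, incl X (seq 0 k) /\
      exists C', Fam C' /\
        forall q v, post k U a (fun w => eqv (lt_pred k) m w u) X C q v -> C' q v.

(** Justifies a tick valuation [v'] by a real one [v] that is silently reachable from the strategy
    position [C]. All members of a position share the region of [rho], which lets a single query to
    the strategy answer for all of them. *)
Definition origin (C : conf) (rho : valuation) (act : nat -> bool) (c : nat -> nat)
    (q : nat) (v' v : valuation) : Prop :=
  clock_valuation v /\ trel act c v v' /\
  (forall x, (x < k)%nat -> act x = false -> INR m < v x) /\
  eqv (lt_pred k) m v rho /\ exists q0 v0 d, C q0 v0 /\ erun k U q0 v0 d q v.

Definition TW (CT : conf) (act : nat -> bool) (c : nat -> nat) : Prop :=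
  nonneg_conf CT /\ (forall x, (c x <= m)%nat) /\
  exists C rho, Fam C /\ forall q v', CT q v' -> exists v, origin C rho act c q v' v.

(** Forgets everything about a won tick position except its key and its counters, which is the form
    needed for the counter argument. *)
Definition W (s : list node * list nat) (c : nat -> nat) : Prop :=
  exists CT act, s = key CT act /\ TW CT act c.

Lemma W_le s c x : W s c -> (c x <= m)%nat.
Proof. intros (CT & act & _ & _ & H & _). apply H. Qed.

Lemma TW_ext CT act act' c : (forall x, (x < k)%nat -> act x = act' x) ->
  TW CT act c -> TW CT act' c.
Proof.
  intros E (H1 & H2 & C & rho & HC & H3). repeat split; auto.
  exists C, rho. split; [exact HC|]. intros q v' Hq.
  destruct (H3 q v' Hq) as (v & Hv & [T1 T2] & Hin & He & Hr). exists v.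
  split; [exact Hv|]. split; [split; [exact T1|]|split; [|split; [exact He|exact Hr]]].
  - intros x Hx Ha. apply T2; [exact Hx|]. now rewrite E.
  - intros x Hx Ha. apply Hin; [exact Hx|]. now rewrite E.
Qed.

Lemma TW_safe CT act c : TW CT act c -> safe k U FA FB CT.
Proof.
  intros (H1 & H2 & C & rho & HC & H3). destruct (HFam C HC) as (_ & Hs & _).
  assert (Hre : forall F, reaches k U CT F -> reaches k U C F).
  { intros F (q & v' & d & q1 & v1 & Hq & Hr & HF).
    destruct (H3 q v' Hq) as (v & Hv & Ht & _ & _ & q0 & v0 & d0 & Hq0 & Hr0).
    destruct (erun_transfer _ _ _ _ _ _ _ _ Ht Hr) as [Hr' _].
    exists q0, v0, (d0 + d), q1, (patch k (shift v d) v1). repeat split; auto.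
    eapply erun_trans; eassumption. }
  intros [HA HB]. apply Hs. split; now apply Hre.
Qed.

(* Observations of the tick clocks determine the region of the real clocks. *)
Lemma origin_region CT C rho act c (u : valuation) :
  nonneg_conf CT ->
  (forall q v', CT q v' -> exists v, origin C rho act c q v' v) ->
  (forall x, (x < k)%nat -> act x = true -> u x <= 1) ->
  forall qa va' va da q1 v1' qb vb' vb db q2 w1',
  CT qa va' -> origin C rho act c qa va' va -> erun k U qa va' da q1 v1' -> tobs act u v1' ->
  CT qb vb' -> origin C rho act c qb vb' vb -> erun k U qb vb' db q2 w1' -> tobs act u w1' ->
  eqv (lt_pred k) m (patch k (shift va da) v1') (patch k (shift vb db) w1').
Proof.
  intros HCT Hor Hu qa va' va da q1 v1' qb vb' vb db q2 w1' Ca Oa Ra Ta Cb Ob Rb Tb.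
  destruct Oa as (Na & [_ TRa] & Ia & Ea & _). destruct Ob as (Nb & [_ TRb] & Ib & Eb & _).
  destruct (erun_nonneg _ _ _ _ _ _ _ Ra (HCT _ _ Ca)) as [Da Pa].
  destruct (erun_nonneg _ _ _ _ _ _ _ Rb (HCT _ _ Cb)) as [Db Pb].
  apply eqv_trans with (shift va da).
  { apply eqv_agree. intros i Hi. unfold patch. apply Nat.ltb_lt in Hi. now rewrite Hi. }
  apply eqv_trans with (shift vb db).
  2:{ apply eqv_agree. intros i Hi. unfold patch. apply Nat.ltb_lt in Hi. now rewrite Hi. }
  apply region_of_tobs with act c; auto.
  - eapply eqv_trans; [exact Ea|now apply eqv_sym].
  - intros x Hx Ha.
    pose proof (erun_observed _ _ _ _ _ _ _ Ra x Hx) as Va.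
    pose proof (erun_observed _ _ _ _ _ _ _ Rb x Hx) as Vb.
    rewrite TRa in Va by assumption. rewrite TRb in Vb by assumption.
    replace (va x + da - INR (c x)) with (v1' x) by (rewrite Va; ring).
    replace (vb x + db - INR (c x)) with (w1' x) by (rewrite Vb; ring).
    destruct Ta as [Ta _], Tb as [Tb _].
    destruct (Ta x 0%nat (conj Hx Ha) ltac:(lia)) as [A1 A2].
    destruct (Ta x 1%nat (conj Hx Ha) ltac:(lia)) as [A3 A4].
    destruct (Tb x 0%nat (conj Hx Ha) ltac:(lia)) as [B1 B2].
    destruct (Tb x 1%nat (conj Hx Ha) ltac:(lia)) as [B3 B4].
    simpl INR in *. pose proof (Pa x). pose proof (Pb x). specialize (Hu x Hx Ha).
    repeat split; try tauto.
Qed.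

Definition reqb (x y : R) : bool := if Req_dec_T x y then true else false.

Lemma reqb_true x y : reqb x y = true <-> x = y.
Proof. unfold reqb. destruct (Req_dec_T x y); split; auto; discriminate. Qed.

(** At a tick, a due clock with count below [m] is restarted and counted. One whose count is already
    [m] has reached [m + 1], where the given strategy can no longer compare it with constants, and
    is switched off until its next reset. *)
Definition due (act : nat -> bool) (u : valuation) (x : nat) : bool := act x && reqb (u x) 1.
Definition kept (act : nat -> bool) (u : valuation) (c : nat -> nat) : list nat :=
  filter (fun x => due act u x && (c x <? m)%nat) (seq 0 k).
Definition tick_act (act : nat -> bool) (u : valuation) (c : nat -> nat) (x : nat) : bool :=
  act x && (negb (reqb (u x) 1) || (c x <? m)%nat).
Definition tick_count (act : nat -> bool) (u : valuation) (c : nat -> nat) (x : nat) : nat :=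
  if due act u x then (if (c x <? m)%nat then S (c x) else 0%nat) else c x.

Lemma existsb_kept act u c x : (x < k)%nat ->
  existsb (Nat.eqb x) (kept act u c) = due act u x && (c x <? m)%nat.
Proof.
  intros Hx. apply eq_iff_eq_true. rewrite existsb_In. unfold kept. rewrite filter_In, in_seq.
  split; [tauto|]. intros K. split; [lia|exact K].
Qed.

Lemma tobs_due act u w x : tobs act u w -> (x < k)%nat -> due act u x = true -> w x = 1.
Proof.
  intros [T _] Hx Hd. apply andb_prop in Hd as [Ha Hd]. apply reqb_true in Hd.
  destruct (T x 1%nat (conj Hx Ha) (le_n 1)) as [A B]. simpl INR in *.
  apply Rle_antisym; [apply A|apply B]; lra.
Qed.

(** No letter has been read, so the strategy position [C] stays; only the common region of the real
    clocks is updated. *)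
Lemma TW_tick CT act c u : TW CT act c ->
  (forall x, (x < k)%nat -> act x = true -> u x <= 1) ->
  TW (tick k U (tobs act u) (kept act u c) CT) (tick_act act u c) (tick_count act u c).
Proof.
  intros (H1 & H2 & C & rho & HC & H3) Hu. split; [now apply tick_nonneg|]. split.
  { intros x. unfold tick_count. specialize (H2 x).
    destruct (due act u x), (Nat.ltb_spec (c x) m); lia. }
  destruct (classic (exists q v' v d q1 v1', CT q v' /\ origin C rho act c q v' v /\
              erun k U q v' d q1 v1' /\ tobs act u v1'))
    as [(qb & vb' & vb & db & q2 & w1' & Cb & Ob & Rb & Tb)|Hno].
  2:{ exists C, rho. split; [exact HC|]. intros q1 v2' (q & v' & d & v1' & Hq & Hr & Ho & ->).
      destruct Hno. destruct (H3 q v' Hq) as [v Hv]. now exists q, v', v, d, q1, v1'. }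
  (* One run that fits the observation supplies the new region; by [origin_region] every other
     fitting run ends in it. *)
  exists C, (patch k (shift vb db) w1'). split; [exact HC|].
  intros q1 v2' (q & v' & d & v1' & Hq & Hr & Ho & ->).
  destruct (H3 q v' Hq) as [v Hv]. exists (patch k (shift v d) v1').
  pose proof (origin_region CT C rho act c u H1 H3 Hu _ _ _ _ _ _ _ _ _ _ _ _
    Hq Hv Hr Ho Cb Ob Rb Tb) as Hreg.
  destruct Hv as (Nv & Tv & Iv & Ev & q0 & v0 & d0 & Hq0 & Hr0).
  destruct (erun_transfer _ _ _ _ _ _ _ _ Tv Hr) as [Hr' [T1 T2]].
  destruct (erun_nonneg _ _ _ _ _ _ _ Hr' Nv) as [Hd Nv1].
  assert (Hinact : forall x, (x < k)%nat -> act x = false -> INR m < patch k (shift v d) v1' x).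
  { intros x Hx Ha. specialize (Iv x Hx Ha). unfold patch, shift.
    apply Nat.ltb_lt in Hx as Hb. rewrite Hb. lra. }
  split; [exact Nv1|]. split; [split|split; [|split]].
  - intros i Hi. unfold jreset. destruct (Nat.ltb_spec i k); [lia|]. simpl. now apply T1.
  - intros x Hx Ha. unfold tick_act in Ha. apply andb_prop in Ha as [Ha Hc].
    specialize (T2 x Hx Ha). unfold jreset. apply Nat.ltb_lt in Hx as Hb. rewrite Hb.
    rewrite existsb_kept by exact Hx. unfold tick_count.
    destruct (due act u x) eqn:Hdue; simpl.
    + pose proof (tobs_due _ _ _ _ Ho Hx Hdue) as E1. apply andb_prop in Hdue as [_ Hr1].
      rewrite Hr1 in Hc. simpl in Hc. rewrite Hc. rewrite S_INR. lra.
    + exact T2.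
  - intros x Hx Ha. unfold tick_act in Ha. destruct (act x) eqn:Hact; [|now apply Hinact].
    simpl in Ha. apply orb_false_elim in Ha as [Ha Hc]. apply negb_false_iff in Ha.
    apply Nat.ltb_ge in Hc.
    assert (E1 : v1' x = 1) by (apply (tobs_due act u); auto; unfold due; now rewrite Hact, Ha).
    specialize (T2 x Hx Hact). apply le_INR in Hc. lra.
  - exact Hreg.
  - exists q0, v0, (d0 + d). split; [exact Hq0|]. eapply erun_trans; eassumption.
Qed.

Definition reset_count (X : list nat) (c : nat -> nat) (x : nat) : nat :=
  if existsb (Nat.eqb x) X then 0%nat else c x.

Lemma TW_letter CT act c u a : TW CT act c ->
  (forall x, (x < k)%nat -> act x = true -> u x <= 1) ->
  exists X, incl X (seq 0 k) /\
  TW (post k U a (tobs act u) X CT)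
     (fun x => act x || existsb (Nat.eqb x) X) (reset_count X c).
Proof.
  intros (H1 & H2 & C & rho & HC & H3) Hu.
  assert (Hle : forall X x, (reset_count X c x <= m)%nat).
  { intros X x. unfold reset_count. destruct (existsb (Nat.eqb x) X); [lia|apply H2]. }
  destruct (classic (exists q v' v d q1 v1', CT q v' /\ origin C rho act c q v' v /\
              erun k U q v' d q1 v1' /\ tobs act u v1'))
    as [(qb & vb' & vb & db & q2 & w1' & Cb & Ob & Rb & Tb)|Hno].
  (* No run fits the observation, so the successor set is empty and any answer will do. *)
  2:{ exists []. split; [intros x []|]. split; [now apply post_nonneg|]. split; [apply Hle|].
      exists C, rho. split; [exact HC|].
      intros q1 v2' (q & v' & d & v1' & tr & Hq & Hr & Ho & _).
      destruct Hno. destruct (H3 q v' Hq) as [v Hv]. now exists q, v', v, d, (src tr), v1'. }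
  set (w1 := patch k (shift vb db) w1').
  assert (Nw1 : clock_valuation w1).
  { destruct Ob as (Nb & Tvb & _). destruct (erun_transfer _ _ _ _ _ _ _ _ Tvb Rb) as [Rb' _].
    now apply (erun_nonneg _ _ _ _ _ _ _ Rb'). }
  destruct (HFam C HC) as (_ & _ & Hmove).
  (* All fitting runs have their real clocks in the region of [w1], so the answer given there is
     valid for each of them. *)
  destruct (Hmove a w1 Nw1) as (X & HX & C' & HC' & Hpost).
  exists X. split; [exact HX|]. split; [now apply post_nonneg|]. split; [apply Hle|].
  exists C', (jreset k w1 X []). split; [exact HC'|].
  intros q1 v2' (q & v' & d & v1' & tr & Hq & Hr & Ho & Hin & Hlab & Hs & -> & ->).
  destruct (H3 q v' Hq) as [v Hv].
  pose proof (origin_region CT C rho act c u H1 H3 Hu _ _ _ _ _ _ _ _ _ _ _ _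
    Hq Hv Hr Ho Cb Ob Rb Tb) as Hreg.
  destruct Hv as (Nv & Tv & Iv & Ev & q0 & v0 & d0 & Hq0 & Hr0).
  destruct (erun_transfer _ _ _ _ _ _ _ _ Tv Hr) as [Hr' [T1 T2]].
  destruct (erun_nonneg _ _ _ _ _ _ _ Hr' Nv) as [Hd Nv1].
  set (v1 := patch k (shift v d) v1') in *.
  exists (jreset k v1 X (rst tr)).
  split; [now apply clock_valuation_jreset|]. split; [split|split; [|split]].
  - intros i Hi. unfold jreset. rewrite (T1 i Hi). reflexivity.
  - intros x Hx Ha. unfold jreset, reset_count. apply Nat.ltb_lt in Hx as Hb. rewrite Hb.
    destruct (existsb (Nat.eqb x) X) eqn:Ex; [simpl; ring|].
    rewrite orb_false_r in Ha. now apply T2.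
  - intros x Hx Ha. apply orb_false_elim in Ha as [Ha Ex]. unfold jreset.
    apply Nat.ltb_lt in Hx as Hb. rewrite Hb, Ex. specialize (Iv x Hx Ha).
    unfold v1, patch, shift. rewrite Hb. lra.
  - apply eqv_trans with (jreset k v1 X []).
    + apply eqv_agree. intros i Hi. unfold jreset. apply Nat.ltb_lt in Hi. now rewrite Hi.
    + now apply eqv_jreset.
  - exists (tgt tr), (jreset k v1 X (rst tr)), 0. split; [|constructor].
    apply Hpost. exists q0, v0, (d0 + d), v1, tr.
    split; [exact Hq0|]. split; [eapply erun_trans; eassumption|]. split; [exact Hreg|].
    repeat split; auto. unfold v1. now rewrite av_patch.
Qed.

(** * The strategy with bounded counters *)

Definition goodS (s : list node * list nat) (pi : list nat) (ct : nat -> nat) : Prop :=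
  good _ keys W k m W_le s pi ct.
(** The counters with which the given strategy is consulted; the ticks really seen are counted
    separately by [ct]. *)
Definition cnt (s : list node * list nat) (pi : list nat) : nat -> nat :=
  lexmax _ W m W_le (s, pi).

Definition tracked (s : list node * list nat) (act : nat -> bool) (ct : nat -> nat)
    (q : nat) (v : valuation) : Prop :=
  clock_valuation v /\ Q q /\ exists v', clock_valuation v' /\ trel act ct v v' /\
    (forall x, (x < k)%nat -> act x = true -> v' x < 1) /\
    exists g, In (q, g) (fst s) /\ eqv (lt_pred (k + n)) M (gval D g) v'.

(** Members of [C] are tied to the given strategy only through the key [s]: their tick views lie in
    regions of [s]. A won position with this key is chosen anew at every move, by [inv_TW]. *)
Definition inv (s : list node * list nat) (pi : list nat) (act : nat -> bool)
    (ct : nat -> nat) (rho : valuation) (C : conf) : Prop :=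
  goodS s pi ct /\ snd s = filter act (seq 0 k) /\
  forall q v, C q v -> tracked s act ct q v /\ eqv (lt_pred k) tick_bound v rho.

Definition Fam' (C : conf) : Prop := exists s pi act ct rho, inv s pi act ct rho C.

Lemma inv_TW s pi act ct rho C : inv s pi act ct rho C ->
  exists CT, s = key CT act /\ TW CT act (cnt s pi).
Proof.
  intros (Hg & Hs & _).
  destruct (lexmax_spec _ W m W_le (s, pi)) as [(CT & act0 & E & HT) _]; [apply Hg|].
  simpl in E. exists CT.
  assert (Ea : forall x, (x < k)%nat -> act0 x = act x).
  { apply filter_seq_inj. rewrite <- Hs, E. reflexivity. }
  split.
  - rewrite E. unfold key. f_equal. rewrite <- Hs, E. reflexivity.
  - now apply TW_ext with act0.
Qed.

Lemma inv_lt s pi act ct rho C x : inv s pi act ct rho C -> (x < k)%nat ->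
  (S (ct x) <= tick_bound)%nat.
Proof. intros (Hg & _) Hx. exact (good_le _ _ _ _ _ _ _ _ _ x Hg Hx). Qed.

Lemma rep_of_node CT act q g v' : In (q, g) (fst (key CT act)) ->
  eqv (lt_pred (k + n)) M (gval D g) v' -> rep (k + n) M CT q v'.
Proof.
  intros Hg He. apply in_code in Hg as [_ Hg]. simpl in Hg. now apply rep_eqv with (gval D g).
Qed.

Lemma node_of_rep CT act q v' : Q q -> clock_valuation v' -> rep (k + n) M CT q v' ->
  exists g, In (q, g) (fst (key CT act)) /\ eqv (lt_pred (k + n)) M (gval D g) v'.
Proof.
  intros Hq Hv Hr. destruct (Hcov q v' Hq Hv) as (g & Hg & He). exists g. split; [|exact He].
  apply in_code. split; [exact Hg|]. apply rep_eqv with v'; [exact Hr|]. now apply eqv_sym.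
Qed.

Lemma inv_safe s pi act ct rho C : inv s pi act ct rho C -> safe k U FA FB C.
Proof.
  intros Hinv. destruct (inv_TW _ _ _ _ _ _ Hinv) as (CT & E & HT).
  destruct Hinv as (_ & _ & HC).
  assert (Hre : forall F, reaches k U C F -> reaches k U CT F).
  { intros F (q & v & d & q1 & v1 & Hq & Hr & HF).
    destruct (HC q v Hq) as [(Nv & Qq & v' & Nv' & Ht & _ & g & Hg & He) _].
    destruct (erun_transfer_back _ _ _ _ _ _ _ _ Ht Hr) as [Hr' _].
    rewrite E in Hg.
    apply (reaches_rep k U n M F CT q v' HU (proj1 HT) Nv' (rep_of_node _ _ _ _ _ Hg He)
             _ _ _ Hr' HF). }
  intros [HA HB]. apply (TW_safe _ _ _ HT). split; now apply Hre.
Qed.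

Lemma inv_letter s pi act ct rho C a u : inv s pi act ct rho C -> clock_valuation u ->
  (forall x, (x < k)%nat -> act x = true -> u x < INR (ct x) + 1) ->
  exists X, incl X (seq 0 k) /\
    Fam' (post k U a (fun w => eqv (lt_pred k) tick_bound w u) X C).
Proof.
  intros Hinv Nu Hu. destruct (inv_TW _ _ _ _ _ _ Hinv) as (CT & E & HT).
  set (uT := fun x => u x - INR (ct x)).
  destruct (TW_letter CT act (cnt s pi) uT a HT) as (X & HX & HT').
  { intros x Hx Ha. specialize (Hu x Hx Ha). unfold uT. lra. }
  exists X. split; [exact HX|].
  set (act' := fun x => act x || existsb (Nat.eqb x) X) in *.
  set (CT' := post k U a (tobs act uT) X CT) in *.
  exists (key CT' act'), (move_last (fun x => existsb (Nat.eqb x) X) pi), act',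
    (reset_count X ct), (jreset k u X []).
  split; [|split; [reflexivity|]].
  { apply good_step with (s := s) (ct := ct) (c' := reset_count X (cnt s pi)) (delta := fun _ => 0%nat).
    - apply Hinv.
    - apply key_in.
    - now exists CT', act'.
    - intros _. lia.
    - intros x Hx Ex. unfold reset_count. rewrite Ex. unfold cnt. lia.
    - intros x Hx Ex. unfold reset_count. now rewrite Ex. }
  intros q1 v2 (q & v & d & v1 & tr & Hq & Hr & Ho & Hin & Hlab & Hs & -> & ->).
  pose proof (fun x => inv_lt _ _ _ _ _ _ x Hinv) as Hlt.
  destruct Hinv as (_ & _ & HC).
  destruct (HC q v Hq) as [(Nv & Qq & v' & Nv' & Ht & Hl1 & g & Hg & He) Hrho].
  destruct (erun_nonneg _ _ _ _ _ _ _ Hr Nv) as [Hd Nv1].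
  destruct (erun_transfer_back _ _ _ _ _ _ _ _ Ht Hr) as [Hr' [T1 T2]].
  destruct (erun_nonneg _ _ _ _ _ _ _ Hr' Nv') as [_ Nv1'].
  set (v1' := patch k (shift v' d) v1) in *.
  assert (Hobs : tobs act uT v1') by (apply tobs_of_region with tick_bound v1; auto).
  split; [split; [now apply clock_valuation_jreset|split; [now apply HQ|]]|].
  - exists (jreset k v1' X (rst tr)). split; [now apply clock_valuation_jreset|].
    split; [split|split].
    + intros i Hi. unfold jreset. rewrite (T1 i Hi). reflexivity.
    + intros x Hx Ha. unfold jreset, reset_count. apply Nat.ltb_lt in Hx as Hb. rewrite Hb.
      destruct (existsb (Nat.eqb x) X) eqn:Ex; [simpl; ring|].
      unfold act' in Ha. rewrite Ex, orb_false_r in Ha. now apply T2.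
    + intros x Hx Ha. unfold jreset. apply Nat.ltb_lt in Hx as Hb. rewrite Hb.
      destruct (existsb (Nat.eqb x) X) eqn:Ex; [lra|].
      unfold act' in Ha. rewrite Ex, orb_false_r in Ha. specialize (Hu x Hx Ha).
      destruct Ho as [Ho _].
      destruct (Ho x (S (ct x)) Hx (Hlt x Hx)) as [_ [A _]]. rewrite S_INR in A.
      rewrite (T2 x Hx Ha). apply Rnot_le_lt. intros K.
      assert (INR (ct x) + 1 <= v1 x) as K' by lra. apply A in K'. lra.
    + apply node_of_rep; [now apply HQ|now apply clock_valuation_jreset|].
      rewrite E in Hg.
      apply (post_rep k U n M a (tobs act uT) X CT q v' HU (proj1 HT)
        (tobs_invariant act uT) Nv' (rep_of_node _ _ _ _ _ Hg He) d tr v1'); auto.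
      unfold v1'. now rewrite av_patch.
  - apply eqv_trans with (jreset k v1 X []).
    + apply eqv_agree. intros i Hi. unfold jreset. apply Nat.ltb_lt in Hi. now rewrite Hi.
    + now apply eqv_jreset.
Qed.

(** Decreases at each tick, which either raises the count of an active clock, still below
    [tick_bound], or switches the clock off. It limits the ticks between two letters. *)
Definition measure (act : nat -> bool) (ct : nat -> nat) : nat :=
  sum_upto (fun x => if act x then tick_bound - ct x else 0)%nat k.

(** Here the delay is prescribed: it ends when [xs] reaches [c + 1]. Afterwards clock [y] reads
    [v y - v xs + c + 1], so comparing it with [z] is a difference constraint with constant
    [z - 1 - c]. *)
Lemma shift_to_tick b c vs v xs : eqv (lt_pred k) b v vs -> (xs < k)%nat -> (S c <= b)%nat ->
  eqv (lt_pred k) b (shift v (1 - (v xs - INR c))) (shift vs (1 - (vs xs - INR c))).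
Proof.
  intros He Hxs Hc. split.
  - intros y z Hy Hz. unfold shift.
    destruct (eqv_diff_Z _ _ _ _ y xs (Z.of_nat z - 1 - Z.of_nat c) He Hy Hxs) as [A B]; [lia|].
    rewrite !minus_IZR, <- !INR_IZR_INZ in A, B. split; split; intros K; lra.
  - intros i j z Hi Hj Hz. unfold shift. destruct He as [_ H2].
    destruct (H2 i j z Hi Hj Hz) as [A B]. split; split; intros K; lra.
Qed.

(** [xs] is an active clock that reaches its next integer first. Since the region fixes this order,
    all members of [C] can be advanced to their own moment of that tick. *)
Lemma inv_tick s pi act ct rho C vs xs : inv s pi act ct rho C ->
  eqv (lt_pred k) tick_bound vs rho -> (xs < k)%nat -> act xs = true ->
  (forall x, (x < k)%nat -> act x = true -> vs x - INR (ct x) <= vs xs - INR (ct xs)) ->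
  exists s' pi' act' ct' rho',
    inv s' pi' act' ct' rho'
      (fun q1 v1 => exists q v, C q v /\ erun k U q v (1 - (v xs - INR (ct xs))) q1 v1) /\
    (measure act' ct' < measure act ct)%nat.
Proof.
  intros Hinv Hvs Hxs Haxs Hmax.
  destruct (inv_TW _ _ _ _ _ _ Hinv) as (CT & E & HT).
  pose proof (fun x => inv_lt _ _ _ _ _ _ x Hinv) as Hlt.
  set (c := cnt s pi) in *.
  set (rho' := shift vs (1 - (vs xs - INR (ct xs)))).
  set (uT := fun x => rho' x - INR (ct x)).
  assert (Hleg : forall x, (x < k)%nat -> act x = true -> uT x <= 1).
  { intros x Hx Ha. specialize (Hmax x Hx Ha). unfold uT, rho', shift. lra. }
  pose proof (TW_tick CT act c uT HT Hleg) as HT'.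
  set (CT' := tick k U (tobs act uT) (kept act uT c) CT) in *.
  set (act' := tick_act act uT c) in *.
  (* A clock whose consulted counter is exhausted is switched off; for the counter argument this is
     a reset, so it becomes least significant with count 0. *)
  set (drop := fun x => due act uT x && negb (c x <? m)%nat).
  set (delta := fun x => if due act uT x && (c x <? m)%nat then 1%nat else 0%nat).
  set (ct' := fun x => if drop x then 0%nat else (ct x + delta x)%nat).
  assert (Hact' : forall x, act' x = true -> act x = true /\ drop x = false).
  { intros x Ha. unfold act', tick_act in Ha. apply andb_prop in Ha as [Ha Hc]. split; [exact Ha|].
    unfold drop, due. rewrite Ha. simpl. destruct (reqb (uT x) 1); [|reflexivity].
    simpl in *. now rewrite Hc. }
  exists (key CT' act'), (move_last drop pi), act', ct', rho'. split.
  2:{ unfold measure. apply sum_upto_lt with xs; [|exact Hxs|].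
      - intros x Hx. destruct (act' x) eqn:Ha'; [|lia].
        destruct (Hact' x Ha') as [-> Hd]. unfold ct'. rewrite Hd. lia.
      - rewrite Haxs. specialize (Hlt xs Hxs). destruct (act' xs) eqn:Ha'; [|lia].
        destruct (Hact' xs Ha') as [_ Hd]. unfold ct'. rewrite Hd.
        assert (Hdue : due act uT xs = true).
        { unfold due. rewrite Haxs. simpl. apply reqb_true. unfold uT, rho', shift. lra. }
        unfold delta. unfold drop in Hd. rewrite Hdue in Hd |- *.
        rewrite andb_true_l in Hd |- *. apply negb_false_iff in Hd. rewrite Hd. lia. }
  split; [|split; [reflexivity|]].
  { apply good_step with (s := s) (ct := ct) (c' := tick_count act uT c) (delta := delta).
    - apply Hinv.
    - apply key_in.
    - now exists CT', act'.
    - intros x. unfold delta. destruct (_ && _); lia.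
    - intros x Hx Hd. unfold ct'. rewrite Hd. unfold tick_count, delta. fold (cnt s pi). fold c.
      unfold drop in Hd. destruct (due act uT x), (c x <? m)%nat; simpl in *; try discriminate; lia.
    - intros x Hx Hd. unfold ct'. now rewrite Hd. }
  destruct Hinv as (_ & _ & HC).
  intros q1 v1 (q & v & Hq & Hr).
  destruct (HC q v Hq) as [(Nv & Qq & v' & Nv' & Ht & Hl1 & g & Hg & He) Hrho].
  destruct (erun_nonneg _ _ _ _ _ _ _ Hr Nv) as [Hd Nv1].
  pose proof (erun_observed _ _ _ _ _ _ _ Hr) as Hobs1.
  destruct (erun_transfer_back _ _ _ _ _ _ _ _ Ht Hr) as [Hr' [T1 T2]].
  destruct (erun_nonneg _ _ _ _ _ _ _ Hr' Nv') as [_ Nv1'].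
  set (v1' := patch k (shift v' (1 - (v xs - INR (ct xs)))) v1) in *.
  assert (Hreg : eqv (lt_pred k) tick_bound v1 rho').
  { apply eqv_trans with (shift v (1 - (v xs - INR (ct xs)))).
    - apply eqv_agree. exact Hobs1.
    - apply shift_to_tick; auto. eapply eqv_trans; [exact Hrho|now apply eqv_sym]. }
  assert (Hobs : tobs act uT v1') by (apply tobs_of_region with tick_bound v1; auto).
  assert (Qq1 : Q q1) by (eapply erun_loc; eassumption).
  split; [split; [exact Nv1|split; [exact Qq1|]]|exact Hreg].
  exists (jreset k v1' (kept act uT c) []). split; [now apply clock_valuation_jreset|].
  split; [split|split].
  - intros i Hi. unfold jreset. destruct (Nat.ltb_spec i k); [lia|]. simpl. now apply T1.
  - intros x Hx Ha. destruct (Hact' x Ha) as [Hax Hdx]. specialize (T2 x Hx Hax).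
    unfold jreset, ct'. apply Nat.ltb_lt in Hx as Hb. rewrite Hb, Hdx.
    rewrite existsb_kept by exact Hx. unfold delta.
    destruct (due act uT x && (c x <? m)%nat) eqn:Hk.
    + apply andb_prop in Hk as [Hdue _]. pose proof (tobs_due _ _ _ _ Hobs Hx Hdue).
      rewrite plus_INR. simpl INR. lra.
    + rewrite Nat.add_0_r. exact T2.
  - intros x Hx Ha. destruct (Hact' x Ha) as [Hax Hdx].
    unfold jreset. apply Nat.ltb_lt in Hx as Hb. rewrite Hb.
    rewrite existsb_kept by exact Hx. unfold drop in Hdx.
    destruct (due act uT x) eqn:Hdue; simpl in *.
    + apply negb_false_iff in Hdx. rewrite Hdx. lra.
    + destruct Hobs as [Hobs _].
      destruct (Hobs x 1%nat (conj Hx Hax) (le_n 1)) as [[A A'] [B B']]. simpl INR in *.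
      specialize (Hleg x Hx Hax).
      assert (uT x <> 1).
      { intros K. unfold due in Hdue. rewrite Hax in Hdue. simpl in Hdue.
        apply reqb_true in K. congruence. }
      apply Rnot_le_lt. intros K. apply B in K. lra.
  - apply node_of_rep; [exact Qq1|now apply clock_valuation_jreset|].
    rewrite E in Hg.
    apply (tick_rep k U n M (tobs act uT) (kept act uT c) CT q v' HU (proj1 HT)
        (tobs_invariant act uT) Nv' (rep_of_node _ _ _ _ _ Hg He) _ q1 v1' Hr' Hobs).
Qed.

Lemma active_argmax (act : nat -> bool) (f : nat -> R) :
  (exists x, (x < k)%nat /\ act x = true) ->
  exists xs, (xs < k)%nat /\ act xs = true /\
    forall x, (x < k)%nat -> act x = true -> f x <= f xs.
Proof.
  intros (x0 & Hx0 & Ha0).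
  destruct (list_max_real (map f (filter act (seq 0 k)))) as [Hnil|(r & Hr & Hmax)].
  - apply map_eq_nil in Hnil. assert (In x0 (filter act (seq 0 k))) as K.
    { apply filter_In. split; [apply in_seq; lia|exact Ha0]. }
    rewrite Hnil in K. destruct K.
  - apply in_map_iff in Hr as (xs & <- & Hxs). apply filter_In in Hxs as [Hxs Ha].
    apply in_seq in Hxs. exists xs. split; [lia|]. split; [exact Ha|].
    intros x Hx Hax. apply Hmax, in_map, filter_In. split; [apply in_seq; lia|exact Hax].
Qed.

(** If the observed region [u] shows an active clock past its next integer, a tick happened before
    the letter: it is played first, runs are cut there, and the measure drops. Otherwise the letter
    itself is played. *)
Lemma inv_move b : forall s pi act ct rho C a u, (measure act ct <= b)%nat -> clock_valuation u ->
  inv s pi act ct rho C -> exists X, incl X (seq 0 k) /\ exists C', Fam' C' /\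
    forall q v, post k U a (fun w => eqv (lt_pred k) tick_bound w u) X C q v -> C' q v.
Proof.
  induction b as [b IH] using lt_wf_ind. intros s pi act ct rho C a u Hb Nu Hinv.
  destruct (classic (exists x, (x < k)%nat /\ act x = true /\ INR (ct x) + 1 <= u x))
    as [(x0 & Hx0 & Ha0 & Hge)|Hno].
  2:{ destruct (inv_letter s pi act ct rho C a u Hinv Nu) as (X & HX & HF).
      - intros x Hx Ha. apply Rnot_le_lt. intros K. apply Hno. now exists x.
      - exists X. split; [exact HX|]. eexists. split; [exact HF|auto]. }
  destruct (classic (exists q v d q1 v1, C q v /\ erun k U q v d q1 v1 /\
                       eqv (lt_pred k) tick_bound v1 u)) as [(qs & vs & _ & _ & _ & Hqs & _)|Hno].
  2:{ exists []. split; [intros x []|]. exists C. split; [now exists s, pi, act, ct, rho|].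
      intros q v (q0 & v0 & d & v1 & tr & Hq & Hr & Ho & _). destruct Hno.
      now exists q0, v0, d, (src tr), v1. }
  assert (Hvs : eqv (lt_pred k) tick_bound vs rho) by now apply (proj2 (proj2 Hinv) qs).
  destruct (active_argmax act (fun x => vs x - INR (ct x))) as (xs & Hxs & Haxs & Hmax);
    [now exists x0|].
  pose proof (fun x => inv_lt _ _ _ _ _ _ x Hinv) as Hlt.
  destruct (inv_tick s pi act ct rho C vs xs Hinv Hvs Hxs Haxs Hmax)
    as (s' & pi' & act' & ct' & rho' & Hinv' & Hmeas).
  destruct (IH (measure act' ct') ltac:(lia) _ _ _ _ _ _ a u (le_n _) Nu Hinv')
    as (X & HX & C' & HC' & Hpost).
  exists X. split; [exact HX|]. exists C'. split; [exact HC'|].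
  intros q2 v2 (q & v & d & v1 & tr & Hq & Hr & Ho & Hin & Hlab & Hs & E1 & E2).
  apply Hpost.
  destruct (proj2 (proj2 Hinv) q v Hq) as [(Nv & _ & v' & _ & [_ T2] & Hl1 & _) Hrho].
  assert (Hd : 0 <= 1 - (v xs - INR (ct xs)) <= d).
  { split.
    - specialize (Hl1 xs Hxs Haxs). rewrite (T2 xs Hxs Haxs) in Hl1. lra.
    - assert (Hv0 : INR (ct x0) + 1 <= v1 x0).
      { destruct Ho as [Ho _]. destruct (Ho x0 (S (ct x0)) Hx0 (Hlt x0 Hx0)) as [_ [_ A]].
        rewrite S_INR in A. now apply A. }
      rewrite (erun_observed _ _ _ _ _ _ _ Hr x0 Hx0) in Hv0.
      (* The clock [x0] has passed its tick by the time of the letter, and [xs] ticks no later than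
         [x0]. The latter holds at [vs] and passes to [v] as a difference constraint. *)
      assert (Hle : v x0 - v xs <= IZR (Z.of_nat (ct x0) - Z.of_nat (ct xs))).
      { pose proof (Hlt x0 Hx0). pose proof (Hlt xs Hxs).
        apply (eqv_diff_Z (lt_pred k) tick_bound v vs x0 xs); auto; [|lia|].
        - eapply eqv_trans; [exact Hrho|now apply eqv_sym].
        - rewrite minus_IZR, <- !INR_IZR_INZ. specialize (Hmax x0 Hx0 Ha0). lra. }
      rewrite minus_IZR, <- !INR_IZR_INZ in Hle. lra. }
  destruct (erun_split _ _ _ _ _ _ _ Hr _ Hd) as (q3 & v3 & R1 & R2).
  exists q3, v3, (d - (1 - (v xs - INR (ct xs)))), v1, tr.
  split; [now exists q, v|]. split; [exact R2|]. split; [exact Ho|]. auto.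
Qed.

Lemma Fam'_init C0 : Fam C0 -> (forall q v, C0 q v -> v = (fun _ => 0) /\ Q q) -> Fam' C0.
Proof.
  intros HF H0. set (act := fun _ : nat => true). set (c := fun _ : nat => 0%nat).
  assert (N0 : clock_valuation (fun _ => 0)) by (intros i; lra).
  assert (HT : TW C0 act c).
  { split; [now apply HFam|]. split; [intros x; apply Nat.le_0_l|].
    exists C0, (fun _ => 0). split; [exact HF|]. intros q v' Hq.
    destruct (H0 q v' Hq) as [-> _]. exists (fun _ => 0). split; [exact N0|].
    split; [split; [reflexivity|intros; simpl; ring]|]. split; [discriminate|].
    split; [apply eqv_refl|]. exists q, (fun _ => 0), 0. split; [exact Hq|constructor]. }
  exists (key C0 act), (seq 0 k), act, c, (fun _ => 0). split; [|split; [reflexivity|]].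
  - apply good_init; [apply key_in|]. now exists C0, act.
  - intros q v Hq. destruct (H0 q v Hq) as [-> Qq]. split; [|apply eqv_refl].
    split; [exact N0|]. split; [exact Qq|]. exists (fun _ => 0). split; [exact N0|].
    split; [split; [reflexivity|intros; simpl; ring]|]. split; [intros; lra|].
    apply node_of_rep; auto. exists (fun _ => 0). split; [exact Hq|apply eqv_refl].
Qed.

End Source.

Theorem Gwin_bounded m C0 : (forall q v, C0 q v -> v = (fun _ => 0) /\ Q q) ->
  Gwin k U FA FB m C0 -> Gwin k U FA FB tick_bound C0.
Proof.
  intros H0 (Fam & HF0 & HFam). exists (Fam' m Fam). split; [now apply Fam'_init|].
  intros C HC. split; [|split].
  - destruct HC as (s & pi & act & ct & rho & _ & _ & HC). intros q v Hq. now apply (HC q).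
  - destruct HC as (s & pi & act & ct & rho & Hinv). now apply (inv_safe m Fam HFam s pi act ct rho).
  - destruct HC as (s & pi & act & ct & rho & Hinv). intros a u Hu.
    now apply (inv_move m Fam HFam (measure act ct) s pi act ct rho).
Qed.

End Ticks.

(** * From separators to the game *)

(* The disjoint union of [A] and [B]: location [p] becomes [2p] in [A] and [2p+1] in [B]. *)
Definition loc (b : bool) (p : nat) : nat := (2 * p + Nat.b2n b)%nat.
Definition ren (b : bool) (tr : transition) : transition :=
  Trans (loc b (src tr)) (lab tr) (grd tr) (rst tr) (loc b (tgt tr)).
Definition union_trans (A B : TA) : list transition :=
  map (ren false) (trans A) ++ map (ren true) (trans B).
Definition union_final (A : TA) (b : bool) (q : nat) : Prop :=
  exists p, In p (final A) /\ q = loc b p.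
Definition side (A B : TA) (b : bool) : TA := if b then B else A.
Definition union_init (A B : TA) : conf := fun q v =>
  v = (fun _ => 0) /\ exists b p, In p (init (side A B b)) /\ q = loc b p.

Lemma loc_inj b p b' p' : loc b p = loc b' p' -> b = b' /\ p = p'.
Proof. unfold loc. destruct b, b'; simpl Nat.b2n; intros H; split; try reflexivity; lia. Qed.

Lemma in_union_trans A B tr : In tr (union_trans A B) <->
  exists b tr0, In tr0 (trans (side A B b)) /\ tr = ren b tr0.
Proof.
  unfold union_trans. rewrite in_app_iff, !in_map_iff. split.
  - intros [(tr0 & <- & H)|(tr0 & <- & H)]; [exists false, tr0|exists true, tr0]; auto.
  - intros ([|] & tr0 & H & ->); [right|left]; exists tr0; auto.
Qed.

Lemma av_shift k v d : av k (shift v d) = shift (av k v) d.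
Proof. reflexivity. Qed.

Lemma av_jreset k v X r : av k (jreset k v X r) = reset (av k v) r.
Proof.
  apply functional_extensionality. intros i. unfold av, jreset, reset.
  destruct (Nat.ltb_spec (k + i) k); [lia|]. replace (k + i - k)%nat with i by lia. reflexivity.
Qed.

(** Unlike [runs], this records the final valuation and time and treats delays as steps, so that
    runs can be extended at their end in parallel with [erun]. *)
Inductive prun (A : TA) : nat -> valuation -> R -> tword -> nat -> valuation -> R -> Prop :=
| pr_nil q v t : prun A q v t [] q v t
| pr_delay q v t t1 w q' v' t' : t <= t1 -> prun A q (shift v (t1 - t)) t1 w q' v' t' ->
    prun A q v t w q' v' t'
| pr_eps tr v t w q' v' t' : In tr (trans A) -> lab tr = None -> sat v (grd tr) ->
    prun A (tgt tr) (reset v (rst tr)) t w q' v' t' -> prun A (src tr) v t w q' v' t'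
| pr_letter tr a v t w q' v' t' : In tr (trans A) -> lab tr = Some a -> sat v (grd tr) ->
    prun A (tgt tr) (reset v (rst tr)) t w q' v' t' ->
    prun A (src tr) v t ((a, t) :: w) q' v' t'.

Lemma prun_trans A q v t w q1 v1 t1 w' q2 v2 t2 : prun A q v t w q1 v1 t1 ->
  prun A q1 v1 t1 w' q2 v2 t2 -> prun A q v t (w ++ w') q2 v2 t2.
Proof.
  induction 1; intros K; simpl.
  - exact K.
  - eapply pr_delay; eauto.
  - apply pr_eps; auto.
  - eapply pr_letter; eauto.
Qed.

Lemma runs_delay A q v t t1 w qf : t <= t1 ->
  runs A q (shift v (t1 - t)) t1 w qf -> runs A q v t w qf.
Proof.
  intros Ht Hr. inversion Hr; subst.
  - constructor.
  - rewrite shift_shift in *. replace (t1 - t + (t' - t1)) with (t' - t) in * by ring.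
    apply run_eps with tr t'; auto; lra.
  - rewrite shift_shift in *. replace (t1 - t + (t' - t1)) with (t' - t) in * by ring.
    apply run_letter with tr; auto; lra.
Qed.

Lemma runs_of_prun A q v t w q' v' t' : prun A q v t w q' v' t' -> runs A q v t w q'.
Proof.
  induction 1.
  - constructor.
  - eapply runs_delay; eauto.
  - apply run_eps with tr t; auto; [lra| |]; rewrite Rminus_diag, shift_0; auto.
  - apply run_letter with tr; auto; [lra| |]; rewrite Rminus_diag, shift_0; auto.
Qed.

(* Runs without epsilon-transitions, ending at the time of the last letter. *)
Inductive srun (S : TA) : nat -> valuation -> R -> tword -> nat -> valuation -> R -> Prop :=
| sr_nil q v t : srun S q v t [] q v t
| sr_cons tr a v t t1 w q' v' t' : In tr (trans S) -> lab tr = Some a -> t <= t1 ->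
    sat (shift v (t1 - t)) (grd tr) ->
    srun S (tgt tr) (reset (shift v (t1 - t)) (rst tr)) t1 w q' v' t' ->
    srun S (src tr) v t ((a, t1) :: w) q' v' t'.

Lemma runs_of_srun S q v t w q' v' t' : srun S q v t w q' v' t' -> runs S q v t w q'.
Proof. induction 1; [constructor|eapply run_letter; eauto]. Qed.

Lemma srun_of_runs S : (forall tr, In tr (trans S) -> lab tr <> None) ->
  forall q v t w qf, runs S q v t w qf -> exists v' t', srun S q v t w qf v' t'.
Proof.
  intros Hne. induction 1 as [q v t|q v t tr t' w qf Hin Hs Hl|q v t tr a t' w qf Hin Hs Hl Ht Hg Hr IH].
  - exists v, t. constructor.
  - now destruct (Hne tr Hin).
  - destruct IH as (v' & t'' & IH). exists v', t''. subst q. eapply sr_cons; eauto.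
Qed.

Lemma srun_snoc S q v t w q1 v1 t1 : srun S q v t w q1 v1 t1 ->
  forall tr a t2, In tr (trans S) -> src tr = q1 -> lab tr = Some a -> t1 <= t2 ->
  sat (shift v1 (t2 - t1)) (grd tr) ->
  srun S q v t (w ++ [(a, t2)]) (tgt tr) (reset (shift v1 (t2 - t1)) (rst tr)) t2.
Proof.
  induction 1; intros tr' a' t2 Hin Hs Hl Ht Hg.
  - subst q. simpl. eapply sr_cons; eauto. constructor.
  - simpl. eapply sr_cons; eauto.
Qed.

Lemma srun_snoc_inv S w a t2 : forall q v t q' v' t', srun S q v t (w ++ [(a, t2)]) q' v' t' ->
  exists v1 t1 tr, srun S q v t w (src tr) v1 t1 /\ In tr (trans S) /\ lab tr = Some a /\
    sat (shift v1 (t2 - t1)) (grd tr).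
Proof.
  induction w as [|[b s] w IH]; intros q v t q' v' t' Hr; simpl in Hr; inversion Hr; subst.
  - exists v, t, tr. repeat split; auto. constructor.
  - match goal with K : srun _ _ _ _ (w ++ _) _ _ _ |- _ =>
      destruct (IH _ _ _ _ _ _ K) as (v1 & t1 & tr' & K1 & K2 & K3 & K4) end.
    exists v1, t1, tr'. repeat split; auto. eapply sr_cons; eauto.
Qed.

Lemma srun_nonneg S q v t w q' v' t' : srun S q v t w q' v' t' -> clock_valuation v ->
  t <= t' /\ clock_valuation v'.
Proof.
  induction 1 as [q v t|tr a v t t1 w q' v' t' Hin Hl Ht Hg Hr IH]; intros Hv; [split; [lra|auto]|].
  destruct IH as [H1 H2].
  - intros i. unfold reset. destruct (existsb (Nat.eqb i) (rst tr)); [lra|].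
    apply clock_valuation_shift; [exact Hv|lra].
  - split; [lra|exact H2].
Qed.

Lemma reset_ext v r r' : (forall x, In x r <-> In x r') -> reset v r = reset v r'.
Proof.
  intros H. apply functional_extensionality. intros i. unfold reset.
  replace (existsb (Nat.eqb i) r') with (existsb (Nat.eqb i) r); [reflexivity|].
  apply eq_iff_eq_true. rewrite !existsb_exists.
  split; intros (y & Hy & E); exists y; split; auto; now apply H.
Qed.

(** Determinism speaks of nonnegative valuations, so nonnegativity is carried along the run. *)
Lemma srun_unique S : deterministic S -> forall q v t w q1 v1 t1, srun S q v t w q1 v1 t1 ->
  clock_valuation v -> forall q2 v2 t2, srun S q v t w q2 v2 t2 -> q1 = q2 /\ v1 = v2 /\ t1 = t2.
Proof.
  intros (_ & _ & Hdet) q v t w q1 v1 t1.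
  induction 1 as [q v t|tr a v t t1 w q' v' t' Hin Hl Ht Hg Hr IH]; intros Hv q2 v2 t2 K.
  - inversion K; subst; auto.
  - inversion K as [|tr2 a2 v0 s0 s1 w0 q0 v0' t0' Hin2 Hl2 Ht2 Hg2 Hr2 E1]; subst.
    assert (Hv1 : clock_valuation (shift v (t1 - t))) by (apply clock_valuation_shift; [exact Hv|lra]).
    destruct (Hdet tr tr2 Hin Hin2 (eq_sym E1)) as [Et Er].
    + congruence.
    + now exists (shift v (t1 - t)).
    + apply IH.
      * intros i. unfold reset. destruct (existsb (Nat.eqb i) (rst tr)); [lra|apply Hv1].
      * rewrite Et, (reset_ext _ _ _ Er). exact Hr2.
Qed.

Lemma sat_agree n g v v' : guard_clocks_lt n g -> (forall x, (x < n)%nat -> v x = v' x) ->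
  (sat v g <-> sat v' g).
Proof.
  intros Hn He. induction g; simpl in *; try tauto.
  - now rewrite He.
  - destruct Hn. now rewrite !He.
Qed.

Section SeparatorToGame.
Variables (k m : nat) (A B S : TA).
Hypothesis HwfS : wf_TA S.
Hypothesis Hdet : deterministic S.
Hypothesis Hclk : (nclk S <= k)%nat.
Hypothesis Hmax : max_const_le S m.
Hypothesis Hsep : separates S A B.
Variable s0 : nat.
Hypothesis Hs0 : forall q, In q (init S) <-> q = s0.

(** [None] means that the separator is stuck on [w]. Otherwise [ts] is the time at which its run
    ends, and its clocks have grown by [t - ts] since. *)
Definition at_loc (o : option nat) (w : tword) (t : R) (v : valuation) : Prop :=
  match o with
  | Some s => exists sv ts, srun S s0 (fun _ => 0) 0 w s sv ts /\ ts <= t /\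
                forall x, (x < nclk S)%nat -> v x = sv x + (t - ts)
  | None => ~ exists s sv ts, srun S s0 (fun _ => 0) 0 w s sv ts
  end.

(** Different members may stem from different words, which only need to bring the separator to the
    same place; this is indistinguishability for the separator at hand. *)
Definition joint (o : option nat) : conf := fun q v => clock_valuation v /\
  exists b p w t p0, q = loc b p /\ In p0 (init (side A B b)) /\
    prun (side A B b) p0 (fun _ => 0) 0 w p (av k v) t /\ at_loc o w t v.

Lemma joint_erun o q v d q' v' : erun k (union_trans A B) q v d q' v' ->
  joint o q v -> joint o q' v'.
Proof.
  induction 1 as [q v|q v d e q' v' Hd Hr IH|tr v e q' v' Hin Hlab Hs Hr IH]; intros HJ;
    [exact HJ| |]; apply IH; destruct HJ as (Nv & b & p & w & t & p0 & E & Hp0 & Hp & Hat).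
  - split; [now apply clock_valuation_shift|]. exists b, p, w, (t + d), p0.
    repeat split; auto.
    + rewrite <- (app_nil_r w). eapply prun_trans; [exact Hp|].
      apply pr_delay with (t + d); [lra|]. rewrite av_shift.
      replace (t + d - t) with d by ring. constructor.
    + destruct o as [s|]; [|exact Hat]. destruct Hat as (sv & ts & H1 & H2 & H3).
      exists sv, ts. repeat split; auto; [lra|]. intros x Hx. unfold shift. rewrite H3 by exact Hx. ring.
  - apply in_union_trans in Hin as (b' & tr0 & Hin & ->). simpl in *.
    apply loc_inj in E as [<- <-].
    split; [now apply clock_valuation_jreset|]. exists b', (tgt tr0), w, t, p0.
    repeat split; auto.
    + rewrite <- (app_nil_r w). eapply prun_trans; [exact Hp|].
      apply pr_eps; auto. rewrite av_jreset. constructor.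
    + destruct o as [s|]; [|exact Hat]. destruct Hat as (sv & ts & H1 & H2 & H3).
      exists sv, ts. repeat split; auto. intros x Hx. unfold jreset.
      destruct (Nat.ltb_spec x k); [|lia]. simpl. now apply H3.
Qed.

(** Acceptance by the separator depends on the location alone. A word of [A] that leads to [o] makes
    that location final, so a word of [B] that leads there would be accepted as well; being stuck
    contradicts the inclusion of [L(A)]. *)
Lemma joint_safe o C : (forall q v, C q v -> joint o q v) ->
  safe k (union_trans A B) (union_final A false) (union_final B true) C.
Proof.
  intros HC [(q & v & d & q1 & v1 & Hq & Hr & pA & HfA & EA)
             (q' & v' & d' & q1' & v1' & Hq' & Hr' & pB & HfB & EB)].
  pose proof (joint_erun o _ _ _ _ _ Hr (HC _ _ Hq)) as (_ & b & p & w & t & p0 & E & Hp0 & Hp & Hat).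
  pose proof (joint_erun o _ _ _ _ _ Hr' (HC _ _ Hq')) as (_ & b' & p' & w' & t' & p0' & E' & Hp0' & Hp' & Hat').
  rewrite EA in E. rewrite EB in E'. apply loc_inj in E as [<- <-], E' as [<- <-]. simpl in *.
  assert (HA : accepts A w) by (exists p0, pA; repeat split; auto; eapply runs_of_prun; eauto).
  assert (HB : accepts B w') by (exists p0', pB; repeat split; auto; eapply runs_of_prun; eauto).
  destruct Hsep as [H1 H2]. apply (H2 w'). split; [|exact HB].
  destruct (H1 w HA) as (s1 & sf & Hs1 & Hsf & Hrun). apply Hs0 in Hs1. subst s1.
  destruct (srun_of_runs S (proj1 Hdet) _ _ _ _ _ Hrun) as (sv & ts & Hsr).
  destruct o as [s|].
  - destruct Hat as (sv1 & ts1 & Hsr1 & _). destruct Hat' as (sv2 & ts2 & Hsr2 & _).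
    destruct (srun_unique S Hdet _ _ _ _ _ _ _ Hsr) with (2 := Hsr1) as [-> _]; [intros i; lra|].
    exists s0, s. repeat split; auto; [now apply Hs0|]. eapply runs_of_srun; eauto.
  - destruct Hat. eauto.
Qed.

(** Guards of the separator are constant on the region of [u], as their constants are at most [m].
    So a single transition, or the fact of being stuck, applies to all members at once. *)
Lemma joint_move o C a u : (forall q v, C q v -> joint o q v) -> clock_valuation u ->
  exists X, incl X (seq 0 k) /\ exists o', forall q v,
    post k (union_trans A B) a (fun w => eqv (lt_pred k) m w u) X C q v -> joint o' q v.
Proof.
  intros HC Nu.
  assert (Hpr : forall w p0 b p v1 t tr0 X, In p0 (init (side A B b)) ->
     prun (side A B b) p0 (fun _ => 0) 0 w p (av k v1) t -> In tr0 (trans (side A B b)) ->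
     src tr0 = p -> lab tr0 = Some a -> sat (av k v1) (grd tr0) ->
     prun (side A B b) p0 (fun _ => 0) 0 (w ++ [(a, t)]) (tgt tr0)
       (av k (jreset k v1 X (rst tr0))) t).
  { intros w p0 b p v1 t tr0 X Hp0 Hp Hin <- Hl Hs. eapply prun_trans; [exact Hp|].
    eapply pr_letter; eauto. rewrite av_jreset. constructor. }
  destruct (classic (exists s tr, o = Some s /\ In tr (trans S) /\ src tr = s /\
                       lab tr = Some a /\ sat u (grd tr))) as [(s & str & -> & Hin & Hsrc & Hlab & Hsat)|Hno].
  - destruct (HwfS str Hin) as (_ & Hgc & Hrst).
    exists (rst str). split.
    { intros x Hx. apply in_seq. specialize (Hrst x Hx). lia. }
    exists (Some (tgt str)).
    intros q2 v2 (q & v & d & v1 & tr & Hq & Hr & Ho & Hin' & Hlab' & Hs & -> & ->).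
    destruct (joint_erun _ _ _ _ _ _ Hr (HC _ _ Hq)) as (Nv1 & b & p & w & t & p0 & E & Hp0 & Hp & Hat).
    apply in_union_trans in Hin' as (b' & tr0 & Hin' & ->). simpl in *.
    apply loc_inj in E as [<- <-].
    split; [now apply clock_valuation_jreset|].
    exists b', (tgt tr0), (w ++ [(a, t)]), t, p0. repeat split; auto.
    + eapply Hpr; eauto.
    + destruct Hat as (sv & ts & H1 & H2 & H3).
      destruct (srun_nonneg _ _ _ _ _ _ _ _ H1 ltac:(intros i; lra)) as [_ Nsv].
      exists (reset (shift sv (t - ts)) (rst str)), t. split; [|split; [lra|]].
      * apply (srun_snoc _ _ _ _ _ _ _ _ H1); auto.
        apply (sat_agree (nclk S) (grd str) v1); auto.
        apply (sat_eqv (nclk S) m (grd str) v1 u); auto.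
        apply eqv_weaken with (lt_pred k) m; auto. unfold lt_pred. intros; lia.
      * intros x Hx. unfold jreset, reset, shift. destruct (Nat.ltb_spec x k); [|lia].
        destruct (existsb (Nat.eqb x) (rst str)); [ring|]. rewrite H3 by exact Hx. ring.
  - exists []. split; [intros x []|]. exists None.
    intros q2 v2 (q & v & d & v1 & tr & Hq & Hr & Ho & Hin' & Hlab' & Hs & -> & ->).
    destruct (joint_erun _ _ _ _ _ _ Hr (HC _ _ Hq)) as (Nv1 & b & p & w & t & p0 & E & Hp0 & Hp & Hat).
    apply in_union_trans in Hin' as (b' & tr0 & Hin' & ->). simpl in *.
    apply loc_inj in E as [<- <-].
    split; [now apply clock_valuation_jreset|].
    exists b', (tgt tr0), (w ++ [(a, t)]), t, p0. repeat split; auto.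
    + eapply Hpr; eauto.
    + simpl. intros (s' & sv' & ts' & Hsr).
      destruct (srun_snoc_inv _ _ _ _ _ _ _ _ _ _ Hsr) as (w1 & t1 & str & Hsr1 & Hin & Hlab & Hsat).
      destruct o as [s|]; [|apply Hat; eauto].
      destruct Hat as (sv & ts & H1 & H2 & H3).
      destruct (srun_nonneg _ _ _ _ _ _ _ _ H1 ltac:(intros i; lra)) as [_ Nsv].
      destruct (srun_unique S Hdet _ _ _ _ _ _ _ H1 ltac:(intros i; lra) _ _ _ Hsr1) as (E1 & -> & ->).
      apply Hno. exists s, str. repeat split; auto.
      apply (sat_eqv (nclk S) m (grd str) v1 u); auto.
      * now apply HwfS.
      * apply eqv_weaken with (lt_pred k) m; auto. unfold lt_pred. intros; lia.
      * apply (sat_agree (nclk S) (grd str) (shift w1 (t - t1))); auto; [now apply HwfS|].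
        intros x Hx. unfold shift. now rewrite H3.
Qed.

Lemma Gwin_of_separator :
  Gwin k (union_trans A B) (union_final A false) (union_final B true) m (union_init A B).
Proof.
  exists (fun C => exists o, forall q v, C q v -> joint o q v). split.
  - exists (Some s0). intros q v (-> & b & p & Hp & ->). split; [intros i; lra|].
    exists b, p, [], 0, p. repeat split; auto.
    + apply pr_nil.
    + exists (fun _ => 0), 0. repeat split; [constructor|lra|intros; ring].
  - intros C [o HC]. split; [intros q v Hq; now apply (HC q v)|].
    split; [now apply joint_safe with o|]. intros a u Nu.
    destruct (joint_move o C a u HC Nu) as (X & HX & o' & H). exists X. split; [exact HX|].
    exists (joint o'). split; [now exists o'|exact H].
Qed.

End SeparatorToGame.

Theorem Gwin_of_km_det_separable k m A B : km_det_separable k m A B ->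
  Gwin k (union_trans A B) (union_final A false) (union_final B true) m (union_init A B).
Proof.
  intros (S & Hwf & _ & Hdet & Hclk & Hmax & Hsep).
  destruct (proj1 (proj2 Hdet)) as [s0 Hs0]. now apply Gwin_of_separator with S s0.
Qed.

(** * Guards as numbers *)

Open Scope nat_scope.

Definition evenb (n : nat) : bool := nat_rect (fun _ => bool) true (fun _ b => negb b) n.

Lemma cmp_evenb {E} `{Enc E} (f : E -> nat) : computable f -> computable (fun e => evenb (f e)).
Proof. intros Hf. apply (cmp_nat_rect f (fun _ => true) (fun _ _ b => negb b)); cmp. Qed.

Lemma evenb_double p : evenb (2 * p) = true.
Proof.
  induction p as [|p IH]; [reflexivity|]. replace (2 * S p) with (S (S (2 * p))) by lia.
  change (negb (negb (evenb (2 * p))) = true). now rewrite IH.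
Qed.

Lemma evenb_double_S p : evenb (S (2 * p)) = false.
Proof. change (negb (evenb (2 * p)) = false). now rewrite evenb_double. Qed.

(* [a/D - b/D] is compared with the integer coded by [z] by comparing [lside D a z] with
   [rside D b z]; all terms are doubled because [enc_Z] doubles the absolute value. *)
Definition lside (D a z : nat) : nat := 2 * a + (if evenb z then 0 else (z - 1) * D).
Definition rside (D b z : nat) : nat := 2 * b + (if evenb z then z * D else 0).

Definition cmpb (c l r : nat) : bool :=
  if c =? 0 then l <? r else if c =? 1 then l <=? r else if c =? 2 then l =? r
  else if c =? 3 then r <=? l else r <? l.

Lemma side_diff D a b z : 0 < D ->
  (INR a / INR D - INR b / INR D - IZR z =
   (INR (lside D a (enc_Z z)) - INR (rside D b (enc_Z z))) / (2 * INR D))%R.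
Proof.
  intros HD. assert (0 < INR D)%R by now apply lt_0_INR. unfold lside, rside.
  destruct z as [|p|p]; unfold enc_Z.
  - simpl evenb. cbv iota. rewrite !plus_INR, !mult_INR. simpl INR. field. lra.
  - rewrite evenb_double, !plus_INR, !mult_INR.
    replace (IZR (Z.pos p)) with (INR (Pos.to_nat p)) by (rewrite INR_IZR_INZ, positive_nat_Z; reflexivity).
    simpl INR. field. lra.
  - rewrite evenb_double_S. replace (S (2 * Pos.to_nat p) - 1) with (2 * Pos.to_nat p) by lia.
    rewrite !plus_INR, !mult_INR.
    replace (IZR (Z.neg p)) with (- INR (Pos.to_nat p))%R
      by (rewrite INR_IZR_INZ, positive_nat_Z; reflexivity).
    simpl INR. field. lra.
Qed.

Lemma cmpb_spec D a b c z : 0 < D ->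
  cmpb (enc_cmp c) (lside D a (enc_Z z)) (rside D b (enc_Z z)) = true <->
  cmp_sem c (INR a / INR D - INR b / INR D)%R (IZR z).
Proof.
  intros HD. pose proof (side_diff D a b z HD) as E.
  set (l := lside D a (enc_Z z)) in *. set (r := rside D b (enc_Z z)) in *.
  set (x := (INR a / INR D - INR b / INR D)%R) in *.
  assert (HD' : (0 < 2 * INR D)%R) by (pose proof (lt_0_INR D HD); lra).
  assert (E' : ((x - IZR z) * (2 * INR D) = INR l - INR r)%R) by (rewrite E; field; lra).
  assert (Hlt : l < r <-> (x < IZR z)%R).
  { split; intros K; [apply lt_INR in K|apply INR_lt]; nra. }
  assert (Hgt : r < l <-> (x > IZR z)%R).
  { split; intros K; [apply lt_INR in K|apply INR_lt]; nra. }
  destruct c; unfold cmpb; simpl.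
  - rewrite Nat.ltb_lt. exact Hlt.
  - rewrite Nat.leb_le. split; intros K.
    + apply Rnot_lt_le. intros K'. apply Hgt in K'. lia.
    + apply Nat.nlt_ge. intros K'. apply Hgt in K'. lra.
  - rewrite Nat.eqb_eq. split; intros K.
    + apply Rle_antisym; apply Rnot_lt_le; intros K'; [apply Hgt in K'|apply Hlt in K']; lia.
    + destruct (Nat.lt_trichotomy l r) as [K'|[K'|K']]; [|exact K'|];
        [apply Hlt in K'|apply Hgt in K']; lra.
  - rewrite Nat.leb_le. split; intros K.
    + apply Rle_ge, Rnot_lt_le. intros K'. apply Hlt in K'. lia.
    + apply Nat.nlt_ge. intros K'. apply Hlt in K'. lra.
  - rewrite Nat.ltb_lt. exact Hgt.
Qed.

Definition b2n (b : bool) : nat := if b then 1 else 0.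

(** Evaluates a guard directly on its code. The entry at index 0 is the constructor tag, and the
    values of subguards, whose codes are smaller, are read from the history. *)
Definition gsat_step (e : nat * list nat) (n : nat) (h : list nat) : nat :=
  b2n (let l := tolist n in
  if nth 0 l 0 =? 0 then true
  else if nth 0 l 0 =? 1 then
    cmpb (nth 2 l 0) (lside (fst e) (nth (nth 1 l 0) (snd e) 0) (nth 3 l 0))
                     (rside (fst e) 0 (nth 3 l 0))
  else if nth 0 l 0 =? 2 then
    cmpb (nth 3 l 0) (lside (fst e) (nth (nth 1 l 0) (snd e) 0) (nth 4 l 0))
                     (rside (fst e) (nth (nth 2 l 0) (snd e) 0) (nth 4 l 0))
  else if nth 0 l 0 =? 3 then prior h n (nth 1 l 0) =? 0
  else if nth 0 l 0 =? 4 then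
    negb (prior h n (nth 1 l 0) =? 0) && negb (prior h n (nth 2 l 0) =? 0)
  else negb (prior h n (nth 1 l 0) =? 0) || negb (prior h n (nth 2 l 0) =? 0)).

Definition gsatb (D : nat) (g : list nat) (n : nat) : bool :=
  negb (cov (gsat_step (D, g)) n =? 0).

Lemma pair_nat_ge x y : x + y <= pair_nat x y.
Proof. pose proof (to_nat_non_decreasing x y). unfold pair_nat. lia. Qed.

(** Components have smaller codes: this justifies the recursion on guard codes, and later bounds
    locations, clocks and constants by the code of the instance. *)
Lemma in_enc_list x l : In x l -> x < enc_list l.
Proof.
  induction l as [|y l IH]; intros [].
  - subst y. simpl. pose proof (pair_nat_ge x (enc_list l)). lia.
  - specialize (IH H). simpl. pose proof (pair_nat_ge y (enc_list l)). lia.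
Qed.

Lemma b2n_eq0 b : (b2n b =? 0) = negb b.
Proof. now destruct b. Qed.

Lemma gsatb_spec D g : 0 < D -> forall gd,
  gsatb D g (enc_guard gd) = true <-> sat (gval D g) gd.
Proof.
  intros HD.
  assert (Hprior : forall l x, In x l ->
     (prior (hist (gsat_step (D, g)) (enc_list l)) (enc_list l) x =? 0) = negb (gsatb D g x)).
  { intros l x Hx. unfold gsatb. rewrite prior_hist by now apply in_enc_list.
    now rewrite negb_involutive. }
  induction gd as [|x c z|x y c z|gd IH|g1 IH1 g2 IH2|g1 IH1 g2 IH2];
    unfold gsatb, cov; unfold gsat_step at 1; rewrite b2n_eq0, negb_involutive;
    change (fst (D, g)) with D; change (snd (D, g)) with g; cbv zeta;
    unfold enc_guard; fold enc_guard; rewrite tolist_enc_list.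
  - simpl. tauto.
  - simpl nth. cbn [Nat.eqb]. rewrite cmpb_spec by exact HD. simpl sat.
    unfold gval. replace (INR 0 / INR D)%R with 0%R by (simpl; unfold Rdiv; ring).
    rewrite Rminus_0_r. tauto.
  - simpl nth. cbn [Nat.eqb]. rewrite cmpb_spec by exact HD. simpl sat. unfold gval. tauto.
  - simpl nth. cbn [Nat.eqb]. rewrite (Hprior [3; enc_guard gd] (enc_guard gd)) by (simpl; auto).
    simpl sat. rewrite negb_true_iff, <- IH. destruct (gsatb D g (enc_guard gd)); intuition congruence.
  - simpl nth. cbn [Nat.eqb].
    rewrite (Hprior [4; enc_guard g1; enc_guard g2] (enc_guard g1)),
      (Hprior [4; enc_guard g1; enc_guard g2] (enc_guard g2)) by (simpl; auto).
    rewrite !negb_involutive. simpl sat. rewrite <- IH1, <- IH2. apply andb_true_iff.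
  - simpl nth. cbn [Nat.eqb].
    rewrite (Hprior [5; enc_guard g1; enc_guard g2] (enc_guard g1)),
      (Hprior [5; enc_guard g1; enc_guard g2] (enc_guard g2)) by (simpl; auto).
    rewrite !negb_involutive. simpl sat. rewrite <- IH1, <- IH2. apply orb_true_iff.
Qed.

(* The tests against [1] are there because [enc_Z] misses that value. *)
Definition gok_step (nc : nat) (n : nat) (h : list nat) : nat :=
  b2n (let l := tolist n in
  if nth 0 l 0 =? 0 then length l =? 1
  else if nth 0 l 0 =? 1 then
    (length l =? 4) && (nth 1 l 0 <? nc) && (nth 2 l 0 <=? 4) && negb (nth 3 l 0 =? 1)
  else if nth 0 l 0 =? 2 then
    (length l =? 5) && (nth 1 l 0 <? nc) && (nth 2 l 0 <? nc) && (nth 3 l 0 <=? 4) &&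
    negb (nth 4 l 0 =? 1)
  else if nth 0 l 0 =? 3 then (length l =? 2) && negb (prior h n (nth 1 l 0) =? 0)
  else (nth 0 l 0 <=? 5) && (length l =? 3) && negb (prior h n (nth 1 l 0) =? 0) &&
       negb (prior h n (nth 2 l 0) =? 0)).

Definition gokb (nc n : nat) : bool := negb (cov (gok_step nc) n =? 0).

Lemma enc_cmp_surj c : c <= 4 -> exists c', enc_cmp c' = c.
Proof.
  intros Hc. destruct c as [|[|[|[|[|c]]]]]; [exists CLt|exists CLe|exists CEq|exists CGe|exists CGt|lia];
    reflexivity.
Qed.

Lemma enc_Z_surj z : z <> 1 -> exists z', enc_Z z' = z.
Proof.
  intros Hz. destruct (Nat.Even_or_Odd z) as [[p ->]|[p ->]].
  - destruct p as [|p]; [now exists 0%Z|]. exists (Z.pos (Pos.of_nat (S p))).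
    unfold enc_Z. rewrite Nat2Pos.id by lia. reflexivity.
  - destruct p as [|p]; [simpl in Hz; lia|]. exists (Z.neg (Pos.of_nat (S p))).
    unfold enc_Z. rewrite Nat2Pos.id by lia. lia.
Qed.

Lemma enc_Z_neq1 z : enc_Z z <> 1.
Proof. destruct z as [|p|p]; simpl; try lia; pose proof (Pos2Nat.is_pos p); lia. Qed.

Lemma enc_list_tolist n : enc_list (tolist n) = n.
Proof. rewrite enc_list_enc. apply enc_tolist. Qed.

Lemma gokb_enc nc gd : guard_clocks_lt nc gd -> gokb nc (enc_guard gd) = true.
Proof.
  assert (Hprior : forall l x, In x l ->
     (prior (hist (gok_step nc) (enc_list l)) (enc_list l) x =? 0) = negb (gokb nc x)).
  { intros l x Hx. unfold gokb. rewrite prior_hist by now apply in_enc_list.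
    now rewrite negb_involutive. }
  induction gd as [|x c z|x y c z|gd IH|g1 IH1 g2 IH2|g1 IH1 g2 IH2]; intros Hc;
    unfold gokb, cov; unfold gok_step at 1; rewrite b2n_eq0, negb_involutive; cbv zeta;
    unfold enc_guard; fold enc_guard; rewrite tolist_enc_list; simpl in Hc.
  - reflexivity.
  - simpl nth. simpl length. cbn [Nat.eqb]. simpl.
    pose proof (enc_Z_neq1 z) as Hz. apply Nat.eqb_neq in Hz. rewrite Hz.
    apply Nat.ltb_lt in Hc. rewrite Hc. now destruct c.
  - simpl nth. simpl length. cbn [Nat.eqb]. destruct Hc as [Hx Hy].
    pose proof (enc_Z_neq1 z) as Hz. apply Nat.eqb_neq in Hz. rewrite Hz.
    apply Nat.ltb_lt in Hx, Hy. rewrite Hx, Hy. now destruct c.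
  - simpl nth. simpl length. cbn [Nat.eqb].
    rewrite (Hprior [3; enc_guard gd] (enc_guard gd)) by (simpl; auto). now rewrite IH.
  - simpl nth. simpl length. cbn [Nat.eqb].
    rewrite (Hprior [4; enc_guard g1; enc_guard g2] (enc_guard g1)),
      (Hprior [4; enc_guard g1; enc_guard g2] (enc_guard g2)) by (simpl; auto).
    destruct Hc. now rewrite IH1, IH2.
  - simpl nth. simpl length. cbn [Nat.eqb].
    rewrite (Hprior [5; enc_guard g1; enc_guard g2] (enc_guard g1)),
      (Hprior [5; enc_guard g1; enc_guard g2] (enc_guard g2)) by (simpl; auto).
    destruct Hc. now rewrite IH1, IH2.
Qed.

Lemma gokb_dec nc n : gokb nc n = true -> exists gd, n = enc_guard gd /\ guard_clocks_lt nc gd.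
Proof.
  induction n as [n IH] using lt_wf_ind. unfold gokb, cov. unfold gok_step at 1.
  rewrite b2n_eq0, negb_involutive. cbv zeta.
  assert (Hprior : forall x, In x (tolist n) -> 
     negb (prior (hist (gok_step nc) n) n x =? 0) = true ->
     exists gd, x = enc_guard gd /\ guard_clocks_lt nc gd).
  { intros x Hx Hp. assert (x < n) by (rewrite <- (enc_list_tolist n); now apply in_enc_list).
    apply IH; [assumption|]. unfold gokb. now rewrite prior_hist in Hp. }
  (* The list and the history become variables, so the case analysis on the list does not unfold the
     recursion. *)
  pose proof (enc_list_tolist n) as En. revert Hprior En. generalize (hist (gok_step nc) n) as h. generalize (tolist n) as l.
  intros l h Hprior En Hl.
  destruct (nth 0 l 0) as [|[|[|[|t]]]] eqn:Et; cbn [Nat.eqb] in Hl.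
  - apply Nat.eqb_eq in Hl. destruct l as [|a [|b l]]; try discriminate.
    simpl in Et. subst a. exists GTrue; rewrite <- En; now split.
  - rewrite !andb_true_iff in Hl. destruct Hl as (((Hlen & Hx) & Hcm) & Hz).
    apply Nat.eqb_eq in Hlen. destruct l as [|a [|x [|c [|z [|b l]]]]]; try discriminate.
    simpl in *. subst a. apply Nat.ltb_lt in Hx. apply Nat.leb_le in Hcm.
    apply negb_true_iff, Nat.eqb_neq in Hz.
    destruct (enc_cmp_surj c Hcm) as [c' <-]. destruct (enc_Z_surj z Hz) as [z' <-].
    exists (GAtom x c' z'); rewrite <- En; now split.
  - rewrite !andb_true_iff in Hl. destruct Hl as ((((Hlen & Hx) & Hy) & Hcm) & Hz).
    apply Nat.eqb_eq in Hlen. destruct l as [|a [|x [|y [|c [|z [|b l]]]]]]; try discriminate.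
    simpl in *. subst a. apply Nat.ltb_lt in Hx, Hy. apply Nat.leb_le in Hcm.
    apply negb_true_iff, Nat.eqb_neq in Hz.
    destruct (enc_cmp_surj c Hcm) as [c' <-]. destruct (enc_Z_surj z Hz) as [z' <-].
    exists (GDiff x y c' z'); rewrite <- En; now split.
  - rewrite !andb_true_iff in Hl. destruct Hl as (Hlen & Hg).
    apply Nat.eqb_eq in Hlen. destruct l as [|a [|x [|b l]]]; try discriminate.
    simpl in *. subst a. destruct (Hprior x) as (gd & -> & Hgd); auto. exists (GNot gd); rewrite <- En; now split.
  - rewrite !andb_true_iff in Hl. destruct Hl as (((Ht & Hlen) & H1) & H2).
    apply Nat.eqb_eq in Hlen. apply Nat.leb_le in Ht.
    destruct l as [|a [|x [|y [|b l]]]]; try discriminate. simpl in *. subst a.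
    destruct (Hprior x) as (gd1 & -> & Hgd1); auto.
    destruct (Hprior y) as (gd2 & -> & Hgd2); auto.
    destruct t as [|[|t]]; [exists (GAnd gd1 gd2); rewrite <- En; now split|exists (GOr gd1 gd2); rewrite <- En; now split|lia].
Qed.

Lemma cmp_b2n {E} `{Enc E} (f : E -> bool) : computable f -> computable (fun e => b2n (f e)).
Proof. intros Hf. unfold b2n. cmp. Qed.

Lemma cmp_cmpb {E} `{Enc E} (c l r : E -> nat) : computable c -> computable l -> computable r ->
  computable (fun e => cmpb (c e) (l e) (r e)).
Proof. intros. unfold cmpb. cmp. Qed.

Lemma cmp_lside {E} `{Enc E} (D a z : E -> nat) : computable D -> computable a -> computable z ->
  computable (fun e => lside (D e) (a e) (z e)).
Proof. intros. unfold lside. cmp; now apply cmp_evenb. Qed.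

Lemma cmp_rside {E} `{Enc E} (D a z : E -> nat) : computable D -> computable a -> computable z ->
  computable (fun e => rside (D e) (a e) (z e)).
Proof. intros. unfold rside. cmp; now apply cmp_evenb. Qed.

Lemma cmp_prior {E} `{Enc E} (h : E -> list nat) (n j : E -> nat) :
  computable h -> computable n -> computable j -> computable (fun e => prior (h e) (n e) (j e)).
Proof. intros. unfold prior. cmp. Qed.

Ltac cmp_user ::=
  first [ simple apply cmp_b2n | simple apply cmp_cmpb | simple apply cmp_lside
        | simple apply cmp_rside | simple apply cmp_prior | cmp_lists ].

Lemma cmp_gsatb {E} `{Enc E} (D : E -> nat) (g : E -> list nat) (n : E -> nat) :
  computable D -> computable g -> computable n ->
  computable (fun e => gsatb (D e) (g e) (n e)).
Proof.
  intros HD Hg Hn. unfold gsatb.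
  assert (Hc : computable (fun e => cov (gsat_step (D e, g e)) (n e))); [|cmp].
  apply (cmp_cov (fun e => gsat_step (D e, g e))); [|exact Hn].
  unfold gsat_step. cbv zeta. cmp.
Qed.

Lemma cmp_gokb {E} `{Enc E} (nc n : E -> nat) : computable nc -> computable n ->
  computable (fun e => gokb (nc e) (n e)).
Proof.
  intros Hnc Hn. unfold gokb.
  assert (Hc : computable (fun e => cov (gok_step (nc e)) (n e))); [|cmp].
  apply (cmp_cov (fun e => gok_step (nc e))); [|exact Hn].
  unfold gok_step. cbv zeta. cmp.
Qed.

(** * The decision procedure *)

(** Comparing codes gives a computable membership test for every encoded type; it is faithful when
    the encoding is injective. *)
Definition memb {X} `{Enc X} (x : X) (l : list X) : bool :=
  existsb (fun y => enc x =? enc y) l.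

Lemma memb_In {X} `{Enc X} (HX : enc_injective X) (x : X) l : memb x l = true <-> In x l.
Proof.
  unfold memb. rewrite existsb_exists. split.
  - intros (y & Hy & E). apply Nat.eqb_eq, HX in E. now subst.
  - intros Hx. exists x. split; [exact Hx|apply Nat.eqb_refl].
Qed.

Lemma node_inj : enc_injective node.
Proof. apply enc_prod_inj; [exact enc_nat_inj|apply enc_list_inj, enc_nat_inj]. Qed.

Lemma position_inj : enc_injective (list node).
Proof. apply enc_list_inj, node_inj. Qed.

Definition eqvb (D N M : nat) (g h : list nat) : bool :=
  forallb (fun i => forallb (fun z =>
    Bool.eqb (nth i g 0 <=? z * D) (nth i h 0 <=? z * D) &&
    Bool.eqb (z * D <=? nth i g 0) (z * D <=? nth i h 0) &&
    forallb (fun j =>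
      Bool.eqb (nth i g 0 <=? nth j g 0 + z * D) (nth i h 0 <=? nth j h 0 + z * D) &&
      Bool.eqb (nth j g 0 + z * D <=? nth i g 0) (nth j h 0 + z * D <=? nth i h 0))
    (seq 0 N)) (seq 0 (S M))) (seq 0 N).

Lemma eqb_leb_iff a b c d : Bool.eqb (a <=? b) (c <=? d) = true <-> (a <= b <-> c <= d).
Proof.
  rewrite Bool.eqb_true_iff.
  destruct (Nat.leb_spec a b), (Nat.leb_spec c d); split; intros K; try reflexivity; try discriminate; lia.
Qed.

Lemma forallb_seq (f : nat -> bool) n :
  forallb f (seq 0 n) = true <-> forall i, i < n -> f i = true.
Proof.
  rewrite forallb_forall. split; intros K i Hi; apply K; [apply in_seq; lia|].
  apply in_seq in Hi. lia.
Qed.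

Lemma eqvb_spec D N M g h : 0 < D ->
  eqvb D N M g h = true <-> eqv (lt_pred N) M (gval D g) (gval D h).
Proof.
  intros HD. unfold gval.
  rewrite <- (geqv_eqv N M D (fun i => nth i g 0) (fun i => nth i h 0) HD).
  unfold eqvb, geqv. rewrite forallb_seq. split.
  - intros K. split.
    + intros i z Hi Hz. specialize (K i Hi). rewrite forallb_seq in K.
      specialize (K z ltac:(lia)). rewrite !andb_true_iff, !eqb_leb_iff in K. tauto.
    + intros i j z Hi Hj Hz. specialize (K i Hi). rewrite forallb_seq in K.
      specialize (K z ltac:(lia)). rewrite !andb_true_iff in K. destruct K as [_ K].
      rewrite forallb_seq in K. specialize (K j Hj). rewrite andb_true_iff, !eqb_leb_iff in K. exact K.
  - intros [K1 K2] i Hi. rewrite forallb_seq. intros z Hz.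
    rewrite !andb_true_iff, !eqb_leb_iff. split; [apply K1; lia|].
    rewrite forallb_seq. intros j Hj. rewrite andb_true_iff, !eqb_leb_iff. apply K2; lia.
Qed.

Definition jresetb (k N : nat) (X r g : list nat) : list nat :=
  map (fun i => if (if i <? k then memb i X else memb (i - k) r) then 0 else nth i g 0) (seq 0 N).

Lemma memb_existsb x (l : list nat) : memb x l = existsb (Nat.eqb x) l.
Proof. reflexivity. Qed.

Lemma jresetb_spec D k N X r g i : i < N ->
  gval D (jresetb k N X r g) i = jreset k (gval D g) X r i.
Proof.
  intros Hi. unfold gval, jresetb, jreset. rewrite nth_map_seq by exact Hi. rewrite !memb_existsb.
  destruct (if i <? k then _ else _); [|reflexivity]. simpl. unfold Rdiv. ring.
Qed.

(* [h] lists the clock values after the delay, followed by the delay itself. *)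
Definition delayb (D N M B : nat) (g g' : list nat) : bool :=
  existsb (fun h => forallb (fun i => nth N h 0 <=? nth i h 0) (seq 0 N) &&
    eqvb D N M (map (fun i => nth i h 0 - nth N h 0) (seq 0 N)) g && eqvb D N M h g')
  (vectors (S N) B).

Lemma delayb_sound D N M B g g' : 0 < D -> delayb D N M B g g' = true ->
  exists v d, clock_valuation v /\ (0 <= d)%R /\ eqv (lt_pred N) M v (gval D g) /\
    eqv (lt_pred N) M (shift v d) (gval D g').
Proof.
  intros HD K. apply existsb_exists in K as (h & Hh & K).
  rewrite !andb_true_iff, !eqvb_spec, forallb_seq in K by exact HD.
  destruct K as [[K1 K2] K3]. assert (0 < INR D)%R by now apply lt_0_INR.
  exists (gval D (map (fun i => nth i h 0 - nth N h 0) (seq 0 N))), (gval D h N).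
  split; [now apply gval_nonneg|]. split; [now apply gval_nonneg|]. split; [exact K2|].
  eapply eqv_trans; [|exact K3]. apply eqv_agree. intros i Hi. unfold shift, gval.
  rewrite nth_map_seq by exact Hi. specialize (K1 i Hi). apply Nat.leb_le in K1.
  rewrite minus_INR by exact K1. field. lra.
Qed.

(** The delay is treated as one more clock: since [v i = x i - x N], both regions are described by
    comparisons among [N + 1] values, which a grid point preserves. This is the origin of [S N] in
    the bounds. *)
Lemma delayb_complete D N M B g g' v d :
  S N < D -> S N * ((M + 2) * D) <= B -> clock_valuation v -> (0 <= d)%R ->
  eqv (lt_pred N) M v (gval D g) -> eqv (lt_pred N) M (shift v d) (gval D g') ->
  delayb D N M B g g' = true.
Proof.
  intros HD HB Hv Hd E1 E2.
  set (x := fun i => if i <? N then shift v d i else d).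
  assert (Hx : clock_valuation x).
  { intros i. unfold x. destruct (i <? N); [now apply clock_valuation_shift|exact Hd]. }
  assert (xN : x N = d) by (unfold x; now rewrite Nat.ltb_irrefl).
  assert (xi : forall i, i < N -> x i = (v i + d)%R).
  { intros i Hi. unfold x. apply Nat.ltb_lt in Hi. now rewrite Hi. }
  destruct (grid_rep (S N) M D B x HD HB Hx) as (h & Hl & Hb & He).
  assert (0 < INR D)%R by (apply lt_0_INR; lia).
  assert (Hle : forall i, i < N -> nth N h 0 <= nth i h 0).
  { intros i Hi. destruct He as [_ He].
    destruct (He i N 0 ltac:(unfold lt_pred; lia) ltac:(unfold lt_pred; lia) ltac:(lia)) as [_ [_ A]].
    unfold gval in A. rewrite div_ge_iff in A by lia. rewrite Nat.mul_0_l, Nat.add_0_r in A.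
    apply A. rewrite xN, xi by exact Hi. specialize (Hv i). simpl. lra. }
  apply existsb_exists. exists h. split; [now apply in_vectors|].
  rewrite !andb_true_iff, !eqvb_spec, forallb_seq by lia.
  assert (EhN : eqv (lt_pred N) M (gval D h) x).
  { apply eqv_weaken with (lt_pred (S N)) M; auto. unfold lt_pred. intros; lia. }
  split; [split|].
  - intros i Hi. apply Nat.leb_le. now apply Hle.
  - eapply eqv_trans; [|exact E1].
    assert (Hval : forall i, i < N -> gval D (map (fun i => nth i h 0 - nth N h 0) (seq 0 N)) i =
                      (gval D h i - gval D h N)%R).
    { intros i Hi. unfold gval. rewrite nth_map_seq by exact Hi.
      rewrite minus_INR by now apply Hle. field. lra. }
    destruct He as [He1 He2]. split.
    + intros i z Hi Hz. rewrite (Hval i Hi).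
      destruct (He2 i N z ltac:(unfold lt_pred in *; lia) ltac:(unfold lt_pred; lia) Hz) as [A B'].
      rewrite xN, xi in A, B' by exact Hi. split; split; intros K; lra.
    + intros i j z Hi Hj Hz. rewrite (Hval i Hi), (Hval j Hj).
      destruct (He2 i j z ltac:(unfold lt_pred in *; lia) ltac:(unfold lt_pred in *; lia) Hz) as [A B'].
      rewrite !xi in A, B' by assumption. split; split; intros K; lra.
  - eapply eqv_trans; [exact EhN|]. eapply eqv_trans; [|exact E2]. apply eqv_agree.
    intros i Hi. now apply xi.
Qed.

Definition rawtr := (nat * (nat * (nat * (list nat * nat))))%type.
Definition rsrc (r : rawtr) : nat := fst r.
Definition rlab (r : rawtr) : nat := fst (snd r).
Definition rgrd (r : rawtr) : nat := fst (snd (snd r)).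
Definition rrst (r : rawtr) : list nat := fst (snd (snd (snd r))).
Definition rtgt (r : rawtr) : nat := snd (snd (snd (snd r))).
Definition raw_of (tr : transition) : rawtr :=
  (src tr, (enc_option (lab tr), (enc_guard (grd tr), (rst tr, tgt tr)))).

(* Grid parameters: scale, number of joint clocks, constant of the automata, grid bound,
   constant of the separator. *)
Definition params := (nat * (nat * (nat * (nat * nat))))%type.
Definition pD (P : params) : nat := fst P.
Definition pN (P : params) : nat := fst (snd P).
Definition pM (P : params) : nat := fst (snd (snd P)).
Definition pB (P : params) : nat := fst (snd (snd (snd P))).
Definition pm (P : params) : nat := snd (snd (snd (snd P))).

Section Algorithm.
Variable k : nat.
Variable P : params.
Variable raws : list rawtr.
Variable nodes : list node.

Definition stepb (nd nd' : node) : bool :=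
  ((fst nd =? fst nd') && delayb (pD P) (pN P) (pM P) (pB P) (snd nd) (snd nd')) ||
  existsb (fun r => (rlab r =? 0) && (rsrc r =? fst nd) && (rtgt r =? fst nd') &&
    gsatb (pD P) (skipn k (snd nd)) (rgrd r) &&
    eqvb (pD P) (pN P) (pM P) (jresetb k (pN P) [] (rrst r) (snd nd)) (snd nd')) raws.

Definition step_closedb (S : list node) : bool :=
  forallb (fun nd => forallb (fun nd' => negb (stepb nd nd') || memb nd' S) nodes) S.

(** The least closed superset of [p], defined as an intersection over all closed subsets, so that no
    iteration has to be shown to stabilise. *)
Definition reachb (p : list node) (nd : node) : bool :=
  forallb (fun S => negb (forallb (fun x => memb x S) p && step_closedb S) || memb nd S)
    (powerset nodes).

Definition reach (p : list node) : list node := filter (reachb p) nodes.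

Definition letterb (a : nat) (u X : list nat) (nd nd' : node) : bool :=
  existsb (fun r => (rlab r =? S a) && (rsrc r =? fst nd) && (rtgt r =? fst nd') &&
    gsatb (pD P) (skipn k (snd nd)) (rgrd r) && eqvb (pD P) k (pm P) (snd nd) u &&
    eqvb (pD P) (pN P) (pM P) (jresetb k (pN P) X (rrst r) (snd nd)) (snd nd')) raws.

Definition next (p : list node) (a : nat) (u X : list nat) : list node :=
  filter (fun nd' => existsb (fun nd => letterb a u X nd nd') (reach p)) nodes.

Definition hasb (fin : list nat) (p : list node) : bool :=
  existsb (fun nd => memb (fst nd) fin) (reach p).

Definition closedb (alph : nat) (fa fb : list nat) (W : list (list node)) : bool :=
  forallb (fun p => negb (hasb fa p && hasb fb p) &&
    forallb (fun a => forallb (fun u => existsb (fun X => memb (next p a u X) W)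
      (powerset (seq 0 k))) (vectors k (pB P))) (seq 0 alph)) W.

(** The empty list names the zero valuation, as missing entries read as 0. *)
Definition startb (ini : list nat) : list node :=
  filter (fun nd => memb (fst nd) ini && eqvb (pD P) (pN P) (pM P) (snd nd) []) nodes.

(** In a safety game, winning means lying in some closed family of safe positions, so trying all
    families decides it. *)
Definition winb (alph : nat) (ini fa fb : list nat) : bool :=
  existsb (fun W => closedb alph fa fb W && memb (startb ini) W) (powerset (powerset nodes)).

End Algorithm.

Section Correctness.
Variables (k n : nat) (P : params) (U : list transition) (nodes : list node) (Q : nat -> Prop).
Hypothesis HN : pN P = k + n.
Hypothesis HD : S (pN P) < pD P.
Hypothesis HB : S (pN P) * ((pM P + 2) * pD P) <= pB P.
Hypothesis Hm : pm P <= pM P.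
Hypothesis HU : bounded_guards U n (pM P).
Hypothesis Hnodes : forall q g, In (q, g) nodes <-> Q q /\ In g (vectors (pN P) (pB P)).
Hypothesis HQ : forall tr, In tr U -> Q (tgt tr).

Let D := pD P.
Let M := pM P.
Let raws := map raw_of U.
Notation "v ~~ w" := (eqv (lt_pred (k + n)) M v w) (at level 70).
Notation ereach p := (reach k P raws nodes p).

Lemma D_pos : 0 < D. Proof. unfold D. lia. Qed.

Lemma node_cover q v : Q q -> clock_valuation v ->
  exists g, In (q, g) nodes /\ gval D g ~~ v.
Proof.
  intros Hq Hv. destruct (grid_rep (k + n) M D (pB P) v) as (g & Hl & Hb & He); auto.
  - unfold D. lia.
  - unfold M, D. nia.
  - exists g. split; [|exact He]. apply Hnodes. split; [exact Hq|]. apply in_vectors.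
    rewrite HN. auto.
Qed.

Lemma gsatb_av g gd : gsatb D (skipn k g) (enc_guard gd) = true <-> sat (av k (gval D g)) gd.
Proof.
  rewrite gsatb_spec by apply D_pos.
  replace (gval D (skipn k g)) with (av k (gval D g)); [tauto|].
  apply functional_extensionality. intros i. unfold av, gval. now rewrite nth_skipn.
Qed.

Lemma jresetb_eqv X r g : gval D (jresetb k (pN P) X r g) ~~ jreset k (gval D g) X r.
Proof. apply eqv_agree. intros i Hi. apply jresetb_spec. rewrite HN. exact Hi. Qed.

Lemma eqvb_iff g h : eqvb (pD P) (pN P) (pM P) g h = true <-> gval D g ~~ gval D h.
Proof. rewrite eqvb_spec by apply D_pos. now rewrite HN. Qed.

Lemma step_delay q g g' v d : clock_valuation v -> (0 <= d)%R ->
  v ~~ gval D g -> shift v d ~~ gval D g' -> stepb k P raws (q, g) (q, g') = true.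
Proof.
  intros Hv Hd E1 E2. unfold stepb. simpl fst. simpl snd. rewrite Nat.eqb_refl.
  rewrite (delayb_complete (pD P) (pN P) (pM P) (pB P) g g' v d); auto; now rewrite HN.
Qed.

Lemma step_eps tr g g' v : In tr U -> lab tr = None -> clock_valuation v -> v ~~ gval D g ->
  sat (av k v) (grd tr) -> jreset k v [] (rst tr) ~~ gval D g' ->
  stepb k P raws (src tr, g) (tgt tr, g') = true.
Proof.
  intros Hin Hl Hv E1 Hs E2. unfold stepb. apply orb_true_iff. right. apply existsb_exists.
  exists (raw_of tr). split; [now apply in_map|].
  unfold rlab, rsrc, rtgt, rgrd, rrst, raw_of. simpl fst. simpl snd. rewrite Hl, !Nat.eqb_refl.
  assert (Ng : clock_valuation (gval D g)) by apply gval_nonneg, D_pos.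
  assert (Hsg : gsatb (pD P) (skipn k g) (enc_guard (grd tr)) = true).
  { apply gsatb_av. now apply sat_av_eqv with U n M v. }
  rewrite Hsg. simpl. apply eqvb_iff. eapply eqv_trans; [apply jresetb_eqv|].
  eapply eqv_trans; [|exact E2]. apply eqv_jreset; auto. now apply eqv_sym.
Qed.

Lemma closed_complete S q v d q1 v1 : step_closedb k P raws nodes S = true -> incl S nodes ->
  erun k U q v d q1 v1 -> clock_valuation v ->
  forall g, In (q, g) S -> v ~~ gval D g ->
  forall g1, In (q1, g1) nodes -> v1 ~~ gval D g1 -> In (q1, g1) S.
Proof.
  intros HS Hincl. unfold step_closedb in HS. rewrite forallb_forall in HS.
  assert (Hst : forall nd nd', In nd S -> In nd' nodes -> stepb k P raws nd nd' = true -> In nd' S).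
  { intros nd nd' H1 H2 H3. specialize (HS nd H1). rewrite forallb_forall in HS.
    specialize (HS nd' H2). rewrite H3 in HS. now apply (memb_In node_inj). }
  induction 1 as [q v|q v d e q1 v1 Hd Hr IH|tr v e q1 v1 Hin Hlab Hs Hr IH];
    intros Nv g Hg Eg g1 Hg1 E1.
  (* [g] and [g1] may be two names of one region; a step of zero delay connects them. *)
  - apply (Hst (q, g)); auto. apply step_delay with v 0%R; auto; [lra|]. now rewrite shift_0.
  - assert (Qq : Q q) by now apply (Hnodes q g), Hincl.
    assert (Nv' : clock_valuation (shift v d)) by now apply clock_valuation_shift.
    destruct (node_cover q (shift v d) Qq Nv') as (g' & Hg' & E').
    apply IH with g'; auto; [|now apply eqv_sym].
    apply (Hst (q, g)); auto. apply step_delay with v d; auto. now apply eqv_sym.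
  - assert (Nv' : clock_valuation (jreset k v [] (rst tr))) by now apply clock_valuation_jreset.
    destruct (node_cover (tgt tr) _ (HQ tr Hin) Nv') as (g' & Hg' & E').
    apply IH with g'; auto; [|now apply eqv_sym].
    apply (Hst (src tr, g)); auto. apply step_eps with v; auto. now apply eqv_sym.
Qed.

Lemma reach_complete p q v d q1 v1 g g1 : incl p nodes -> erun k U q v d q1 v1 ->
  clock_valuation v -> In (q, g) p -> v ~~ gval D g ->
  In (q1, g1) nodes -> v1 ~~ gval D g1 -> In (q1, g1) (ereach p).
Proof.
  intros Hp Hr Nv Hg Eg Hg1 E1. apply filter_In. split; [exact Hg1|]. unfold reachb.
  apply forallb_forall. intros S HS.
  destruct (forallb (fun x => memb x S) p && step_closedb k P raws nodes S) eqn:EqS; [|reflexivity].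
  apply andb_prop in EqS as [HpS HcS]. rewrite forallb_forall in HpS. simpl.
  apply (memb_In node_inj). apply (closed_complete S q v d q1 v1) with g; auto.
  - now apply powerset_incl.
  - now apply (memb_In node_inj), HpS.
Qed.

Lemma next_complete p a u X q v d v1 tr g g' : incl p nodes -> erun k U q v d (src tr) v1 ->
  clock_valuation v -> In (q, g) p -> v ~~ gval D g ->
  In tr U -> lab tr = Some a -> sat (av k v1) (grd tr) ->
  eqv (lt_pred k) (pm P) v1 (gval D u) ->
  In (tgt tr, g') nodes -> jreset k v1 X (rst tr) ~~ gval D g' ->
  In (tgt tr, g') (next k P raws nodes p a u X).
Proof.
  intros Hp Hr Nv Hg Eg Hin Hlab Hs Hu Hg' E'.
  assert (Nv1 : clock_valuation v1) by now apply (erun_nonneg _ _ _ _ _ _ _ Hr).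
  assert (Qs : Q (src tr)).
  { apply (erun_loc k U Q HQ _ _ _ _ _ Hr). now apply (Hnodes q g), Hp. }
  destruct (node_cover (src tr) v1 Qs Nv1) as (g1 & Hg1 & E1).
  apply filter_In. split; [exact Hg'|]. apply existsb_exists. exists (src tr, g1). split.
  - apply reach_complete with q v d v1 g; auto. now apply eqv_sym.
  - unfold letterb. apply existsb_exists. exists (raw_of tr). split; [now apply in_map|].
    unfold rlab, rsrc, rtgt, rgrd, rrst, raw_of. simpl fst. simpl snd. rewrite Hlab, !Nat.eqb_refl.
    assert (Ng : clock_valuation (gval D g1)) by apply gval_nonneg, D_pos.
    assert (Hsg : gsatb (pD P) (skipn k g1) (enc_guard (grd tr)) = true).
    { apply gsatb_av. apply sat_av_eqv with U n M v1; auto. now apply eqv_sym. }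
    rewrite Hsg. simpl. apply andb_true_iff. split.
    + apply eqvb_spec; [apply D_pos|]. eapply eqv_trans; [|exact Hu].
      apply eqv_weaken with (lt_pred (k + n)) M; auto. unfold lt_pred. intros; lia.
    + apply eqvb_iff. eapply eqv_trans; [apply jresetb_eqv|].
      eapply eqv_trans; [|exact E']. now apply eqv_jreset.
Qed.

Definition eclos (C : conf) : conf := fun q1 v1 => exists q v d, C q v /\ erun k U q v d q1 v1.
Notation codeC C := (code (k + n) M D nodes C).

Lemma erun_delay q v d : (0 <= d)%R -> erun k U q v d q (shift v d).
Proof. intros Hd. rewrite <- (Rplus_0_r d) at 1. apply er_delay; [exact Hd|constructor]. Qed.

Lemma step_sound C nd nd' : nonneg_conf C -> In nd (codeC (eclos C)) -> In nd' nodes ->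
  stepb k P raws nd nd' = true -> In nd' (codeC (eclos C)).
Proof.
  intros NC Hnd Hnd' Hst. apply in_code in Hnd as [Hn (v1 & (q & v & d & HC & Hr) & E1)].
  destruct nd as [q1 g1], nd' as [q2 g2]. simpl fst in *. simpl snd in *.
  apply in_code. split; [exact Hnd'|]. simpl fst. simpl snd.
  assert (Nv1 : clock_valuation v1) by (apply (erun_nonneg _ _ _ _ _ _ _ Hr); now apply (NC q)).
  unfold stepb in Hst. apply orb_true_iff in Hst as [Hst|Hst]; simpl fst in Hst; simpl snd in Hst.
  - apply andb_prop in Hst as [Eq Hst]. apply Nat.eqb_eq in Eq. subst q2.
    apply delayb_sound in Hst as (v2 & e & Nv2 & He & A1 & A2); [|apply D_pos].
    rewrite HN in A1, A2.
    destruct (eqv_delay (k + n) M v2 v1 e) as (e' & He' & A3); auto.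
    { eapply eqv_trans; [exact A1|]. now apply eqv_sym. }
    exists (shift v1 e'). split.
    + exists q, v, (d + e')%R. split; [exact HC|]. eapply erun_trans; [exact Hr|]. now apply erun_delay.
    + eapply eqv_trans; [apply eqv_sym; exact A3|exact A2].
  - apply existsb_exists in Hst as (r & Hr' & Hst). apply in_map_iff in Hr' as (tr & <- & Hin).
    unfold rlab, rsrc, rtgt, rgrd, rrst, raw_of in Hst. simpl fst in Hst. simpl snd in Hst.
    rewrite !andb_true_iff, !Nat.eqb_eq, eqvb_iff in Hst.
    destruct Hst as ((((Hl & <-) & <-) & Hs) & E2). apply gsatb_av in Hs.
    assert (Ng : clock_valuation (gval D g1)) by apply gval_nonneg, D_pos.
    exists (jreset k v1 [] (rst tr)). split.
    + exists q, v, (d + 0)%R. split; [exact HC|]. eapply erun_trans; [exact Hr|].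
      apply er_eps; [exact Hin| | |constructor].
      * destruct (lab tr); [discriminate|reflexivity].
      * apply sat_av_eqv with U n M (gval D g1); auto. now apply eqv_sym.
    + eapply eqv_trans; [|exact E2]. eapply eqv_trans; [|apply eqv_sym, jresetb_eqv].
      now apply eqv_jreset.
Qed.

(** The regions silently reachable from [C] form one of the closed sets over which [reachb]
    quantifies. *)
Lemma reach_sound C nd : nonneg_conf C -> In nd (ereach (codeC C)) -> In nd (codeC (eclos C)).
Proof.
  intros NC Hnd. apply filter_In in Hnd as [Hnd Hr]. unfold reachb in Hr.
  rewrite forallb_forall in Hr. specialize (Hr (codeC (eclos C)) (filter_powerset _ _)).
  assert (Hc : forallb (fun x => memb x (codeC (eclos C))) (codeC C) &&
          step_closedb k P raws nodes (codeC (eclos C)) = true).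
  { apply andb_true_iff. split.
    - apply forallb_forall. intros x Hx. apply (memb_In node_inj).
      apply in_code in Hx as [Hx (v & Hv & E)]. apply in_code. split; [exact Hx|].
      exists v. split; [|exact E]. exists (fst x), v, 0%R. split; [exact Hv|constructor].
    - unfold step_closedb. apply forallb_forall. intros x Hx. apply forallb_forall. intros y Hy.
      destruct (stepb k P raws x y) eqn:Est; [|reflexivity]. simpl. apply (memb_In node_inj).
      now apply step_sound with x. }
  rewrite Hc in Hr. simpl in Hr. now apply (memb_In node_inj).
Qed.

Lemma code_incl C : incl (codeC C) nodes.
Proof. intros x Hx. now apply in_code in Hx. Qed.

(** The abstraction is exact: moves computed on codes agree with moves of the game, so a play can be
    followed on either level. *)
Lemma next_code C a u X : nonneg_conf C -> (forall q v, C q v -> Q q) ->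
  next k P raws nodes (codeC C) a u X =
  codeC (post k U a (fun w => eqv (lt_pred k) (pm P) w (gval D u)) X C).
Proof.
  intros NC QC. unfold next, code at 2. apply filter_ext_in. intros [q2 g2] Hnd. apply eq_iff_eq_true.
  rewrite cdec_true. simpl fst. simpl snd. rewrite existsb_exists. split.
  - intros ([q1 g1] & Hnd1 & Hl). apply reach_sound in Hnd1; [|exact NC].
    apply in_code in Hnd1 as [_ (v1 & (q & v & d & HC & Hr) & E1)]. simpl fst in *. simpl snd in *.
    assert (Nv1 : clock_valuation v1) by (apply (erun_nonneg _ _ _ _ _ _ _ Hr); now apply (NC q)).
    unfold letterb in Hl. apply existsb_exists in Hl as (r & Hr' & Hl).
    apply in_map_iff in Hr' as (tr & <- & Hin).
    unfold rlab, rsrc, rtgt, rgrd, rrst, raw_of in Hl. simpl fst in Hl. simpl snd in Hl.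
    rewrite !andb_true_iff, !Nat.eqb_eq, eqvb_iff, (eqvb_spec (pD P) k (pm P)) in Hl by apply D_pos.
    destruct Hl as (((((Hl & <-) & <-) & Hs) & Hu) & E2). apply gsatb_av in Hs.
    assert (Ng : clock_valuation (gval D g1)) by apply gval_nonneg, D_pos.
    exists (jreset k v1 X (rst tr)). split.
    + exists q, v, d, v1, tr. split; [exact HC|]. split; [exact Hr|]. split.
      * eapply eqv_trans; [|exact Hu].
        apply eqv_weaken with (lt_pred (k + n)) M; auto. unfold lt_pred. intros; lia.
      * split; [exact Hin|]. split.
        { destruct (lab tr); simpl in Hl; [congruence|discriminate]. }
        split; [|auto]. apply sat_av_eqv with U n M (gval D g1); auto. now apply eqv_sym.
    + eapply eqv_trans; [|exact E2]. eapply eqv_trans; [|apply eqv_sym, jresetb_eqv].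
      now apply eqv_jreset.
  - intros (v2 & (q & v & d & v1 & tr & HC & Hr & Ho & Hin & Hlab & Hs & -> & ->) & E2).
    destruct (node_cover q v (QC q v HC) (NC q v HC)) as (g & Hg & Eg).
    assert (Hgc : In (q, g) (codeC C)).
    { apply in_code. split; [exact Hg|]. exists v. split; [exact HC|now apply eqv_sym]. }
    assert (Hin2 : In (tgt tr, g2) (next k P raws nodes (codeC C) a u X)).
    { apply next_complete with q v d v1 g; auto; [apply code_incl|now apply (NC q)|now apply eqv_sym]. }
    apply filter_In in Hin2 as [_ Hin2]. now apply existsb_exists in Hin2.
Qed.

Lemma hasb_code C fin (F : nat -> Prop) : nonneg_conf C -> (forall q, F q <-> In q fin) ->
  hasb k P raws nodes fin (codeC C) = true -> reaches k U C F.
Proof.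
  intros NC HF Hh. apply existsb_exists in Hh as ([q1 g1] & Hnd & Hfin).
  apply reach_sound in Hnd; [|exact NC]. apply in_code in Hnd as [_ (v1 & (q & v & d & HC & Hr) & _)].
  simpl in *. exists q, v, d, q1, v1. repeat split; auto. now apply HF, (memb_In enc_nat_inj).
Qed.

Variables (alphabet : nat) (ini fa fb : list nat) (FA FB : nat -> Prop) (C0 : conf).
Hypothesis HFA : forall q, FA q <-> In q fa.
Hypothesis HFB : forall q, FB q <-> In q fb.
Hypothesis HC0 : forall q v, C0 q v <-> v = (fun _ => 0%R) /\ In q ini.
Hypothesis Hini : forall q, In q ini -> Q q.

Lemma startb_code : startb P nodes ini = codeC C0.
Proof.
  unfold startb, code. apply filter_ext_in. intros [q g] Hnd. apply eq_iff_eq_true.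
  rewrite cdec_true, andb_true_iff, (memb_In enc_nat_inj), eqvb_iff. simpl fst. simpl snd.
  assert (E0 : gval D [] = (fun _ => 0%R)).
  { apply functional_extensionality. intros i. unfold gval. destruct i; simpl; unfold Rdiv; ring. }
  rewrite E0. split.
  - intros [Hq He]. exists (fun _ => 0%R). split; [now apply HC0|now apply eqv_sym].
  - intros (v & Hv & He). apply HC0 in Hv as [-> Hq]. split; [exact Hq|now apply eqv_sym].
Qed.

(** [Fam] may answer with sets larger than the exact successors, even with locations outside [Q].
    The finite family therefore consists of the codes of exact successors contained in members of
    [Fam]. *)
Theorem winb_of_Gwin : Gwin k U FA FB (pm P) C0 ->
  winb k P raws nodes alphabet ini fa fb = true.
Proof.
  intros (Fam & HF0 & HFam).
  set (fam := fun p => exists C C', p = codeC C /\ nonneg_conf C /\ (forall q v, C q v -> Q q) /\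
                 Fam C' /\ forall q v, C q v -> C' q v).
  set (W := filter (fun p => cdec (fam p)) (powerset nodes)).
  assert (HW : forall p, fam p -> In p W).
  { intros p Hp. apply filter_In. split; [|now apply cdec_true].
    destruct Hp as (C & C' & -> & _). apply filter_powerset. }
  apply existsb_exists. exists W. split; [apply filter_powerset|]. apply andb_true_iff. split.
  - unfold closedb. apply forallb_forall. intros p Hp. apply filter_In in Hp as [_ Hp].
    apply cdec_true in Hp as (C & C' & -> & NC & QC & HC' & Hsub).
    destruct (HFam C' HC') as (_ & Hsafe & Hmove). apply andb_true_iff. split.
    + apply negb_true_iff. destruct (hasb _ _ _ _ fa _ && hasb _ _ _ _ fb _) eqn:Eh; [|reflexivity].
      apply andb_prop in Eh as [Ha Hb]. exfalso. apply Hsafe.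
      assert (Hmono : forall F, reaches k U C F -> reaches k U C' F).
      { intros F (q & v & d & q1 & v1 & H1 & H2 & H3). exists q, v, d, q1, v1. auto. }
      split; apply Hmono; [now apply hasb_code with fa|now apply hasb_code with fb].
    + apply forallb_forall. intros a _. apply forallb_forall. intros u _.
      destruct (Hmove a (gval D u)) as (X & HX & C'' & HC'' & Hpost).
      { apply gval_nonneg, D_pos. }
      (* [powerset] lists only sublists of [seq 0 k] in increasing order, so the answer is brought
         into that form. *)
      set (X' := filter (fun x => existsb (Nat.eqb x) X) (seq 0 k)).
      apply existsb_exists. exists X'. split; [apply filter_powerset|].
      apply (memb_In position_inj). rewrite next_code by assumption. apply HW.
      exists (post k U a (fun w => eqv (lt_pred k) (pm P) w (gval D u)) X' C), C''.
      split; [reflexivity|]. split; [now apply post_nonneg|]. split.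
      * intros q v (q0 & v0 & d & v1 & tr & _ & _ & _ & Hin & _ & _ & -> & _). now apply HQ.
      * split; [exact HC''|].
        intros q v (q0 & v0 & d & v1 & tr & H1 & H2 & H3 & H4 & H5 & H6 & -> & ->). apply Hpost.
        exists q0, v0, d, v1, tr. split; [now apply Hsub|]. split; [exact H2|].
        split; [exact H3|]. split; [exact H4|]. split; [exact H5|]. split; [exact H6|].
        split; [reflexivity|]. apply functional_extensionality. intros i. unfold jreset.
        destruct (Nat.ltb_spec i k) as [Hi|Hi]; [|reflexivity].
        replace (existsb (Nat.eqb i) X') with (existsb (Nat.eqb i) X); [reflexivity|].
        apply eq_iff_eq_true. rewrite !existsb_In. unfold X'. rewrite filter_In, existsb_In, in_seq.
        split; [intros K; split; [lia|exact K]|tauto].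
  - apply (memb_In position_inj), HW. exists C0, C0. split; [apply startb_code|].
    split; [now apply HFam|]. split; [|auto]. intros q v Hq. apply HC0 in Hq as [_ Hq].
    now apply Hini.
Qed.

End Correctness.

(** * From the game to separators *)

Definition lit (b : bool) (g : guard) : guard := if b then g else GNot g.

Definition region_atoms (D m k : nat) (u : list nat) : list guard :=
  flat_map (fun i => flat_map (fun z =>
    lit (nth i u 0 <=? z * D) (GAtom i CLe (Z.of_nat z)) ::
    lit (z * D <=? nth i u 0) (GAtom i CGe (Z.of_nat z)) ::
    flat_map (fun j =>
      [lit (nth i u 0 <=? nth j u 0 + z * D) (GDiff i j CLe (Z.of_nat z));
       lit (nth j u 0 + z * D <=? nth i u 0) (GDiff i j CGe (Z.of_nat z))])
    (seq 0 k)) (seq 0 (S m))) (seq 0 k).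

Definition region_guard (D m k : nat) (u : list nat) : guard :=
  fold_right GAnd GTrue (region_atoms D m k u).

Lemma region_atoms_inv (Pr : guard -> Prop) D m k u :
  (forall g, In g (region_atoms D m k u) -> Pr g) <->
  (forall i z, i < k -> z <= m ->
     Pr (lit (nth i u 0 <=? z * D) (GAtom i CLe (Z.of_nat z))) /\
     Pr (lit (z * D <=? nth i u 0) (GAtom i CGe (Z.of_nat z)))) /\
  (forall i j z, i < k -> j < k -> z <= m ->
     Pr (lit (nth i u 0 <=? nth j u 0 + z * D) (GDiff i j CLe (Z.of_nat z))) /\
     Pr (lit (nth j u 0 + z * D <=? nth i u 0) (GDiff i j CGe (Z.of_nat z)))).
Proof.
  unfold region_atoms. split.
  - intros H.
    assert (H' : forall i z, i < k -> z <= m -> forall g,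
       In g (lit (nth i u 0 <=? z * D) (GAtom i CLe (Z.of_nat z)) ::
             lit (z * D <=? nth i u 0) (GAtom i CGe (Z.of_nat z)) ::
             flat_map (fun j =>
               [lit (nth i u 0 <=? nth j u 0 + z * D) (GDiff i j CLe (Z.of_nat z));
                lit (nth j u 0 + z * D <=? nth i u 0) (GDiff i j CGe (Z.of_nat z))])
             (seq 0 k)) -> Pr g).
    { intros i z Hi Hz g Hg. apply H, in_flat_map. exists i. split; [apply in_seq; lia|].
      apply in_flat_map. exists z. split; [apply in_seq; lia|exact Hg]. }
    split.
    + intros i z Hi Hz. split; apply (H' i z Hi Hz); [now left|right; now left].
    + intros i j z Hi Hj Hz.
      split; apply (H' i z Hi Hz); right; right; apply in_flat_map;
        (exists j; split; [apply in_seq; lia|]); [now left|right; now left].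
  - intros [H1 H2] g Hg. apply in_flat_map in Hg as (i & Hi & Hg).
    apply in_flat_map in Hg as (z & Hz & Hg). apply in_seq in Hi, Hz.
    destruct Hg as [<-|[<-|Hg]]; [apply H1; lia|apply H1; lia|].
    apply in_flat_map in Hg as (j & Hj & Hg). apply in_seq in Hj.
    destruct Hg as [<-|[<-|[]]]; apply H2; lia.
Qed.

Lemma sat_conj v l : sat v (fold_right GAnd GTrue l) <-> forall g, In g l -> sat v g.
Proof.
  induction l as [|g l IH]; simpl; [split; [intros _ g []|auto]|]. rewrite IH. split.
  - intros [H1 H2] g' [<-|Hg]; auto.
  - auto.
Qed.

Lemma sat_lit v b g : sat v (lit b g) <-> (sat v g <-> b = true).
Proof. destruct b; simpl; intuition congruence. Qed.

Lemma sat_region_guard D m k u v : 0 < D ->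
  sat v (region_guard D m k u) <-> eqv (lt_pred k) m v (gval D u).
Proof.
  intros HD. unfold region_guard. rewrite sat_conj, region_atoms_inv. unfold eqv, gval, lt_pred.
  assert (Hge : forall a b : R, (a >= b <-> b <= a)%R) by (intros; split; lra).
  split; intros [H1 H2]; split.
  - intros i z Hi Hz. destruct (H1 i z Hi Hz) as [A B].
    rewrite sat_lit, Nat.leb_le in A, B. simpl in A, B. rewrite <- INR_IZR_INZ in A, B.
    rewrite div_le_nat, div_ge_nat by exact HD. rewrite Hge in B. tauto.
  - intros i j z Hi Hj Hz. destruct (H2 i j z Hi Hj Hz) as [A B].
    rewrite sat_lit, Nat.leb_le in A, B. simpl in A, B. rewrite <- INR_IZR_INZ in A, B.
    rewrite div_le_iff, div_ge_iff by exact HD. rewrite <- A, <- B.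
    split; split; intros; lra.
  - intros i z Hi Hz. destruct (H1 i z Hi Hz) as [A B].
    rewrite div_le_nat in A by exact HD. rewrite div_ge_nat in B by exact HD.
    rewrite !sat_lit, !Nat.leb_le. simpl. rewrite <- INR_IZR_INZ, Hge. tauto.
  - intros i j z Hi Hj Hz. destruct (H2 i j z Hi Hj Hz) as [A B].
    rewrite div_le_iff in A by exact HD. rewrite div_ge_iff in B by exact HD.
    rewrite !sat_lit, !Nat.leb_le. simpl. rewrite <- INR_IZR_INZ, <- A, <- B.
    split; split; intros; lra.
Qed.

Lemma region_guard_wf D m k u :
  guard_clocks_lt k (region_guard D m k u) /\ guard_consts_le m (region_guard D m k u).
Proof.
  assert (H : forall g, In g (region_atoms D m k u) -> guard_clocks_lt k g /\ guard_consts_le m g).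
  { apply region_atoms_inv. split.
    - intros i z Hi Hz. split; (destruct (_ <=? _); simpl; lia).
    - intros i j z Hi Hj Hz. split; (destruct (_ <=? _); simpl; lia). }
  unfold region_guard. induction (region_atoms D m k u) as [|g l IH]; simpl; [auto|].
  destruct (H g (or_introl eq_refl)). destruct IH; [|auto]. intros g' Hg'. apply H. now right.
Qed.

Lemma find_ext {X} (f g : X -> bool) l : (forall x, f x = g x) -> find f l = find g l.
Proof. intros H. induction l as [|x l IH]; [reflexivity|]. simpl. now rewrite H, IH. Qed.

Section GameToSeparator.
Variables (k n : nat) (P : params) (A B : TA) (nodes : list node) (Q : nat -> Prop).
Hypothesis HN : pN P = k + n.
Hypothesis HD : S (pN P) < pD P.
Hypothesis HB : S (pN P) * ((pM P + 2) * pD P) <= pB P.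
Hypothesis Hm : pm P <= pM P.
Hypothesis HU : bounded_guards (union_trans A B) n (pM P).
Hypothesis Hnodes : forall q g, In (q, g) nodes <-> Q q /\ In g (vectors (pN P) (pB P)).
Hypothesis HQ : forall tr, In tr (union_trans A B) -> Q (tgt tr).
Hypothesis HwfA : wf_TA A.
Hypothesis HwfB : wf_TA B.
Hypothesis Halph : alph A = alph B.

Let raws := map raw_of (union_trans A B).
Let ini := map (loc false) (init A) ++ map (loc true) (init B).
Let fa := map (loc false) (final A).
Let fb := map (loc true) (final B).
Hypothesis Hini : forall q, In q ini -> Q q.

Variable W : list (list node).
Hypothesis HW : closedb k P raws nodes (alph A) fa fb W = true.
Hypothesis HWn : forall p, In p W -> incl p nodes.
Hypothesis Hstart : In (startb P nodes ini) W.

Let p0 := startb P nodes ini.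
Let D := pD P.
Notation "v ~~ w" := (eqv (lt_pred (k + n)) (pM P) v w) (at level 70).
Notation nx p a u X := (next k P raws nodes p a u X).

Definition same_region (u u' : list nat) : bool := eqvb D k (pm P) u u'.
(** A region has many grid points, possibly with different answers. Keeping only the first one in
    the enumeration makes the guards of distinct observations disjoint, which gives determinism. *)
Definition canonical (u : list nat) : bool :=
  match find (same_region u) (vectors k (pB P)) with
  | Some u' => enc u =? enc u'
  | None => false
  end.
Definition observations : list (list nat) := filter canonical (vectors k (pB P)).
Definition answer (p : list node) (a : nat) (u : list nat) : list nat :=
  match find (fun X => memb (nx p a u X) W) (powerset (seq 0 k)) with
  | Some X => X
  | None => []
  end.
Definition sep_trans (p : list node) (a : nat) (u : list nat) : transition :=
  Trans (enc p) (Some a) (region_guard D (pm P) k u) (answer p a u)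
    (enc (nx p a u (answer p a u))).
(** Its locations are the codes of the positions in [W], and a position is final when [A] can
    silently finish from it; by closedness [B] then cannot. *)
Definition separator : TA :=
  MkTA (alph A) k [enc p0] (map enc (filter (hasb k P raws nodes fa) W))
    (flat_map (fun p => flat_map (fun a => map (sep_trans p a) observations)
       (seq 0 (alph A))) W).

Lemma D_pos' : 0 < D. Proof. unfold D. lia. Qed.

Lemma same_region_spec u u' : same_region u u' = true <->
  eqv (lt_pred k) (pm P) (gval D u) (gval D u').
Proof. apply eqvb_spec, D_pos'. Qed.

Lemma in_sep_trans tr : In tr (trans separator) <->
  exists p a u, In p W /\ a < alph A /\ In u observations /\ tr = sep_trans p a u.
Proof.
  simpl. rewrite in_flat_map. split.
  - intros (p & Hp & K). apply in_flat_map in K as (a & Ha & K). apply in_map_iff in K as (u & <- & Hu).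
    apply in_seq in Ha. exists p, a, u. repeat split; auto; lia.
  - intros (p & a & u & Hp & Ha & Hu & ->). exists p. split; [exact Hp|].
    apply in_flat_map. exists a. split; [apply in_seq; lia|]. now apply in_map.
Qed.

Lemma canonical_unique u u' : In u observations -> In u' observations ->
  same_region u u' = true -> u = u'.
Proof.
  intros Hu Hu' He. apply filter_In in Hu as [_ Hu], Hu' as [_ Hu']. unfold canonical in *.
  assert (E : find (same_region u') (vectors k (pB P)) = find (same_region u) (vectors k (pB P))).
  { apply find_ext. intros x. apply eq_iff_eq_true. rewrite same_region_spec in He. rewrite !same_region_spec.
    split; intros K; eapply eqv_trans; [exact He|exact K|apply eqv_sym, He|exact K]. }
  rewrite E in Hu'. destruct (find (same_region u) (vectors k (pB P))) as [x|]; [|discriminate].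
  apply Nat.eqb_eq in Hu, Hu'. apply (enc_list_inj nat enc_nat_inj). congruence.
Qed.

Lemma observation_of v : clock_valuation v ->
  exists u, In u observations /\ eqv (lt_pred k) (pm P) v (gval D u).
Proof.
  intros Nv. destruct (grid_rep k (pm P) D (pB P) v) as (g & Hl & Hb & He); auto.
  - unfold D. lia.
  - unfold D. nia.
  - assert (Hg : In g (vectors k (pB P))) by now apply in_vectors.
    destruct (find (same_region g) (vectors k (pB P))) as [u|] eqn:Ef.
    2:{ pose proof (find_none _ _ Ef g Hg) as K. simpl in K.
        assert (same_region g g = true) by (apply same_region_spec, eqv_refl). congruence. }
    pose proof (find_some _ _ Ef) as [Hu Hgu]. exists u. split.
    + apply filter_In. split; [exact Hu|]. unfold canonical.
      assert (E : find (same_region u) (vectors k (pB P)) = find (same_region g) (vectors k (pB P))).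
      { apply find_ext. intros x. apply eq_iff_eq_true. rewrite same_region_spec in Hgu. rewrite !same_region_spec.
        split; intros K; eapply eqv_trans; [exact Hgu|exact K|apply eqv_sym, Hgu|exact K]. }
      rewrite E, Ef. apply Nat.eqb_refl.
    + apply same_region_spec in Hgu. eapply eqv_trans; [apply eqv_sym, He|exact Hgu].
Qed.

Lemma answer_spec p a u : In p W -> a < alph A -> In u observations ->
  incl (answer p a u) (seq 0 k) /\ In (nx p a u (answer p a u)) W.
Proof.
  intros Hp Ha Hu. apply filter_In in Hu as [Hu _].
  unfold closedb in HW. rewrite forallb_forall in HW. specialize (HW p Hp).
  apply andb_prop in HW as [_ K]. rewrite forallb_forall in K.
  specialize (K a ltac:(apply in_seq; lia)). rewrite forallb_forall in K. specialize (K u Hu).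
  apply existsb_exists in K as (X & HX & HXW). unfold answer.
  destruct (find _ (powerset (seq 0 k))) as [Y|] eqn:Ef.
  - apply find_some in Ef as [HY HYW]. split; [now apply powerset_incl|].
    now apply (memb_In position_inj).
  - pose proof (find_none _ _ Ef X HX) as K. simpl in K. congruence.
Qed.

Lemma position_safe p : In p W -> hasb k P raws nodes fa p = true ->
  hasb k P raws nodes fb p = true -> False.
Proof.
  intros Hp Ha Hb. unfold closedb in HW. rewrite forallb_forall in HW. specialize (HW p Hp).
  apply andb_prop in HW as [K _]. rewrite Ha, Hb in K. discriminate.
Qed.

Lemma separator_deterministic : deterministic separator.
Proof.
  split; [|split].
  - intros tr Htr. apply in_sep_trans in Htr as (p & a & u & _ & _ & _ & ->). discriminate.
  - exists (enc p0). intros q. simpl. split; [intros [K|[]]; auto|auto].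
  - intros tr1 tr2 H1 H2 Hs Hl (v & Nv & S1 & S2).
    apply in_sep_trans in H1 as (p & a & u & Hp & Ha & Hu & ->).
    apply in_sep_trans in H2 as (p' & a' & u' & Hp' & Ha' & Hu' & ->).
    simpl src in Hs. simpl lab in Hl. simpl grd in S1, S2.
    apply position_inj in Hs. injection Hl as ->. subst p'.
    rewrite sat_region_guard in S1, S2 by apply D_pos'.
    assert (u = u') as <-; [|split; [reflexivity|tauto]].
    apply canonical_unique; auto. apply same_region_spec. eapply eqv_trans; [apply eqv_sym, S1|exact S2].
Qed.

Lemma separator_wf : wf_TA separator.
Proof.
  intros tr Htr. apply in_sep_trans in Htr as (p & a & u & Hp & Ha & Hu & ->). split; [|split].
  - intros a' E. injection E as <-. exact Ha.
  - apply region_guard_wf.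
  - intros x Hx. destruct (answer_spec p a u Hp Ha Hu) as [K _]. apply K, in_seq in Hx.
    change (x < k). lia.
Qed.

Lemma separator_const : max_const_le separator (pm P).
Proof.
  intros tr Htr. apply in_sep_trans in Htr as (p & a & u & _ & _ & _ & ->). apply region_guard_wf.
Qed.

Lemma side_wf b : wf_TA (side A B b) /\ alph (side A B b) = alph A.
Proof. destruct b; auto. Qed.

(** The run is cut at its letters. Since the last letter, read at time [ts], only the node [g0] of
    the current position and the silent run from [v0] to the present joint valuation [J] are
    remembered. *)
Lemma follow_run b q v t w qf : runs (side A B b) q v t w qf ->
  forall p J sv ts q0 g0 v0 d, In p W -> clock_valuation sv -> (ts <= t)%R ->
  (forall x, x < k -> J x = (sv x + (t - ts))%R) -> av k J = v ->
  In (q0, g0) p -> v0 ~~ gval D g0 -> clock_valuation v0 ->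
  erun k (union_trans A B) q0 v0 d (loc b q) J ->
  exists p' sv' ts', In p' W /\ srun separator (enc p) sv ts w (enc p') sv' ts' /\
    exists g, In (loc b qf, g) (reach k P raws nodes p').
Proof.
  induction 1 as [q v t|q v t tr t' w qf Hin Hsrc Hlab Ht Hs Hr IH|q v t tr a t' w qf Hin Hsrc Hlab Ht Hs Hr IH];
    intros p J sv ts q0 g0 v0 d Hp Nsv Hts HJ Hav Hg0 E0 N0 Her;
    destruct (erun_nonneg _ _ _ _ _ _ _ Her N0) as [_ NJ].
  - exists p, sv, ts. split; [exact Hp|]. split; [constructor|].
    assert (Qq : Q (loc b q)).
    { apply (erun_loc k _ Q HQ _ _ _ _ _ Her). apply (Hnodes q0 g0). now apply (HWn p). }
    destruct (node_cover k n P nodes Q HN HD HB Hm Hnodes (loc b q) J Qq NJ) as (g & Hg & Eg).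
    exists g. apply (reach_complete k n P (union_trans A B) nodes Q HN HD HB Hm HU Hnodes HQ)
      with q0 v0 d J g0; auto. now apply eqv_sym.
  - set (J1 := shift J (t' - t)).
    assert (Er1 : erun k (union_trans A B) q0 v0 (d + (t' - t)) (loc b q) J1).
    { eapply erun_trans; [exact Her|]. apply erun_delay. lra. }
    assert (Hav1 : av k J1 = shift v (t' - t)) by (unfold J1; now rewrite av_shift, Hav).
    apply IH with (J := jreset k J1 [] (rst tr)) (q0 := q0) (g0 := g0) (v0 := v0)
      (d := (d + (t' - t) + 0)%R); auto; [lra| | |].
    + intros x Hx. unfold jreset, J1, shift. apply Nat.ltb_lt in Hx as Hb. rewrite Hb. simpl.
      rewrite HJ by exact Hx. ring.
    + now rewrite av_jreset, Hav1.
    + eapply erun_trans; [exact Er1|]. subst q.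
      apply (er_eps k (union_trans A B) (ren b tr)); simpl; auto.
      * apply in_union_trans. now exists b, tr.
      * now rewrite Hav1.
      * constructor.
  - set (J1 := shift J (t' - t)).
    assert (NJ1 : clock_valuation J1) by (apply clock_valuation_shift; [exact NJ|lra]).
    assert (Er1 : erun k (union_trans A B) q0 v0 (d + (t' - t)) (loc b q) J1).
    { eapply erun_trans; [exact Her|]. apply erun_delay. lra. }
    assert (Hav1 : av k J1 = shift v (t' - t)) by (unfold J1; now rewrite av_shift, Hav).
    destruct (observation_of J1 NJ1) as (u & Hu & Eu).
    assert (Ha : a < alph A).
    { destruct (side_wf b) as [Hwf <-]. now apply (Hwf tr Hin). }
    destruct (answer_spec p a u Hp Ha Hu) as [HX HpX]. set (X := answer p a u) in *.
    assert (Hin' : In (ren b tr) (union_trans A B)) by (apply in_union_trans; now exists b, tr).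
    set (J2 := jreset k J1 X (rst tr)).
    assert (NJ2 : clock_valuation J2) by now apply clock_valuation_jreset.
    destruct (node_cover k n P nodes Q HN HD HB Hm Hnodes (loc b (tgt tr)) J2 (HQ _ Hin') NJ2)
      as (g2 & Hg2 & Eg2).
    assert (HJ1 : forall x, x < k -> J1 x = shift sv (t' - ts) x).
    { intros x Hx. unfold J1, shift. rewrite HJ by exact Hx. ring. }
    (* After the letter the bookkeeping restarts: [J2] is its own starting point, with duration 0,
       and [g2] is a node of its region. *)
    destruct (IH (nx p a u X) J2 (reset (shift sv (t' - ts)) X) t' (loc b (tgt tr)) g2 J2 0%R)
      as (p' & sv' & ts' & Hp' & Hsr & Hg'); auto.
    + intros x. unfold reset. destruct (existsb _ X); [lra|].
      apply clock_valuation_shift; [exact Nsv|lra].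
    + lra.
    + intros x Hx. unfold J2, jreset, reset. apply Nat.ltb_lt in Hx as Hb. rewrite Hb.
      destruct (existsb _ X); [ring|]. rewrite HJ1 by exact Hx. ring.
    + unfold J2. now rewrite av_jreset, Hav1.
    + apply (next_complete k n P (union_trans A B) nodes Q HN HD HB Hm HU Hnodes HQ p a u X
        q0 v0 (d + (t' - t)) J1 (ren b tr) g0 g2); auto.
      * simpl. now rewrite Hsrc.
      * simpl. now rewrite Hav1.
      * now apply eqv_sym.
    + now apply eqv_sym.
    + constructor.
    + exists p', sv', ts'. split; [exact Hp'|]. split; [|exact Hg'].
      apply (sr_cons separator (sep_trans p a u)); simpl; auto; [|lra|].
      * apply in_sep_trans. now exists p, a, u.
      * apply sat_region_guard; [apply D_pos'|]. eapply eqv_trans; [|exact Eu].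
        apply eqv_agree. intros x Hx. symmetry. now apply HJ1.
Qed.

Lemma follow_word b w : accepts (side A B b) w ->
  exists p' sv' ts', In p' W /\ srun separator (enc p0) (fun _ => 0%R) 0 w (enc p') sv' ts' /\
    hasb k P raws nodes (map (loc b) (final (side A B b))) p' = true.
Proof.
  intros (q0 & qf & Hq0 & Hqf & Hr).
  assert (N0 : clock_valuation (fun _ => 0%R)) by (intros i; lra).
  assert (Hi : In (loc b q0) ini).
  { unfold ini. apply in_or_app. destruct b; [right|left]; now apply in_map. }
  destruct (node_cover k n P nodes Q HN HD HB Hm Hnodes (loc b q0) (fun _ => 0%R) (Hini _ Hi) N0)
    as (g & Hg & Eg).
  destruct (follow_run b q0 _ 0%R w qf Hr p0 (fun _ => 0%R) (fun _ => 0%R) 0%R (loc b q0) g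
              (fun _ => 0%R) 0%R) as (p' & sv' & ts' & Hp' & Hsr & g' & Hg'); auto.
  - intros; ring.
  - unfold p0. apply filter_In. split; [exact Hg|]. simpl. apply andb_true_iff. split.
    + now apply (memb_In enc_nat_inj).
    + apply (eqvb_iff k n P HN HD HB Hm). replace (gval (pD P) []) with (fun _ : nat => 0%R); [exact Eg|].
      apply functional_extensionality. intros i. unfold gval. destruct i; simpl; unfold Rdiv; ring.
  - now apply eqv_sym.
  - constructor.
  - exists p', sv', ts'. split; [exact Hp'|]. split; [exact Hsr|].
    apply existsb_exists. exists (loc b qf, g'). split; [exact Hg'|].
    apply (memb_In enc_nat_inj). now apply (in_map (loc b)).
Qed.

Lemma separator_separates : separates separator A B.
Proof.
  split.
  - intros w Hw. destruct (follow_word false w Hw) as (p' & sv' & ts' & Hp' & Hsr & Hh).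
    exists (enc p0), (enc p'). split; [now left|]. split.
    + simpl. apply in_map, filter_In. auto.
    + eapply runs_of_srun; eauto.
  - intros w [(s1 & sf & Hs1 & Hsf & Hrun) HwB].
    destruct Hs1 as [<-|[]].
    destruct (follow_word true w HwB) as (p' & sv' & ts' & Hp' & Hsr & Hh).
    destruct (srun_of_runs separator (proj1 separator_deterministic) _ _ _ _ _ Hrun) as (sv & ts & Hsr').
    destruct (srun_unique _ separator_deterministic _ _ _ _ _ _ _ Hsr ltac:(intros i; lra) _ _ _ Hsr')
      as [E _].
    simpl in Hsf. apply in_map_iff in Hsf as (p'' & E' & Hp''). rewrite <- E' in E.
    apply position_inj in E. subst p''. apply filter_In in Hp'' as [_ Hha].
    now apply (position_safe p').
Qed.

Lemma separable_of_closed : km_det_separable k (pm P) A B.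
Proof.
  exists separator. split; [apply separator_wf|]. split; [reflexivity|].
  split; [apply separator_deterministic|]. split; [apply le_n|].
  split; [apply separator_const|apply separator_separates].
Qed.

End GameToSeparator.

(** * Decidability *)

Section ComputableAlgorithm.
Context {E : Type} `{Enc E}.

Lemma cmp_memb {X} `{Enc X} (x : E -> X) (l : E -> list X) : computable x -> computable l ->
  computable (fun e => memb (x e) (l e)).
Proof. intros. unfold memb. cmp. Qed.

Lemma cmp_eqvb (D N M : E -> nat) (g h : E -> list nat) : computable D -> computable N ->
  computable M -> computable g -> computable h ->
  computable (fun e => eqvb (D e) (N e) (M e) (g e) (h e)).
Proof. intros. unfold eqvb. cmp. Qed.

End ComputableAlgorithm.

Ltac cmp_user ::=
  first [ simple apply cmp_memb | simple apply cmp_eqvb | simple apply cmp_gsatb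
        | simple apply cmp_gokb | cmp_lists ].

Section ComputableAlgorithm2.
Context {E : Type} `{Enc E}.
Variable k : nat.

Lemma cmp_jresetb (N : E -> nat) (X r g : E -> list nat) : computable N ->
  computable X -> computable r -> computable g ->
  computable (fun e => jresetb k (N e) (X e) (r e) (g e)).
Proof. intros. unfold jresetb. cmp. Qed.

Lemma cmp_delayb (D N M B : E -> nat) (g g' : E -> list nat) : computable D -> computable N ->
  computable M -> computable B -> computable g -> computable g' ->
  computable (fun e => delayb (D e) (N e) (M e) (B e) (g e) (g' e)).
Proof. intros. unfold delayb. cmp. Qed.

End ComputableAlgorithm2.

Ltac cmp_user ::=
  first [ simple apply cmp_memb | simple apply cmp_eqvb | simple apply cmp_gsatb
        | simple apply cmp_gokb | simple apply cmp_jresetb | simple apply cmp_delayb | cmp_lists ].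

Lemma cmp_stepb {E} `{Enc E} k (P : E -> params) (raws : E -> list rawtr) (nd nd' : E -> node) :
  computable P -> computable raws -> computable nd -> computable nd' ->
  computable (fun e => stepb k (P e) (raws e) (nd e) (nd' e)).
Proof. intros. unfold stepb, pD, pN, pM, pB, rlab, rsrc, rtgt, rgrd, rrst. cmp. Qed.

Ltac cmp_user ::=
  first [ simple apply cmp_stepb | simple apply cmp_memb | cmp_lists ].

Lemma cmp_reach {E} `{Enc E} k (P : E -> params) (raws : E -> list rawtr)
  (nodes p : E -> list node) : computable P -> computable raws -> computable nodes ->
  computable p -> computable (fun e => reach k (P e) (raws e) (nodes e) (p e)).
Proof. intros. unfold reach, reachb, step_closedb. cmp. Qed.

Ltac cmp_user ::=
  first [ simple apply cmp_reach | simple apply cmp_memb | simple apply cmp_eqvb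
        | simple apply cmp_gsatb | simple apply cmp_jresetb | cmp_lists ].

Lemma cmp_next {E} `{Enc E} k (P : E -> params) (raws : E -> list rawtr)
  (nodes p : E -> list node) (a : E -> nat) (u X : E -> list nat) :
  computable P -> computable raws -> computable nodes ->
  computable p -> computable a -> computable u -> computable X ->
  computable (fun e => next k (P e) (raws e) (nodes e) (p e) (a e) (u e) (X e)).
Proof.
  intros. unfold next, letterb, pD, pN, pM, pm, rlab, rsrc, rtgt, rgrd, rrst. cmp.
Qed.

Lemma cmp_hasb {E} `{Enc E} k (P : E -> params) (raws : E -> list rawtr)
  (nodes : E -> list node) (fin : E -> list nat) (p : E -> list node) :
  computable P -> computable raws -> computable nodes -> computable fin -> computable p ->
  computable (fun e => hasb k (P e) (raws e) (nodes e) (fin e) (p e)).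
Proof. intros. unfold hasb. cmp. Qed.

Ltac cmp_user ::=
  first [ simple apply cmp_next | simple apply cmp_hasb | simple apply cmp_memb
        | simple apply cmp_eqvb | cmp_lists ].

Lemma cmp_winb {E} `{Enc E} k (P : E -> params) (raws : E -> list rawtr)
  (nodes : E -> list node) (al : E -> nat) (ini fa fb : E -> list nat) :
  computable P -> computable raws -> computable nodes ->
  computable al -> computable ini -> computable fa -> computable fb ->
  computable (fun e => winb k (P e) (raws e) (nodes e) (al e) (ini e) (fa e) (fb e)).
Proof.
  intros. unfold winb, closedb, startb, pD, pN, pM, pB. cmp.
Qed.

(* Every location, clock and constant of an instance is bounded by its code. *)
Definition par (k m c : nat) : params :=
  let N := k + c in let M := m + c + 1 in let D := N + 2 in
  (D, (N, (M, (S N * ((M + 2) * D), m)))).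
(** A location [p < c] becomes at most [2 * p + 1] in the union, hence lies below [2 * c + 2]. *)
Definition all_nodes (k m c : nat) : list node :=
  list_prod (seq 0 (2 * c + 2)) (vectors (pN (par k m c)) (pB (par k m c))).

Definition raw_side (b : bool) (l : list nat) : list rawtr :=
  map (fun tc => (loc b (nth 0 (tolist tc) 0), (nth 1 (tolist tc) 0, (nth 2 (tolist tc) 0,
         (tolist (nth 3 (tolist tc) 0), loc b (nth 4 (tolist tc) 0)))))) (tolist (nth 4 l 0)).
Definition left_code (c : nat) : list nat := tolist (ufst c).
Definition right_code (c : nat) : list nat := tolist (usnd c).

Definition km_test (k m c : nat) : bool :=
  winb k (par k m c) (raw_side false (left_code c) ++ raw_side true (right_code c))
    (all_nodes k m c) (nth 0 (left_code c) 0)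
    (map (loc false) (tolist (nth 2 (left_code c) 0)) ++ map (loc true) (tolist (nth 2 (right_code c) 0)))
    (map (loc false) (tolist (nth 3 (left_code c) 0)))
    (map (loc true) (tolist (nth 3 (right_code c) 0))).

Definition trans_okb (al nc tc : nat) : bool :=
  (length (tolist tc) =? 5) && (nth 1 (tolist tc) 0 <=? al) && gokb nc (nth 2 (tolist tc) 0) &&
  forallb (fun x => x <? nc) (tolist (nth 3 (tolist tc) 0)).
Definition ta_okb (l : list nat) : bool :=
  (length l =? 5) && forallb (trans_okb (nth 0 l 0) (nth 1 l 0)) (tolist (nth 4 l 0)).
Definition instance_okb (c : nat) : bool :=
  ta_okb (left_code c) && ta_okb (right_code c) && (nth 0 (left_code c) 0 =? nth 0 (right_code c) 0).

(** Tick observations use constants at most 1, so the grid for [m = 0], whose constant is [c + 1],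
    serves whatever constant the given strategy has. *)
Definition const_bound (k c : nat) : nat := tick_bound k (all_nodes k 0 c).

Lemma cmp_ufst {E} `{Enc E} (f : E -> nat) : computable f -> computable (fun e => ufst (f e)).
Proof.
  intros (F & HF & EF). exists (fun n => ufst (F n)). split.
  - exact (comp1_comp _ _ HF comp1_fst).
  - intros e. now rewrite EF.
Qed.

Lemma cmp_usnd {E} `{Enc E} (f : E -> nat) : computable f -> computable (fun e => usnd (f e)).
Proof.
  intros (F & HF & EF). exists (fun n => usnd (F n)). split.
  - exact (comp1_comp _ _ HF comp1_snd).
  - intros e. now rewrite EF.
Qed.

Ltac cmp_user ::=
  first [ simple apply cmp_ufst | simple apply cmp_usnd | simple apply cmp_memb
        | simple apply cmp_gokb | cmp_lists ].

Lemma cmp_par k (m : nat -> nat) : computable m -> computable (fun c => par k (m c) c).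
Proof. intros. unfold par, params. cbv zeta. cmp. Qed.

Lemma cmp_all_nodes k (m : nat -> nat) : computable m ->
  computable (fun c => all_nodes k (m c) c).
Proof. intros. unfold all_nodes, node, pN, pB, par. cbv zeta. cmp. Qed.

Lemma cmp_raw_side b (l : nat -> list nat) : computable l ->
  computable (fun c => raw_side b (l c)).
Proof. intros. unfold raw_side, rawtr, loc. cmp. Qed.

Lemma cmp_km_test k (m : nat -> nat) : computable m -> computable (fun c => km_test k (m c) c).
Proof.
  intros Hm. unfold km_test.
  assert (computable left_code) by (unfold left_code; cmp).
  assert (computable right_code) by (unfold right_code; cmp).
  apply cmp_winb.
  - now apply cmp_par.
  - apply cmp_app; now apply cmp_raw_side.
  - now apply cmp_all_nodes.
  - cmp.
  - unfold loc. cmp.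
  - unfold loc. cmp.
  - unfold loc. cmp.
Qed.

Lemma cmp_instance_okb : computable instance_okb.
Proof. unfold instance_okb, ta_okb, trans_okb, left_code, right_code. cmp. Qed.

Lemma cmp_const_bound k : computable (const_bound k).
Proof.
  unfold const_bound, tick_bound, tick_states, keys.
  assert (computable (fun c => all_nodes k 0 c)) by (apply (cmp_all_nodes k (fun _ => 0)); cmp).
  cmp.
Qed.

Lemma raw_side_enc b A : raw_side b (tolist (enc_TA A)) = map raw_of (map (ren b) (trans A)).
Proof.
  unfold raw_side, enc_TA. rewrite tolist_enc_list. simpl nth. rewrite tolist_enc_list, !map_map.
  apply map_ext. intros tr. unfold enc_trans. rewrite tolist_enc_list. simpl nth.
  rewrite tolist_enc_list. reflexivity.
Qed.

Lemma lside_enc A B : left_code (enc_instance A B) = tolist (enc_TA A).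
Proof. unfold left_code, enc_instance. now rewrite ufst_pair. Qed.

Lemma rside_enc A B : right_code (enc_instance A B) = tolist (enc_TA B).
Proof. unfold right_code, enc_instance. now rewrite usnd_pair. Qed.

Lemma trans_okb_spec al nc tc : trans_okb al nc tc = true <->
  exists tr, tc = enc_trans tr /\ (forall a, lab tr = Some a -> a < al) /\
    guard_clocks_lt nc (grd tr) /\ (forall x, In x (rst tr) -> x < nc).
Proof.
  unfold trans_okb. split.
  - rewrite !andb_true_iff, forallb_forall. intros (((Hl & Ha) & Hg) & Hr).
    apply Nat.eqb_eq in Hl. apply Nat.leb_le in Ha. apply gokb_dec in Hg as (g & Eg & Hg).
    rewrite <- (enc_list_tolist tc). destruct (tolist tc) as [|s [|l [|gc [|r [|t [|x y]]]]]]; try discriminate.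
    simpl in *. subst gc.
    exists (Trans s (match l with 0 => None | S a => Some a end) g (tolist r) t).
    split; [|split; [|split]].
    + unfold enc_trans. simpl. rewrite enc_list_tolist. now destruct l.
    + simpl. intros a E. destruct l as [|a']; [discriminate|]. injection E as <-. lia.
    + exact Hg.
    + simpl. intros x Hx. apply Nat.ltb_lt. now apply Hr.
  - intros (tr & -> & Ha & Hg & Hr). unfold enc_trans. rewrite tolist_enc_list.
    simpl nth. simpl length. rewrite tolist_enc_list, !andb_true_iff, forallb_forall.
    repeat split; auto.
    + apply Nat.leb_le. destruct (lab tr); simpl; [now apply Ha|lia].
    + now apply gokb_enc.
    + intros x Hx. apply Nat.ltb_lt. now apply Hr.
Qed.

Lemma ta_okb_spec a : ta_okb (tolist a) = true <-> exists A, a = enc_TA A /\ wf_TA A.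
Proof.
  unfold ta_okb. split.
  - rewrite andb_true_iff, forallb_forall. intros [Hl Ht]. apply Nat.eqb_eq in Hl.
    rewrite <- (enc_list_tolist a). destruct (tolist a) as [|al [|nc [|i [|f [|t [|x y]]]]]]; try discriminate.
    simpl in Ht.
    assert (Htr : exists trs, tolist t = map enc_trans trs /\ forall tr, In tr trs ->
       (forall a, lab tr = Some a -> a < al) /\ guard_clocks_lt nc (grd tr) /\
       (forall x, In x (rst tr) -> x < nc)).
    { induction (tolist t) as [|tc l IH]; [exists []; split; [reflexivity|intros tr []]|].
      destruct IH as (trs & -> & IH); [intros x Hx; apply Ht; now right|].
      destruct (proj1 (trans_okb_spec al nc tc) (Ht tc (or_introl eq_refl))) as (tr & -> & Htr).
      exists (tr :: trs). split; [reflexivity|]. intros tr' [<-|Hin]; auto. }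
    destruct Htr as (trs & Et & Htr).
    exists (MkTA al nc (tolist i) (tolist f) trs). split; [|exact Htr].
    unfold enc_TA. simpl alph. simpl nclk. simpl init. simpl final. simpl trans.
    now rewrite <- Et, !enc_list_tolist.
  - intros (A & -> & Hwf). unfold enc_TA. rewrite tolist_enc_list. simpl length. simpl nth.
    rewrite tolist_enc_list, andb_true_iff, forallb_forall. split; [reflexivity|].
    intros tc Htc. apply in_map_iff in Htc as (tr & <- & Htr). apply trans_okb_spec.
    exists tr. split; [reflexivity|]. now apply Hwf.
Qed.

Lemma instance_okb_spec c : instance_okb c = true <->
  exists A B, c = enc_instance A B /\ valid_instance A B.
Proof.
  unfold instance_okb. split.
  - rewrite !andb_true_iff. unfold left_code, right_code. intros [[HA HB] Hal].
    apply ta_okb_spec in HA as (A & EA & HA), HB as (B & EB & HB).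
    exists A, B. split; [unfold enc_instance; now rewrite <- EA, <- EB, pair_unpair|].
    split; [exact HA|]. split; [exact HB|]. rewrite EA, EB in Hal. unfold enc_TA in Hal.
    rewrite !tolist_enc_list in Hal. now apply Nat.eqb_eq in Hal.
  - intros (A & B & -> & HA & HB & Hal). rewrite lside_enc, rside_enc, !andb_true_iff. split; [split|].
    + apply ta_okb_spec. now exists A.
    + apply ta_okb_spec. now exists B.
    + unfold enc_TA. rewrite !tolist_enc_list. now apply Nat.eqb_eq.
Qed.

Lemma guard_clocks_mono n n' g : n <= n' -> guard_clocks_lt n g -> guard_clocks_lt n' g.
Proof. intros Hn. induction g; simpl; intros; try tauto; lia. Qed.

Lemma guard_consts_mono n n' g : n <= n' -> guard_consts_le n g -> guard_consts_le n' g.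
Proof. intros Hn. induction g; simpl; intros; try tauto; lia. Qed.

Lemma enc_Z_ge z : (Z.abs z <= Z.of_nat (enc_Z z))%Z.
Proof. destruct z as [|p|p]; unfold enc_Z; lia. Qed.

Lemma guard_consts_enc g : guard_consts_le (enc_guard g) g.
Proof.
  induction g as [|x c z|x y c z|g IH|g1 IH1 g2 IH2|g1 IH1 g2 IH2];
    cbn [guard_consts_le enc_guard].
  - exact I.
  - pose proof (enc_Z_ge z).
    pose proof (in_enc_list (enc_Z z) [1; x; enc_cmp c; enc_Z z] ltac:(simpl; auto)). lia.
  - pose proof (enc_Z_ge z).
    pose proof (in_enc_list (enc_Z z) [2; x; y; enc_cmp c; enc_Z z] ltac:(simpl; auto 6)). lia.
  - apply guard_consts_mono with (enc_guard g); [|exact IH].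
    apply Nat.lt_le_incl, in_enc_list. simpl; auto.
  - split; [apply guard_consts_mono with (enc_guard g1)|apply guard_consts_mono with (enc_guard g2)]; auto;
      apply Nat.lt_le_incl, in_enc_list; simpl; auto.
  - split; [apply guard_consts_mono with (enc_guard g1)|apply guard_consts_mono with (enc_guard g2)]; auto;
      apply Nat.lt_le_incl, in_enc_list; simpl; auto.
Qed.

Lemma enc_side_le A B b : enc_TA (side A B b) <= enc_instance A B.
Proof.
  unfold enc_instance. pose proof (pair_nat_ge (enc_TA A) (enc_TA B)). destruct b; simpl; lia.
Qed.

Lemma nclk_lt A : nclk A < enc_TA A.
Proof. apply in_enc_list. simpl; auto. Qed.

Lemma init_lt A q : In q (init A) -> q < enc_TA A.
Proof.
  intros Hq. apply Nat.lt_trans with (enc_list (init A)); apply in_enc_list; simpl; auto.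
Qed.

Lemma trans_lt A tr : In tr (trans A) -> enc_trans tr < enc_TA A.
Proof.
  intros Htr. apply Nat.lt_trans with (enc_list (map enc_trans (trans A))); apply in_enc_list.
  - now apply in_map.
  - simpl; auto 6.
Qed.

Section Instance.
Variables (k : nat) (A B : TA).
Hypothesis Hvalid : valid_instance A B.
Let c := enc_instance A B.
Let Q := fun q => q < 2 * c + 2.

Lemma loc_bound b q : q < enc_TA (side A B b) -> Q (loc b q).
Proof.
  intros Hq. pose proof (enc_side_le A B b) as K. unfold Q, c, loc.
  destruct b; simpl Nat.b2n in *; lia.
Qed.

Lemma side_valid b : wf_TA (side A B b).
Proof. destruct Hvalid as (HA & HB & _). now destruct b. Qed.

Lemma union_bounded M : c <= M -> bounded_guards (union_trans A B) c M.
Proof.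
  intros HM tr Htr. apply in_union_trans in Htr as (b & tr0 & Htr & ->). simpl.
  pose proof (enc_side_le A B b). split.
  - apply guard_clocks_mono with (nclk (side A B b)).
    + pose proof (nclk_lt (side A B b)). unfold c. lia.
    + now apply side_valid.
  - apply guard_consts_mono with (enc_guard (grd tr0)); [|apply guard_consts_enc].
    pose proof (trans_lt _ _ Htr).
    assert (enc_guard (grd tr0) < enc_trans tr0) by (apply in_enc_list; simpl; auto).
    unfold c in HM. lia.
Qed.

Lemma union_targets tr : In tr (union_trans A B) -> Q (tgt tr).
Proof.
  intros Htr. apply in_union_trans in Htr as (b & tr0 & Htr & ->). apply loc_bound.
  apply Nat.lt_trans with (enc_trans tr0); [apply in_enc_list; simpl; auto 6|now apply trans_lt].
Qed.

Lemma in_all_nodes m q g : In (q, g) (all_nodes k m c) <->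
  Q q /\ In g (vectors (pN (par k m c)) (pB (par k m c))).
Proof. unfold all_nodes. rewrite in_prod_iff, in_seq. unfold Q. intuition lia. Qed.

Let ini := map (loc false) (init A) ++ map (loc true) (init B).

Lemma in_ini q : In q ini <-> exists b p, In p (init (side A B b)) /\ q = loc b p.
Proof.
  unfold ini. rewrite in_app_iff, !in_map_iff. split.
  - intros [(p & <- & K)|(p & <- & K)]; [exists false, p|exists true, p]; auto.
  - intros ([|] & p & K & ->); [right|left]; exists p; auto.
Qed.

Lemma ini_bound q : In q ini -> Q q.
Proof. intros Hq. apply in_ini in Hq as (b & p & Hp & ->). now apply loc_bound, init_lt. Qed.

Lemma km_test_eq m : km_test k m c = winb k (par k m c) (map raw_of (union_trans A B))
  (all_nodes k m c) (alph A) ini (map (loc false) (final A)) (map (loc true) (final B)).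
Proof.
  unfold km_test, c. rewrite lside_enc, rside_enc, !raw_side_enc, <- map_app.
  fold (union_trans A B).
  unfold enc_TA. rewrite !tolist_enc_list. simpl nth. rewrite !tolist_enc_list. reflexivity.
Qed.

Lemma par_facts m : pN (par k m c) = k + c /\ S (pN (par k m c)) < pD (par k m c) /\
  S (pN (par k m c)) * ((pM (par k m c) + 2) * pD (par k m c)) <= pB (par k m c) /\
  pm (par k m c) = m /\ pm (par k m c) <= pM (par k m c) /\ c < pM (par k m c).
Proof. unfold par, pN, pD, pM, pB, pm. simpl fst. simpl snd. repeat split; lia. Qed.

Lemma km_test_of_Gwin m :
  Gwin k (union_trans A B) (union_final A false) (union_final B true) m (union_init A B) ->
  km_test k m c = true.
Proof.
  intros HG. rewrite km_test_eq.
  destruct (par_facts m) as (F1 & F2 & F3 & F4 & F5 & F6).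
  apply (winb_of_Gwin k c (par k m c) (union_trans A B) (all_nodes k m c) Q F1 F2 F3 F5)
    with (FA := union_final A false) (FB := union_final B true) (C0 := union_init A B).
  - apply union_bounded. lia.
  - apply in_all_nodes.
  - apply union_targets.
  - intros q. unfold union_final. rewrite in_map_iff.
    split; intros (p & K1 & K2); exists p; auto.
  - intros q. unfold union_final. rewrite in_map_iff.
    split; intros (p & K1 & K2); exists p; auto.
  - intros q v. unfold union_init. rewrite in_ini. tauto.
  - apply ini_bound.
  - now rewrite F4.
Qed.

Lemma separable_of_km_test m : km_test k m c = true -> km_det_separable k m A B.
Proof.
  intros HT. rewrite km_test_eq in HT.
  destruct (par_facts m) as (F1 & F2 & F3 & F4 & F5 & F6).
  apply existsb_exists in HT as (W & HW & HT). apply andb_prop in HT as [Hc Hs].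
  apply (memb_In position_inj) in Hs. destruct Hvalid as (HA & HB & Hal).
  rewrite <- F4.
  apply (separable_of_closed k c (par k m c) A B (all_nodes k m c) Q F1 F2 F3 F5) with W; auto.
  - apply union_bounded. lia.
  - apply in_all_nodes.
  - apply union_targets.
  - apply ini_bound.
  - intros p Hp. apply powerset_incl. now apply (powerset_incl _ _ HW).
Qed.

Lemma km_test_spec m : km_test k m c = true <-> km_det_separable k m A B.
Proof.
  split; [apply separable_of_km_test|].
  intros H. apply km_test_of_Gwin. now apply Gwin_of_km_det_separable.
Qed.

(** Constants are bounded in the game and not on automata: a separator yields a strategy, the
    strategy is made bounded, and a new separator is built from the successful test. *)
Lemma k_det_separable_bound :
  k_det_separable k A B <-> km_det_separable k (const_bound k c) A B.
Proof.
  split; [|now exists (const_bound k c)].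
  intros [m H]. apply separable_of_km_test, km_test_of_Gwin.
  apply Gwin_of_km_det_separable in H.
  destruct (par_facts 0) as (F1 & F2 & F3 & F4 & F5 & F6).
  apply (Gwin_bounded k (union_trans A B) _ _ c (pM (par k 0 c)) (pD (par k 0 c))
           (all_nodes k 0 c) Q) with m; auto.
  - lia.
  - apply union_bounded. lia.
  - apply (node_cover k c (par k 0 c) (all_nodes k 0 c) Q F1 F2 F3 F5). apply in_all_nodes.
  - apply union_targets.
  - intros q v [-> Hq]. split; [reflexivity|]. apply ini_bound, in_ini. exact Hq.
Qed.

End Instance.

Theorem theorem1 (k m : nat) :
  decidable_set (km_det_sep_problem k m) /\ decidable_set (k_det_sep_problem k).
Proof.
  split.
  - apply decidable_of_computable with (fun c => instance_okb c && km_test k m c).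
    + apply cmp_andb; [apply cmp_instance_okb|]. apply (cmp_km_test k (fun _ => m)), cmp_const.
    + intros c. rewrite andb_true_iff, instance_okb_spec. split.
      * intros [(A & B & -> & Hv) Ht]. exists A, B. split; [reflexivity|]. split; [exact Hv|].
        now apply km_test_spec.
      * intros (A & B & -> & Hv & Hs). split; [now exists A, B|]. now apply km_test_spec.
  - apply decidable_of_computable with (fun c => instance_okb c && km_test k (const_bound k c) c).
    + apply cmp_andb; [apply cmp_instance_okb|]. apply cmp_km_test, cmp_const_bound.
    + intros c. rewrite andb_true_iff, instance_okb_spec. split.
      * intros [(A & B & -> & Hv) Ht]. exists A, B. split; [reflexivity|]. split; [exact Hv|].
        apply k_det_separable_bound; [exact Hv|]. now apply km_test_spec.
      * intros (A & B & -> & Hv & Hs). split; [now exists A, B|].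
        apply km_test_spec; [exact Hv|]. now apply k_det_separable_bound.
Qed.
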